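(* Let $A$ be a Hopf algebra over a field $k$ with bijective antipode. Let $P$ be a projective resolution of the trivial $A$-module $k$, and let $f\in\operatorname{Hom}_A(P_m,k)$ and $g\in\operatorname{Hom}_A(P_n,k)$ be cocycles, representing elements of Hopf algebra cohomology $\operatorname{H}^*(A,k)=\operatorname{Ext}_A^*(k,k)$. Let $\Delta_P:P\to P\otimes P$ be a diagonal map, and let $\psi_f,\psi_g$ be homotopy liftings of $f,g$ with respect to $\Delta_P$. Then the Gerstenhaber bracket of the corresponding elements in Hopf algebra cohomology $\operatorname{H}^*(A,k)$ is represented by $$[f,g]=f\psi_g-(-1)^{(m-1)(n-1)}g\psi_f .$$
   Context: $A$ has coproduct $\Delta(a)=\sum a_1\otimes a_2$, counit $\varepsilon$ and antipode $S$; $\otimes=\otimes_k$. The field $k$ is the trivial $A$-module via $\varepsilon$, and the tensor product over $k$ of left $A$-modules is an $A$-module via the coproduct, so left $A$-modules form a monoidal category with unit object $k$. Hochschild cohomology: $A^e=A\otimes A^{op}$ and $\operatorname{HH}^*(A)=\operatorname{Ext}^*_{A^e}(A,A)$, with its usual Gerstenhaber bracket. Embedding of $\operatorname{H}^*(A,k)$ into $\operatorname{HH}^*(A)$: identify $A$ with the subalgebra $\delta(A)$ of $A^e$, where $\delta(a)=\sum a_1\otimes S(a_2)$. Then $A^e$ is projective as a right $A$-module and $A^e\otimes_A k\cong A$ as $A^e$-modules. The exact functor $A^e\otimes_A-$, applied to $n$-extensions of $k$ by $k$, induces an embedding of $\operatorname{H}^*(A,k)$ into $\operatorname{HH}^*(A)$.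 The Gerstenhaber bracket of two elements of $\operatorname{H}^*(A,k)$ is defined via this embedding followed by the Gerstenhaber bracket on $\operatorname{HH}^*(A)$. (So the theorem asserts that the image in $\operatorname{HH}^*(A)$ of the class of the cocycle $[f,g]$ is the Gerstenhaber bracket of the images of the classes of $f$ and $g$.) Homotopy liftings: let $d$ be the differential of $P$ and $\mu_P:P_0\to k$ the augmentation map. A diagonal map $\Delta_P:P\to P\otimes P$ is a chain map of $A$-modules lifting the canonical isomorphism $k\to k\otimes k$. A degree $l$ morphism $\psi:P\to P$ is a family of $A$-module homomorphisms $P_i\to P_{i-l}$, and $\partial(\psi)=d\psi-(-1)^l\psi d$. Maps such as $f:P_m\to k$ and $\mu_P:P_0\to k$ are extended by zero to all of $P$, tensor products of homogeneous maps follow the Koszul sign convention, and $k\otimes X$, $X\otimes k$ are identified with $X$. For an $m$-cocycle $f:P_m\to k$, a degree $m-1$ morphism $\psi_f:P\to P$ is a homotopy lifting of $f$ with respect to $\Delta_P$ if $\partial(\psi_f)=(f\otimes 1_P-1_P\otimes f)\Delta_P$ and $\mu_P\psi_f\sim(-1)^{m+1}f\psi$ for some degree $-1$ morphism $\psi:P\to P$ such that $\partial(\psi)=(\mu_P\otimes 1_P-1_P\otimes\mu_P)\Delta_P$, where $\sim$ means that the two maps $P\to k$ are homotopic, i.e. differ by a coboundary in $\operatorname{Hom}_A(P,k)$. *)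

(* Defs.v *)
From HB Require Import structures.
From mathcomp Require Import all_boot all_algebra.
From mathcomp Require Import boolp.

Set Implicit Arguments.
Unset Strict Implicit.
Unset Printing Implicit Defensive.

Import GRing.Theory.
Local Open Scope ring_scope.
Local Open Scope quotient_scope.

(* Formal sums of pairs, modulo the congruence generated by biadditivity and  *)
(* m r (x) n = m (x) r n.  The scalars S act through bare functions, so that  *)
(* one construction covers the tensor product over k and the tensor product   *)
(* of a right and a left module over a noncommutative ring.                   *)

Inductive tens_eqv (S : Type) (M N : zmodType) (ra : M -> S -> M)
    (la : S -> N -> N) : seq (M * N) -> seq (M * N) -> Prop :=
| TensRefl s : tens_eqv ra la s s
| TensSym s t : tens_eqv ra la s t -> tens_eqv ra la t s
| TensTrans s t u :
    tens_eqv ra la s t -> tens_eqv ra la t u -> tens_eqv ra la s u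
| TensCat s s' t t' : tens_eqv ra la s s' -> tens_eqv ra la t t' ->
    tens_eqv ra la (s ++ t) (s' ++ t')
| TensComm s t : tens_eqv ra la (s ++ t) (t ++ s)
| TensZero n : tens_eqv ra la [:: (0, n)] [::]
| TensAddl m m' n : tens_eqv ra la [:: (m + m', n)] [:: (m, n); (m', n)]
| TensAddr m n n' : tens_eqv ra la [:: (m, n + n')] [:: (m, n); (m, n')]
| TensBal m r n : tens_eqv ra la [:: (ra m r, n)] [:: (m, la r n)].

Section BalancedTensor.
Variables (S : Type) (M N : zmodType) (ra : M -> S -> M) (la : S -> N -> N).

Definition tens_rel (s t : seq (M * N)) : bool := `[< tens_eqv ra la s t >].

Lemma tens_rel_refl : reflexive tens_rel.
Proof. by move=> s; apply/asboolP; constructor. Qed.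
Lemma tens_rel_sym : symmetric tens_rel.
Proof. by move=> s t; apply/asboolP/asboolP; apply: TensSym. Qed.
Lemma tens_rel_trans : transitive tens_rel.
Proof.
by move=> t s u /asboolP st /asboolP tu; apply/asboolP/(TensTrans st tu).
Qed.

Canonical tens_equiv :=
  EquivRel tens_rel tens_rel_refl tens_rel_sym tens_rel_trans.

Definition btens := {eq_quot tens_equiv}.

HB.instance Definition _ := Choice.on btens.

Definition tpi (s : seq (M * N)) : btens := \pi_{eq_quot tens_equiv} s.
Definition trepr (x : btens) : seq (M * N) := repr (x : {eq_quot tens_equiv}).

Lemma treprK x : tpi (trepr x) = x.
Proof. exact: reprK. Qed.

Definition tpure (m : M) (n : N) : btens := tpi [:: (m, n)].

Definition tens_add (x y : btens) : btens := tpi (trepr x ++ trepr y).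
Definition tens_opp (x : btens) : btens :=
  tpi [seq (- p.1, p.2) | p <- trepr x].

Lemma tens_piE s t : tens_eqv ra la s t <-> tpi s = tpi t.
Proof.
split=> [st|/eqmodP/asboolP//].
by apply/eqmodP/asboolP.
Qed.

Lemma tens_reprE s : tens_eqv ra la (trepr (tpi s)) s.
Proof. by apply/tens_piE; rewrite treprK. Qed.

Lemma tens_piD s t : tens_add (tpi s) (tpi t) = tpi (s ++ t).
Proof. by apply/tens_piE; apply: TensCat; apply: tens_reprE. Qed.

Lemma tens_eqv_opp s t : tens_eqv ra la s t ->
  tpi [seq (- p.1, p.2) | p <- s] = tpi [seq (- p.1, p.2) | p <- t].
Proof.
have inv u : tens_eqv ra la (u ++ [seq (- p.1, p.2) | p <- u]) [::].
  elim: u => [|[m n] u IH] /=; first exact: TensRefl.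
  have e1 : tens_eqv ra la
      ([:: (m, n)] ++ (u ++ ([:: (- m, n)] ++ [seq (- p.1, p.2) | p <- u])))
      ([:: (m, n)] ++ ([:: (- m, n)] ++ (u ++ [seq (- p.1, p.2) | p <- u]))).
    apply: TensCat; first exact: TensRefl.
    by rewrite !catA; apply: TensCat; [apply: TensComm | apply: TensRefl].
  apply: TensTrans e1 _; rewrite catA -[[::]]cats0; apply: TensCat => //=.
  apply: TensTrans (TensSym (TensAddl _ _ _ _ _)) _.
  by rewrite subrr; apply: TensZero.
set o := map _ => st; apply/tens_piE.
have e1 : tens_eqv ra la (o s) (o s ++ (t ++ o t)).
  rewrite -{1}[o s]cats0; apply: TensCat; first exact: TensRefl.
  by apply/TensSym/inv.
apply: TensTrans e1 _; rewrite catA -[X in tens_eqv _ _ _ X]cat0s.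
apply: TensCat; last exact: TensRefl.
apply: TensTrans (inv s); apply: TensTrans (TensComm _ _ _ _) _.
by apply: TensCat; [apply: TensSym | apply: TensRefl].
Qed.

Lemma tens_piN s : tens_opp (tpi s) = tpi [seq (- p.1, p.2) | p <- s].
Proof. by apply/tens_eqv_opp/tens_reprE. Qed.

Lemma tquotW (Q : btens -> Prop) : (forall s, Q (tpi s)) -> forall x, Q x.
Proof. by move=> Qpi x; rewrite -[x]treprK. Qed.

Lemma tens_addA : associative tens_add.
Proof.
elim/tquotW=> s; elim/tquotW=> t; elim/tquotW=> u.
by rewrite !tens_piD catA.
Qed.
Lemma tens_addC : commutative tens_add.
Proof.
elim/tquotW=> s; elim/tquotW=> t; rewrite !tens_piD.
by apply/tens_piE/TensComm.
Qed.
Lemma tens_add0 : left_id (tpi [::]) tens_add.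
Proof. by elim/tquotW=> s; rewrite tens_piD. Qed.
Lemma tens_addN : left_inverse (tpi [::]) tens_opp tens_add.
Proof.
elim/tquotW=> s; rewrite tens_piN tens_piD.
elim: s => [//|[m n] s IH] /=.
have e1 : tens_eqv ra la
   ([:: (- m, n)] ++ ([seq (- p.1, p.2) | p <- s] ++ ([:: (m, n)] ++ s)))
   ([:: (- m, n)] ++ ([:: (m, n)] ++ ([seq (- p.1, p.2) | p <- s] ++ s))).
  apply: TensCat; first exact: TensRefl.
  by rewrite !catA; apply: TensCat; [apply: TensComm | apply: TensRefl].
apply/tens_piE; apply: TensTrans e1 _.
rewrite catA -[[::]]cats0; apply: TensCat; last by apply/tens_piE.
apply: TensTrans (TensSym (TensAddl _ _ _ _ _)) _.
by rewrite addNr; apply: TensZero.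
Qed.

HB.instance Definition _ :=
  GRing.isZmodule.Build btens tens_addA tens_addC tens_add0 tens_addN.

Lemma tpureDl m m' n : tpure (m + m') n = tpure m n + tpure m' n.
Proof. by rewrite /tpure [RHS]tens_piD; apply/tens_piE/TensAddl. Qed.
Lemma tpureDr m n n' : tpure m (n + n') = tpure m n + tpure m n'.
Proof. by rewrite /tpure [RHS]tens_piD; apply/tens_piE/TensAddr. Qed.
Lemma tpure_bal m r n : tpure (ra m r) n = tpure m (la r n).
Proof. by apply/tens_piE/TensBal. Qed.

Lemma tpureE x : x = \sum_(p <- trepr x) tpure p.1 p.2.
Proof.
rewrite -{1}[x]treprK; elim: (trepr x) => [|[m n] s IH]; first by rewrite big_nil.
by rewrite big_cons -IH [RHS]tens_piD.
Qed.

Lemma tens_ind (Q : btens -> Prop) :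
  Q 0 -> (forall x y, Q x -> Q y -> Q (x + y)) ->
  (forall m n, Q (tpure m n)) -> forall x, Q x.
Proof. by move=> Q0 QD Qp x; rewrite [x]tpureE; elim/big_ind: _. Qed.

(* The map m (x) n |-> b m n; it only has this meaning for balanced b.        *)
Definition tlift (U : zmodType) (b : M -> N -> U) (x : btens) : U :=
  \sum_(p <- trepr x) b p.1 p.2.

Record balanced (U : zmodType) (b : M -> N -> U) : Prop := Balanced {
  balDl : forall m m' n, b (m + m') n = b m n + b m' n;
  balDr : forall m n n', b m (n + n') = b m n + b m n';
  balZ : forall m r n, b (ra m r) n = b m (la r n) }.

Section Lift.
Variables (U : zmodType) (b : M -> N -> U) (hb : balanced b).

Lemma tlift_pi s : tlift b (tpi s) = \sum_(p <- s) b p.1 p.2.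
Proof.
rewrite /tlift; move: (trepr _) (tens_reprE s) => t.
elim=> {t s} //=.
- by move=> s t u _ -> _ ->.
- by move=> s s' t t' _ e _ e'; rewrite !big_cat /= e e'.
- by move=> s t; rewrite !big_cat /= addrC.
- move=> n; rewrite big_seq1 big_nil /=.
  by apply: (addrI (b 0 n)); rewrite -balDl // !addr0.
- by move=> m m' n; rewrite !big_cons !big_nil /= !addr0 balDl.
- by move=> m n n'; rewrite !big_cons !big_nil /= !addr0 balDr.
- by move=> m r n; rewrite !big_seq1 /= balZ.
Qed.

Lemma tlift_pure m n : tlift b (tpure m n) = b m n.
Proof. by rewrite tlift_pi big_seq1. Qed.

Lemma tliftD : {morph tlift b : x y / x + y}.
Proof.
elim/tquotW=> s; elim/tquotW=> t.
have -> : tpi s + tpi t = tpi (s ++ t) by exact: tens_piD.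
by rewrite !tlift_pi big_cat.
Qed.

Lemma tlift0 : tlift b 0 = 0.
Proof. by apply: (addrI (tlift b 0)); rewrite -tliftD !addr0. Qed.
End Lift.

Lemma eq_tlift (U : zmodType) (b c : M -> N -> U) x :
  (forall m n, b m n = c m n) -> tlift b x = tlift c x.
Proof. by move=> e; apply: eq_bigr. Qed.

End BalancedTensor.

Arguments tpure {S M N ra la} m n.
Definition tens (k : fieldType) (V W : lmodType k) : Type :=
  btens (fun (v : V) (c : k) => c *: v) (fun (c : k) (w : W) => c *: w).

Definition tprod (k : fieldType) (V W : lmodType k) (v : V) (w : W) :
  tens V W := tpure v w.
Notation "v ⊗ w" := (tprod v w) (at level 40, left associativity).

Record bilin (k : fieldType) (V W U : lmodType k) (b : V -> W -> U) : Prop :=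
  Bilin {
  bilDl : forall v v' w, b (v + v') w = b v w + b v' w;
  bilDr : forall v w w', b v (w + w') = b v w + b v w';
  bilZl : forall c v w, b (c *: v) w = c *: b v w;
  bilZr : forall c v w, b v (c *: w) = c *: b v w }.

Section TensorSpace.
Variables (k : fieldType) (V W : lmodType k).

HB.instance Definition _ := GRing.Zmodule.on (tens V W).

Definition tens_scale (c : k) (t : tens V W) : tens V W :=
  tlift (fun v w => c *: v ⊗ w : tens V W) t.

Lemma tens_scale_bal c : balanced (fun (v : V) (c : k) => c *: v)
  (fun (c : k) (w : W) => c *: w) (fun v w => c *: v ⊗ w : tens V W).
Proof.
split=> [v v' w|v w w'|v r w].
- by rewrite scalerDr; apply: tpureDl.
- exact: tpureDr.
- by rewrite scalerA mulrC -scalerA; apply: tpure_bal.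
Qed.

Lemma tprodDl (v v' : V) (w : W) : (v + v') ⊗ w = v ⊗ w + v' ⊗ w.
Proof. exact: tpureDl. Qed.
Lemma tprodDr (v : V) (w w' : W) : v ⊗ (w + w') = v ⊗ w + v ⊗ w'.
Proof. exact: tpureDr. Qed.

Lemma tprod_ind (Q : tens V W -> Prop) :
  Q 0 -> (forall x y, Q x -> Q y -> Q (x + y)) ->
  (forall v w, Q (v ⊗ w)) -> forall x, Q x.
Proof. exact: tens_ind. Qed.

Lemma tens_scale_pure c v w : tens_scale c (v ⊗ w) = c *: v ⊗ w.
Proof. exact: (tlift_pure (tens_scale_bal c)). Qed.

Lemma tens_scaleDr : right_distributive tens_scale +%R.
Proof. by move=> c; apply: (tliftD (tens_scale_bal c)). Qed.
Lemma tens_scale0 c : tens_scale c 0 = 0.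
Proof. exact: (tlift0 (tens_scale_bal c)). Qed.
Lemma tens_scaleA c c' t :
  tens_scale c (tens_scale c' t) = tens_scale (c * c') t.
Proof.
elim/tprod_ind: t => [|x y IHx IHy|v w]; rewrite ?tens_scale0 //.
  by rewrite !tens_scaleDr IHx IHy.
by rewrite !tens_scale_pure scalerA.
Qed.
Lemma tens_scale1 : left_id 1 tens_scale.
Proof.
elim/tprod_ind=> [|x y IHx IHy|v w]; rewrite ?tens_scale0 //.
  by rewrite tens_scaleDr IHx IHy.
by rewrite tens_scale_pure scale1r.
Qed.
Lemma tens_scaleDl t : {morph tens_scale^~ t : c c' / c + c'}.
Proof.
move=> c c'; elim/tprod_ind: t => [|x y IHx IHy|v w].
- by rewrite !tens_scale0 addr0.
- by rewrite !tens_scaleDr IHx IHy addrACA.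
- by rewrite !tens_scale_pure scalerDl tprodDl.
Qed.

HB.instance Definition _ := GRing.Zmodule_isLmodule.Build k (tens V W)
  tens_scaleA tens_scale1 tens_scaleDr tens_scaleDl.

Lemma tprodZl c (v : V) (w : W) : (c *: v) ⊗ w = c *: (v ⊗ w).
Proof. by rewrite -tens_scale_pure. Qed.
Lemma tprodZr c (v : V) (w : W) : v ⊗ (c *: w) = c *: (v ⊗ w).
Proof. by rewrite -tprodZl; apply/esym/tpure_bal. Qed.

Section Bilin.
Variables (U : lmodType k) (b : V -> W -> U) (hb : bilin b).

Lemma bilin_bal : balanced (fun (v : V) (c : k) => c *: v)
  (fun (c : k) (w : W) => c *: w) b.
Proof.
by split=> [v v' w|v w w'|v c w]; rewrite ?(bilDl hb) ?(bilDr hb) //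
  (bilZl hb) (bilZr hb).
Qed.

Lemma tlift_prod v w : tlift b (v ⊗ w) = b v w.
Proof. exact: (tlift_pure bilin_bal). Qed.
Lemma tliftZ c (t : tens V W) : tlift b (c *: t) = c *: tlift b t.
Proof.
elim/tprod_ind: t => [|x y IHx IHy|v w].
- by rewrite scaler0 (tlift0 bilin_bal) scaler0.
- by rewrite scalerDr !(tliftD bilin_bal) IHx IHy scalerDr.
- by rewrite -tprodZl !tlift_prod (bilZl hb).
Qed.
End Bilin.
End TensorSpace.

(* f (x) g : V1 (x) W1 -> V2 (x) W2, for linear f and g.                      *)
Definition tmap (k : fieldType) (V1 W1 V2 W2 : lmodType k)
    (f : V1 -> V2) (g : W1 -> W2) (t : tens V1 W1) : tens V2 W2 :=
  tlift (fun v w => f v ⊗ g w : tens V2 W2) t.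

(* (a (x) b, v (x) w) |-> f a v (x) g b w, for bilinear f and g.              *)
Definition tmul (k : fieldType) (V1 W1 V2 W2 V3 W3 : lmodType k)
    (f : V1 -> V2 -> V3) (g : W1 -> W2 -> W3)
    (u : tens V1 W1) (t : tens V2 W2) : tens V3 W3 :=
  tlift (fun a b => tmap (f a) (g b) t) u.

Section TensorMul.
Variables (k : fieldType) (V1 W1 V2 W2 V3 W3 : lmodType k).
Variables (f : V1 -> V2 -> V3) (g : W1 -> W2 -> W3).
Hypotheses (hf : bilin f) (hg : bilin g).

Lemma tmul_bilin_in a b :
  bilin (fun v w => f a v ⊗ g b w : tens V3 W3).
Proof.
split=> [v v' w|v w w'|c v w|c v w].
- by rewrite (bilDr hf) tprodDl.
- by rewrite (bilDr hg) tprodDr.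
- by rewrite (bilZr hf) tprodZl.
- by rewrite (bilZr hg) tprodZr.
Qed.
Let bal_in a b := bilin_bal (tmul_bilin_in a b).

Lemma tmul_bilin_out (t : tens V2 W2) :
  bilin (fun a b => tmap (f a) (g b) t).
Proof.
rewrite /tmap; split=> [a a' b|a b b'|c a b|c a b];
    elim/tprod_ind: t => [|x y IHx IHy|v w];
    rewrite ?(tlift0 (bal_in _ _)) ?addr0 ?scaler0 //
      ?(tliftD (bal_in _ _)) ?IHx ?IHy ?scalerDr 1?addrACA //
      !(tlift_prod (tmul_bilin_in _ _)).
- by rewrite (bilDl hf) tprodDl.
- by rewrite (bilDl hg) tprodDr.
- by rewrite (bilZl hf) tprodZl.
- by rewrite (bilZl hg) tprodZr.
Qed.
Let bal_out t := bilin_bal (tmul_bilin_out t).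

Lemma tmul_pure a b v w : tmul f g (a ⊗ b) (v ⊗ w) = f a v ⊗ g b w.
Proof.
by rewrite /tmul (tlift_prod (tmul_bilin_out _)) /tmap (tlift_prod (tmul_bilin_in _ _)).
Qed.
Lemma tmulDl u u' t : tmul f g (u + u') t = tmul f g u t + tmul f g u' t.
Proof. exact: (tliftD (bal_out _)). Qed.
Lemma tmul0l t : tmul f g 0 t = 0.
Proof. exact: (tlift0 (bal_out _)). Qed.
Lemma tmulDr u t t' : tmul f g u (t + t') = tmul f g u t + tmul f g u t'.
Proof.
elim/tprod_ind: u => [|x y IHx IHy|a b]; rewrite ?tmul0l ?addr0 //.
  by rewrite !tmulDl IHx IHy addrACA.
by rewrite /tmul !(tlift_prod (tmul_bilin_out _)) /tmap (tliftD (bal_in _ _)).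
Qed.
Lemma tmul0r u : tmul f g u 0 = 0.
Proof. by apply: (addrI (tmul f g u 0)); rewrite -tmulDr !addr0. Qed.
Lemma tmulZl c u t : tmul f g (c *: u) t = c *: tmul f g u t.
Proof. exact: (tliftZ (tmul_bilin_out t)). Qed.
Lemma tmulZr c u t : tmul f g u (c *: t) = c *: tmul f g u t.
Proof.
elim/tprod_ind: u => [|x y IHx IHy|a b]; rewrite ?tmul0l ?scaler0 //.
  by rewrite !tmulDl IHx IHy scalerDr.
rewrite /tmul !(tlift_prod (tmul_bilin_out _)).
exact: (tliftZ (tmul_bilin_in _ _)).
Qed.
End TensorMul.

Section ConverseAlgebra.
Variables (k : fieldType) (A : algType k).

HB.instance Definition _ := GRing.Lmodule.copy A^c A.

Lemma converse_scalerAl (c : k) (u v : A^c) : c *: (u * v) = (c *: u : A^c) * v.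
Proof. exact: (scalerAr c (v : A) (u : A)). Qed.
HB.instance Definition _ :=
  GRing.Lmodule_isLalgebra.Build k A^c converse_scalerAl.

Lemma converse_scalerAr (c : k) (u v : A^c) : c *: (u * v) = u * (c *: v : A^c).
Proof. exact: (scalerAl c (v : A) (u : A)). Qed.
HB.instance Definition _ :=
  GRing.Lalgebra_isAlgebra.Build k A^c converse_scalerAr.
End ConverseAlgebra.

Definition talg (k : fieldType) (A B : algType k) : Type := tens A B.

Section TensorAlgebra.
Variables (k : fieldType) (A B : algType k).

HB.instance Definition _ := GRing.Lmodule.on (talg A B).

Lemma mul_bilin (C : algType k) : bilin (fun x y : C => x * y).
Proof.
by split=> *; rewrite ?mulrDl ?mulrDr // -?scalerAl -?scalerAr.
Qed.

Definition talg_mul : talg A B -> talg A B -> talg A B :=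
  tmul (fun x y : A => x * y) (fun x y : B => x * y).
Definition talg_one : talg A B := 1 ⊗ 1.

Let pureE := tmul_pure (mul_bilin A) (mul_bilin B).
Let mulDl := tmulDl (mul_bilin A) (mul_bilin B).
Let mulDr := tmulDr (mul_bilin A) (mul_bilin B).
Let mul0l := tmul0l (mul_bilin A) (mul_bilin B).
Let mul0r := tmul0r (mul_bilin A) (mul_bilin B).

Lemma talg_mulA : associative talg_mul.
Proof.
rewrite /talg_mul; elim/tprod_ind=> [|x y IHx IHy|a b] t u.
- by rewrite !mul0l.
- by rewrite !mulDl IHx IHy.
elim/tprod_ind: t u => [|x y IHx IHy|a' b'] u.
- by rewrite !(mul0l, mul0r).
- by rewrite !(mulDl, mulDr) IHx IHy.
elim/tprod_ind: u => [|x y IHx IHy|a'' b''].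
- by rewrite !mul0r.
- by rewrite !mulDr IHx IHy.
by rewrite !pureE !mulrA.
Qed.
Lemma talg_mul1 : left_id talg_one talg_mul.
Proof.
rewrite /talg_mul; elim/tprod_ind=> [|x y IHx IHy|a b]; first exact: mul0r.
  by rewrite mulDr IHx IHy.
by rewrite pureE !mul1r.
Qed.
Lemma talg_mulr1 : right_id talg_one talg_mul.
Proof.
rewrite /talg_mul; elim/tprod_ind=> [|x y IHx IHy|a b]; first exact: mul0l.
  by rewrite mulDl IHx IHy.
by rewrite pureE !mulr1.
Qed.

HB.instance Definition _ := GRing.Zmodule_isPzRing.Build (talg A B)
  talg_mulA talg_mul1 talg_mulr1 mulDl mulDr.

Lemma talg_mulE a b a' b' :
  (a ⊗ b : talg A B) * (a' ⊗ b') = (a * a') ⊗ (b * b').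
Proof. exact: pureE. Qed.
End TensorAlgebra.

(* The A-module M as a vector space, along k -> A.                            *)
Definition restr (k : fieldType) (A : algType k) (M : lmodType A) : Type := M.

Section Restriction.
Variables (k : fieldType) (A : algType k) (M : lmodType A).

HB.instance Definition _ := GRing.Zmodule.on (restr M).

Definition restr_scale (c : k) (m : restr M) : restr M := c%:A *: (m : M).

Lemma restr_scaleA c c' m :
  restr_scale c (restr_scale c' m) = restr_scale (c * c') m.
Proof. by rewrite /restr_scale scalerA -scalerAl mul1r scalerA. Qed.
Lemma restr_scale1 : left_id 1 restr_scale.
Proof. by move=> m; rewrite /restr_scale !scale1r. Qed.
Lemma restr_scaleDr : right_distributive restr_scale +%R.
Proof. by move=> c m m'; rewrite /restr_scale scalerDr. Qed.
Lemma restr_scaleDl m : {morph restr_scale^~ m : c c' / c + c'}.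
Proof. by move=> c c'; rewrite /restr_scale !scalerDl. Qed.

HB.instance Definition _ := GRing.Zmodule_isLmodule.Build k (restr M)
  restr_scaleA restr_scale1 restr_scaleDr restr_scaleDl.

Definition mod_act (a : A) (m : restr M) : restr M := a *: (m : M).

Lemma mod_act_bilin : bilin mod_act.
Proof.
split=> [a a' m|a m m'|c a m|c a m]; rewrite /mod_act.
- exact: (scalerDl (m : M) a a').
- exact: (scalerDr a (m : M) m').
- by rewrite -[RHS]/(c%:A *: (a *: (m : M))) scalerA mulr_algl.
- rewrite -[RHS]/(c%:A *: (a *: (m : M))) -[c *: m]/(c%:A *: (m : M)).
  by rewrite !scalerA mulr_algl mulr_algr.
Qed.
End Restriction.

(* (a (x) b) (m (x) n) = a m (x) b n.                                         *)
Definition tens_act (k : fieldType) (A B : algType k) (M : lmodType A)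
    (N : lmodType B) (u : talg A B) (t : tens (restr M) (restr N)) :
    tens (restr M) (restr N) :=
  tmul (@mod_act k A M) (@mod_act k B N) u t.

Section TensorModule.
Variables (k : fieldType) (A B : algType k) (M : lmodType A) (N : lmodType B).
Implicit Types (u v : talg A B) (t : tens (restr M) (restr N)).

Let hM := mod_act_bilin M.
Let hN := mod_act_bilin N.

Lemma tens_actDl u v t : tens_act (u + v) t = tens_act u t + tens_act v t.
Proof. exact: (tmulDl hM hN). Qed.
Lemma tens_actDr u t t' : tens_act u (t + t') = tens_act u t + tens_act u t'.
Proof. exact: (tmulDr hM hN). Qed.
Lemma tens_actA u v t : tens_act u (tens_act v t) = tens_act (u * v) t.
Proof.
have h0r w : tens_act w 0 = 0 := tmul0r hM hN w.
have h0l t' : tens_act 0 t' = 0 := tmul0l hM hN t'.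
elim/tprod_ind: u => [|x y IHx IHy|a b].
- by rewrite -[0 : tens _ _]/(0 : talg A B) mul0r !h0l.
- by rewrite -[(x + y) : tens _ _]/((x : talg A B) + y) mulrDl
    !tens_actDl IHx IHy.
elim/tprod_ind: v => [|x y IHx IHy|a' b'].
- by rewrite -[0 : tens _ _]/(0 : talg A B) mulr0 !h0l h0r.
- by rewrite -[(x + y) : tens _ _]/((x : talg A B) + y) mulrDr
    !tens_actDl tens_actDr IHx IHy.
elim/tprod_ind: t => [|x y IHx IHy|m n].
- by rewrite !h0r.
- by rewrite !tens_actDr IHx IHy.
rewrite talg_mulE /tens_act !(tmul_pure hM hN).
by rewrite /mod_act !scalerA.
Qed.
Lemma tens_act1 t : tens_act 1 t = t.
Proof.
elim/tprod_ind: t => [|x y IHx IHy|m n].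
- exact: (tmul0r hM hN).
- by rewrite tens_actDr IHx IHy.
by rewrite /tens_act (tmul_pure hM hN) /mod_act !scale1r.
Qed.
End TensorModule.

(* tlift b (comul a) is the Sweedler sum of the b a_1 a_2.                    *)
Record hopf (k : fieldType) (A : algType k) := Hopf {
  comul : A -> talg A A;
  counit : A -> k;
  antipode : A -> A;
  comul_linear : linear comul;
  comul_multiplicative : monoid_morphism comul;
  counit_linear : scalar counit;
  counit_multiplicative : monoid_morphism counit;
  antipode_linear : linear antipode;
  comul_coassoc : forall a,
    tlift (fun u z => tlift (fun x y => x ⊗ (y ⊗ z) : tens A (tens A A)) u)
      (tmap comul id (comul a) : tens (tens A A) A) =
    tmap id comul (comul a) :> tens A (tens A A);
  counitl : forall a, tlift (fun x y => counit x *: y) (comul a) = a;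
  counitr : forall a, tlift (fun x y => counit y *: x) (comul a) = a;
  antipodel : forall a,
    tlift (fun x y => antipode x * y) (comul a) = (counit a)%:A;
  antipoder : forall a,
    tlift (fun x y => x * antipode y) (comul a) = (counit a)%:A }.

Definition triv (k : fieldType) (A : algType k) (H : hopf A) : Type := k.

Section Trivial.
Variables (k : fieldType) (A : algType k) (H : hopf A).

HB.instance Definition _ := GRing.Zmodule.on (triv H).

Definition triv_scale (a : A) (c : triv H) : triv H := counit H a * (c : k).

Lemma triv_scaleA a b c :
  triv_scale a (triv_scale b c) = triv_scale (a * b) c.
Proof. by rewrite /triv_scale (counit_multiplicative H).2 mulrA. Qed.
Lemma triv_scale1 : left_id 1 triv_scale.
Proof. by move=> c; rewrite /triv_scale (counit_multiplicative H).1 mul1r. Qed.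
Lemma triv_scaleDr : right_distributive triv_scale +%R.
Proof. by move=> a c d; apply: mulrDr. Qed.
Lemma triv_scaleDl c : {morph triv_scale^~ c : a b / a + b}.
Proof.
move=> a b; rewrite /triv_scale -[a]scale1r (counit_linear H) scale1r.
by rewrite /= mul1r mulrDl.
Qed.

HB.instance Definition _ := GRing.Zmodule_isLmodule.Build A (triv H)
  triv_scaleA triv_scale1 triv_scaleDr triv_scaleDl.
End Trivial.

(* M (x)_k N with a (m (x) n) = a_1 m (x) a_2 n.                              *)
Definition htens (k : fieldType) (A : algType k) (H : hopf A)
  (M N : lmodType A) : Type := tens (restr M) (restr N).

Section HopfTensor.
Variables (k : fieldType) (A : algType k) (H : hopf A) (M N : lmodType A).

HB.instance Definition _ := GRing.Zmodule.on (htens H M N).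

Definition htens_scale (a : A) (t : htens H M N) : htens H M N :=
  tens_act (comul H a) t.

Lemma htens_scaleA a b t :
  htens_scale a (htens_scale b t) = htens_scale (a * b) t.
Proof.
by rewrite /htens_scale tens_actA (comul_multiplicative H).2.
Qed.
Lemma htens_scale1 : left_id 1 htens_scale.
Proof.
by move=> t; rewrite /htens_scale (comul_multiplicative H).1 tens_act1.
Qed.
Lemma htens_scaleDr : right_distributive htens_scale +%R.
Proof. by move=> a; apply: tens_actDr. Qed.
Lemma htens_scaleDl t : {morph htens_scale^~ t : a b / a + b}.
Proof.
move=> a b; rewrite /htens_scale -[a]scale1r (comul_linear H) !scale1r.
exact: tens_actDl.
Qed.

HB.instance Definition _ := GRing.Zmodule_isLmodule.Build A (htens H M N)
  htens_scaleA htens_scale1 htens_scaleDr htens_scaleDl.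
End HopfTensor.

Definition env (k : fieldType) (A : algType k) : pzRingType := talg A A^c.

Definition bimod (k : fieldType) (A : algType k) : Type := A.

Section RegularBimodule.
Variables (k : fieldType) (A : algType k).

HB.instance Definition _ := GRing.Zmodule.on (bimod A).

Definition bimod_scale (u : env A) (x : bimod A) : bimod A :=
  tlift (fun (a : A) (b : A^c) => a * (x : A) * (b : A) : bimod A) u.

Lemma bimod_bal (x : bimod A) : balanced
  (fun (a : A) (c : k) => c *: a) (fun (c : k) (b : A^c) => c *: b)
  (fun (a : A) (b : A^c) => a * (x : A) * (b : A) : bimod A).
Proof.
split=> [a a' b|a b b'|a c b].
- by rewrite !mulrDl.
- exact: mulrDr.
- rewrite -scalerAl -scalerAl -[RHS]/((a * x) * (c *: (b : A))).
  by rewrite -scalerAr.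
Qed.

Lemma bimod_scale_pure (a : A) (b : A^c) x :
  bimod_scale (a ⊗ b) x = a * (x : A) * (b : A).
Proof. exact: (tlift_pure (bimod_bal x)). Qed.
Lemma bimod_scaleDl x : {morph bimod_scale^~ x : u v / u + v}.
Proof. by move=> u v; apply: (tliftD (bimod_bal x)). Qed.
Lemma bimod_scale0l x : bimod_scale 0 x = 0.
Proof. exact: (tlift0 (bimod_bal x)). Qed.
Lemma bimod_scaleDr : right_distributive bimod_scale +%R.
Proof.
move=> u x y; elim/tprod_ind: u => [|u v IHu IHv|a b].
- by rewrite !bimod_scale0l addr0.
- by rewrite !bimod_scaleDl IHu IHv addrACA.
- by rewrite !bimod_scale_pure -[x + y]/((x : A) + (y : A)) mulrDr mulrDl.
Qed.
Lemma bimod_scaleA u v x :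
  bimod_scale u (bimod_scale v x) = bimod_scale (u * v) x.
Proof.
elim/tprod_ind: u => [|u u' IHu IHu'|a b].
- by rewrite -[0 : tens _ _]/(0 : env A) mul0r !bimod_scale0l.
- by rewrite -[(u + u') : tens _ _]/((u : env A) + u') mulrDl
    !bimod_scaleDl IHu IHu'.
elim/tprod_ind: v => [|v v' IHv IHv'|a' b'].
- rewrite -[0 : tens _ _]/(0 : env A) mulr0 !bimod_scale0l.
  by rewrite bimod_scale_pure mulr0 mul0r.
- by rewrite -[(v + v') : tens _ _]/((v : env A) + v') mulrDr
    !bimod_scaleDl bimod_scaleDr IHv IHv'.
by rewrite talg_mulE !bimod_scale_pure !mulrA.
Qed.
Lemma bimod_scale1 : left_id 1 bimod_scale.
Proof. by move=> x; rewrite [LHS]bimod_scale_pure mul1r mulr1. Qed.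

HB.instance Definition _ := GRing.Zmodule_isLmodule.Build (env A) (bimod A)
  bimod_scaleA bimod_scale1 bimod_scaleDr bimod_scaleDl.
End RegularBimodule.

(* delta(a) = a_1 (x) S(a_2).                                                 *)
Definition delta (k : fieldType) (A : algType k) (H : hopf A) (a : A) : env A :=
  tmap id (antipode H : A -> A^c) (comul H a).

(* A^e (x)_A M, where A acts on the right of A^e through delta.               *)
Definition ind (k : fieldType) (A : algType k) (H : hopf A) (M : lmodType A) :
    Type :=
  btens (fun (u : env A) (a : A) => u * delta H a) (fun (a : A) (m : M) => a *: m).

Section Induction.
Variables (k : fieldType) (A : algType k) (H : hopf A) (M : lmodType A).

HB.instance Definition _ := GRing.Zmodule.on (ind H M).

Definition ind_scale (u : env A) (t : ind H M) : ind H M :=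
  tlift (fun v m => tpure (u * v) m : ind H M) t.

Lemma ind_bal u : balanced
  (fun (v : env A) (a : A) => v * delta H a) (fun (a : A) (m : M) => a *: m)
  (fun v m => tpure (u * v) m : ind H M).
Proof.
split=> [v v' m|v m m'|v a m].
- by rewrite mulrDr tpureDl.
- exact: tpureDr.
- by rewrite mulrA tpure_bal.
Qed.

Lemma ind_scale_pure u v (m : M) : ind_scale u (tpure v m) = tpure (u * v) m.
Proof. exact: (tlift_pure (ind_bal u)). Qed.
Lemma ind_scaleDr : right_distributive ind_scale +%R.
Proof. by move=> u; apply: (tliftD (ind_bal u)). Qed.
Lemma ind_scale0 u : ind_scale u 0 = 0.
Proof. exact: (tlift0 (ind_bal u)). Qed.
Lemma ind_scaleA u v t : ind_scale u (ind_scale v t) = ind_scale (u * v) t.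
Proof.
elim/tens_ind: t => [|x y IHx IHy|w m].
- by rewrite !ind_scale0.
- by rewrite !ind_scaleDr IHx IHy.
- by rewrite !ind_scale_pure mulrA.
Qed.
Lemma ind_scale1 : left_id 1 ind_scale.
Proof.
elim/tens_ind=> [|x y IHx IHy|w m].
- exact: ind_scale0.
- by rewrite ind_scaleDr IHx IHy.
- by rewrite ind_scale_pure mul1r.
Qed.
Lemma ind_scaleDl t : {morph ind_scale^~ t : u v / u + v}.
Proof.
move=> u v; elim/tens_ind: t => [|x y IHx IHy|w m].
- by rewrite !ind_scale0 addr0.
- by rewrite !ind_scaleDr IHx IHy addrACA.
- by rewrite !ind_scale_pure mulrDl tpureDl.
Qed.

HB.instance Definition _ := GRing.Zmodule_isLmodule.Build (env A) (ind H M)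
  ind_scaleA ind_scale1 ind_scaleDr ind_scaleDl.
End Induction.

(* A^e (x)_A h, for A-linear h.                                               *)
Definition ind_map (k : fieldType) (A : algType k) (H : hopf A)
    (M N : lmodType A) (h : M -> N) (t : ind H M) : ind H N :=
  tlift (fun u m => tpure u (h m) : ind H N) t.

(* The isomorphism A^e (x)_A k -> A, (a (x) b) (x) c |-> c a b.               *)
Definition ind_triv (k : fieldType) (A : algType k) (H : hopf A)
    (t : ind H (triv H)) : bimod A :=
  tlift (fun (u : env A) (c : triv H) => u *: ((c : k)%:A : bimod A)) t.

Record resolution (R : pzRingType) (M : lmodType R) := Resolution {
  robj :> nat -> lmodType R;
  rd : forall i, {linear robj i.+1 -> robj i};
  raug : {linear robj 0%N -> M};
  raug_surj : forall y, exists x, raug x = y;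
  rexact0 : forall x, raug x = 0 <-> exists y, rd 0%N y = x;
  rexact : forall i x, rd i x = 0 <-> exists y, rd i.+1 y = x }.

Definition projective (R : pzRingType) (P : lmodType R) : Prop :=
  forall (M N : lmodType R) (p : {linear M -> N}) (h : {linear P -> N}),
    (forall y, exists x, p x = y) ->
    exists h' : {linear P -> M}, forall x, p (h' x) = h x.

(* The differential out of degree i, which is 0 for i = 0.                    *)
Definition dfrom (R : pzRingType) (M : lmodType R) (P : resolution M) (i : nat) :
    P i -> P i.-1 :=
  match i return P i -> P i.-1 with
  | 0%N => fun _ => 0
  | j.+1 => rd P j
  end.

Definition cocycle (R : pzRingType) (M N : lmodType R) (P : resolution M)
    (n : nat) (f : P n -> N) : Prop :=
  forall x : P n.+1, f (rd P n x) = 0.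

(* For n > 0 this is an exact sequence                                        *)
(*   0 -> N -> E_(n-1) -> ... -> E_0 -> M -> 0                                *)
(* with N replaced by E_n.  A 0-extension is a homomorphism M -> N: in this   *)
(* case raug : E_0 -> M is bijective and ext_end : E_0 -> N is arbitrary.     *)
Record extension (R : pzRingType) (n : nat) (M N : lmodType R) := Extension {
  ext_res :> resolution M;
  ext_bound : forall j, (n < j)%N -> forall x : ext_res j, x = 0;
  ext_end : {linear ext_res n -> N};
  ext_end_bij : (0 < n)%N -> bijective ext_end }.

Definition represents (R : pzRingType) (n : nat) (M N : lmodType R)
    (P : resolution M) (f : P n -> N) (E : extension n M N) : Prop :=
  exists theta : forall i, {linear P i -> E i},
    [/\ forall i x, theta i (rd P i x) = rd E i (theta i.+1 x),
        forall x, raug E (theta 0%N x) = raug P x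
      & forall x, ext_end E (theta n x) = f x].

(* A cochain of degree n is a k-multilinear function on the sequences of size *)
(* n; its values on sequences of other sizes are irrelevant.  Through         *)
(*   phi s = Phi (1 (x) s_0 (x) ... (x) s_(n-1) (x) 1)                        *)
(* it is an A^e-linear map Phi from A (x) A^(x n) (x) A, the n-th term of the *)
(* bar resolution of A, to N, and hoch_d phi corresponds to the composite of  *)
(* Phi with the bar differential.                                             *)

Definition sgn (R : pzRingType) (l : int) : R := (-1) ^+ `|l|%N.

Section Hochschild.
Variables (k : fieldType) (A : algType k) (N : lmodType (env A)).

Definition lact (a : A) (x : N) : N := ((a ⊗ (1 : A^c)) : env A) *: x.
Definition ract (x : N) (a : A) : N := (((1 : A) ⊗ (a : A^c)) : env A) *: x.

Definition hoch_cochain (n : nat) (phi : seq A -> N) : Prop :=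
  forall (s t : seq A) (c : k) (a b : A), (size s + size t).+1 = n ->
    phi (s ++ (c *: a + b) :: t) =
    lact c%:A (phi (s ++ a :: t)) + phi (s ++ b :: t).

Definition hoch_d (phi : seq A -> N) (s : seq A) : N :=
  let n := (size s).-1 in
  lact s`_0 (phi (behead s))
  + \sum_(i < n) sgn (env A) i.+1 *:
      phi (take i s ++ (s`_i * s`_i.+1) :: drop i.+2 s)
  + sgn (env A) n.+1 *: ract (phi (take n s)) s`_n.
End Hochschild.

Definition hoch_eq (k : fieldType) (A : algType k) (n : nat)
    (F G : seq A -> bimod A) : Prop :=
  if n is n'.+1 then
    exists2 h : seq A -> bimod A, hoch_cochain n' h &
      forall s, size s = n -> F s - G s = hoch_d h s
  else F [::] = G [::].

Definition hoch_circ (k : fieldType) (A : algType k) (m n : nat)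
    (F G : seq A -> bimod A) (s : seq A) : bimod A :=
  \sum_(i < m) sgn (env A) ((n%:Z - 1) * i%:Z) *:
    F (take i s ++ (G (take n (drop i s)) : A) :: drop (i + n) s).

(* Of degree m + n - 1; it vanishes for m = n = 0.                            *)
Definition hoch_bracket (k : fieldType) (A : algType k) (m n : nat)
    (F G : seq A -> bimod A) (s : seq A) : bimod A :=
  hoch_circ m n F G s -
  sgn (env A) ((m%:Z - 1) * (n%:Z - 1)) *: hoch_circ n m G F s.

(* F is the Hochschild cocycle attached to A^e (x)_A E by a chain map from    *)
(* the bar resolution to A^e (x)_A E over the identity of A.                  *)
Definition hoch_represents (k : fieldType) (A : algType k) (H : hopf A)
    (n : nat) (F : seq A -> bimod A) (E : extension n (triv H) (triv H)) :
    Prop :=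
  exists phi : forall i, seq A -> ind H (E i),
    [/\ forall i, hoch_cochain i (phi i),
        ind_triv (ind_map (raug E) (phi 0%N [::])) = 1 :> A,
        forall i s, size s = i.+1 ->
          ind_map (rd E i) (phi i.+1 s) = hoch_d (phi i) s
      & forall s, size s = n ->
          F s = ind_triv (ind_map (ext_end E) (phi n s))].

(* The graph of H^n(A,k) -> HH^n(A), on representatives.                      *)
Definition embeds_to (k : fieldType) (A : algType k) (H : hopf A)
    (P : resolution (triv H)) (n : nat) (f : P n -> triv H)
    (F : seq A -> bimod A) : Prop :=
  exists2 E : extension n (triv H) (triv H),
    represents f E & hoch_represents F E.

Section HomotopyLifting.
Variables (k : fieldType) (A : algType k) (H : hopf A).
Variable (P : resolution (triv H)).

(* The component P_n -> P_i (x) P_j of Delta_P is Delta n i j.                *)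
Record diagonal_map
    (Delta : forall n i j, {linear P n -> htens H (P i) (P j)}) : Prop :=
  DiagonalMap {
  diag_deg : forall n i j x, n <> (i + j)%N -> Delta n i j x = 0;
  diag_chain : forall n i j x,
    (tmap (rd P i : restr (P i.+1) -> restr (P i)) id (Delta n i.+1 j x)
     + (-1) ^+ i *:
       tmap id (rd P j : restr (P j.+1) -> restr (P j)) (Delta n i j.+1 x)
       : tens (restr (P i)) (restr (P j)))
    = Delta n.-1 i j (dfrom x);
  diag_aug : forall x,
    tmap (raug P : restr (P 0%N) -> restr (triv H))
         (raug P : restr (P 0%N) -> restr (triv H)) (Delta 0%N 0%N 0%N x)
    = (raug P x : restr (triv H)) ⊗ ((1 : k) : restr (triv H)) }.

(* A morphism psi : P -> P of degree l, with components psi i j : P_i -> P_j. *)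
Definition has_degree (l : int) (psi : forall i j, {linear P i -> P j}) : Prop :=
  forall i j x, i%:Z - j%:Z <> l -> psi i j x = 0.

Definition bdry (l : int) (psi : forall i j, {linear P i -> P j}) i j (x : P i) :
    P j :=
  rd P j (psi i j.+1 x) - sgn A l *: psi i.-1 j (dfrom x).

(* The component P_i -> P_j of (f (x) 1 - 1 (x) f) Delta_P; the Koszul rule   *)
(* gives (1 (x) f)(x (x) y) = (-1)^(m j) x (x) f(y) for x in P_j.             *)
Definition comm_diag (Delta : forall n i j, {linear P n -> htens H (P i) (P j)})
    (m : nat) (f : P m -> triv H) i j (x : P i) : P j :=
  tlift (fun (y : P m) (z : P j) => (f y : k)%:A *: z : P j) (Delta i m j x)
  - (-1) ^+ (m * j) *:
    tlift (fun (y : P j) (z : P m) => (f z : k)%:A *: y : P j) (Delta i j m x).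

Record homotopy_lifting
    (Delta : forall n i j, {linear P n -> htens H (P i) (P j)})
    (m : nat) (f : P m -> triv H) (psi : forall i j, {linear P i -> P j}) :
    Prop := HomotopyLifting {
  hl_deg : has_degree (m%:Z - 1) psi;
  hl_bdry : forall i j (x : P i),
    bdry (m%:Z - 1) psi j x = comm_diag Delta f j x;
  hl_aug : exists psi0 : forall i j, {linear P i -> P j},
    [/\ has_degree (- 1) psi0,
        forall i j (x : P i),
          bdry (- 1) psi0 j x = comm_diag Delta (raug P) j x
      & exists h : {linear P m.-2 -> triv H}, forall x : P m.-1,
          raug P (psi m.-1 0%N x)
          - sgn A (m%:Z + 1) *: f (psi0 m.-1 m x) = h (dfrom x)] }.

(* The component P_(m+n-1) -> k of f psi_g - (-1)^((m-1)(n-1)) g psi_f.       *)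
Definition lift_bracket (m n : nat) (f : P m -> triv H) (g : P n -> triv H)
    (psif psig : forall i j, {linear P i -> P j}) (x : P (m + n).-1) : triv H :=
  f (psig (m + n).-1 m x)
  - sgn A ((m%:Z - 1) * (n%:Z - 1)) *: g (psif (m + n).-1 n x).
End HomotopyLifting.

(* Main.v *)
(* Write V(M) = M (x) A for the A-bimodule A^e (x)_A M.  Let iota be a chain   *)
(* map from the bar resolution of A to V(P), and let U be the deconcatenation *)
(* product of iota with itself.  U and Delta_P iota are chain maps to         *)
(* V(P (x) P) over the same map, so they differ by a homotopy u.  Hence, up   *)
(* to homotopy and sign, the insertion of the cochain f iota into iota        *)
(* differs from psi_f iota by (f (x) 1 - 1 (x) f) u, the augmentation         *)
(* condition on psi_f being what makes the two sides comparable.  Apply g,    *)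
(* exchange the roles of f and g and subtract: the terms in u cancel, because *)
(* g (f (x) 1) = +- f (1 (x) g) on P (x) P, and the bracket of f iota and     *)
(* g iota becomes cohomologous to (f psi_g -+ g psi_f) iota.  All homotopies  *)
(* come from k-linear contractions.                                           *)

From HB Require Import structures.
Require Import Defs.
From mathcomp Require Import all_boot all_algebra zify.
From mathcomp Require Import boolp classical_sets.

Set Implicit Arguments.
Unset Strict Implicit.
Unset Printing Implicit Defensive.

Import GRing.Theory.
Local Open Scope ring_scope.

(** A class in H^n(A,k) reaches HH^n(A) through an extension E of k by k. Any Hochschild cochain
    attached to E is cohomologous to f iota, where iota is one fixed chain map from the bar
    resolution of A to V(P): this is [embeds_cohomologous]. The bracket respects coboundaries
    ([bracket_cohomologous]), so it remains to compare the bracket of f iota and g iota with (f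
    psi_g -+ g psi_f) iota, which is done in [hat_comparison].

    The engine is [insert_hoch_d]: the circle product fails to commute with the Hochschild
    differential by the difference of two cup products. For F = f iota inserted into iota these cup
    products are (f (x) 1) U and (1 (x) f) U, where U is the product of iota with itself ([l_U],
    [r_U]). The boundary of psi_f iota involves (f (x) 1 - 1 (x) f) Delta_P iota instead, and a
    homotopy u between U and Delta_P iota bridges the two ([diagonal_comparison],
    [insert_comparison]). For the resulting cycle to be a boundary its augmentation must be a
    coboundary; the condition mu psi_f ~ +- f psi provides this, once f psi iota has been computed
    in [psi0_comparison]. In [circle_comparison] the remaining terms in u cancel by symmetry.

    All homotopies come from [lifting_exists], which needs k-linear contractions of V(P) and V(P (x)
    P); these exist since exact complexes over a field split ([linear_section],
    [resolution_contraction], [bihat_contraction]). The product V(M) x V(N) -> V(M (x) N) behind U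
    is [pairing]. Cocycles are realised by extensions through a pushout ([extension_exists]).

    A graded object is carried by one module, the product of its terms, and a cochain by one
    function on sequences of every length. Degrees then enter mainly through parities: signs are
    booleans given to [sg], and signed identities are settled by cases and [zmod]. *)

Inductive zexp := ZVar of nat | ZZero | ZAdd of zexp & zexp | ZOpp of zexp.

Fixpoint zeval (V : zmodType) (e : seq V) (t : zexp) : V :=
  match t with
  | ZVar i => e`_i
  | ZZero => 0
  | ZAdd u v => zeval e u + zeval e v
  | ZOpp u => - zeval e u
  end.

Fixpoint zcoef (t : zexp) (i : nat) : int :=
  match t with
  | ZVar j => (i == j)%:Z
  | ZZero => 0
  | ZAdd u v => zcoef u i + zcoef v i
  | ZOpp u => - zcoef u i
  end.

Lemma zeval_coef (V : zmodType) (e : seq V) t :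
  zeval e t = \sum_(i < size e) e`_i *~ zcoef t i.
Proof.
elim: t => /= [j||u -> v ->|u ->].
- have [lt|ge] := ltnP j (size e); last first.
    rewrite nth_default // big1 // => i _.
    by case: eqP => // ij; move: (ltn_ord i); rewrite ij ltnNge ge.
  rewrite (bigD1 (Ordinal lt)) //= eqxx big1 ?addr0 // => i ne.
  by rewrite (_ : _ == _ = false) //; apply: contraNF ne.
- by rewrite big1.
- by rewrite -big_split; apply: eq_bigr => i _; rewrite mulrzDr.
- by rewrite -sumrN; apply: eq_bigr => i _; rewrite mulrNz.
Qed.

Lemma zeval_eq (V : zmodType) (e : seq V) t u :
  all (fun i => zcoef t i == zcoef u i) (iota 0 (size e)) ->
  zeval e t = zeval e u.
Proof.
move=> /allP h; rewrite !zeval_coef; apply: eq_bigr => i _.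
by rewrite (eqP (h i _)) // mem_iota /= ltn_ord.
Qed.

(* Syntactic equality is tried before the costly unification.                 *)
Ltac zmod_same a t :=
  match constr:(tt) with
  | _ => let _ := match constr:(tt) with _ => constr_eq a t end in constr:(true)
  | _ => let _ := match constr:(tt) with _ => unify a t end in constr:(true)
  | _ => constr:(false)
  end.

Ltac zmod_index l t :=
  lazymatch l with
  | nil => constr:(@None nat)
  | cons ?a ?l' =>
    lazymatch zmod_same a t with
    | true => constr:(Some O)
    | false => lazymatch zmod_index l' t with
      | Some ?i => constr:(Some (S i))
      | None => constr:(@None nat)
      end
    end
  end.

Ltac zmod_atoms l t :=
  lazymatch t with
  | @Algebra.add _ ?x ?y => let l' := zmod_atoms l x in zmod_atoms l' y
  | @Algebra.opp _ ?x => zmod_atoms l x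
  | @Algebra.zero _ => l
  | _ =>
    lazymatch zmod_index l t with
    | Some _ => l
    | None => constr:(cons t l)
    end
  end.

Ltac zmod_reify l t :=
  lazymatch t with
  | @Algebra.add _ ?x ?y =>
      let u := zmod_reify l x in let v := zmod_reify l y in constr:(ZAdd u v)
  | @Algebra.opp _ ?x => let u := zmod_reify l x in constr:(ZOpp u)
  | @Algebra.zero _ => constr:(ZZero)
  | _ => lazymatch zmod_index l t with Some ?i => constr:(ZVar i) end
  end.

(* Decides equations that hold in every abelian group.                        *)
Ltac zmod :=
  lazymatch goal with
  | |- @eq ?T ?x ?y =>
    let l := zmod_atoms (@nil T) x in
    let l := zmod_atoms l y in
    let u := zmod_reify l x in
    let v := zmod_reify l y in
    exact: (@zeval_eq _ l u v isT)
  end.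

(** * Signs, and sections of linear maps *)

Definition sg (V : zmodType) (b : bool) (x : V) : V := if b then - x else x.

Section Sign.
Variables (V : zmodType).
Implicit Types (b c : bool) (x y : V).

Lemma sgD b x y : sg b (x + y) = sg b x + sg b y.
Proof. by case: b => //=; rewrite opprD. Qed.
Lemma sgN b x : sg b (- x) = - sg b x.
Proof. by case: b. Qed.
Lemma sg0 b : sg b (0 : V) = 0.
Proof. by case: b => //=; rewrite oppr0. Qed.
Lemma sgM b c x : sg b (sg c x) = sg (b (+) c) x.
Proof. by case: b c => [] [] //=; rewrite opprK. Qed.
Lemma sgK b x : sg b (sg b x) = x.
Proof. by rewrite sgM addbb. Qed.
Lemma sgNb b x : sg (~~ b) x = - sg b x.
Proof. by case: b; rewrite /= ?opprK. Qed.
End Sign.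

Lemma sgE (R : pzRingType) (M : lmodType R) (n : nat) (x : M) :
  (-1) ^+ n *: x = sg (odd n) x.
Proof. by rewrite -signr_odd /sg; case: odd; rewrite ?expr1 ?scaleN1r ?scale1r. Qed.

(* The sections exist by Zorn's lemma: a maximal subspace of V meeting ker p  *)
(* trivially is mapped bijectively onto the image of p.                       *)
Lemma linear_section (k : fieldType) (V W : lmodType k) (p : V -> W) :
  linear p ->
  exists2 s : W -> V, forall v, p (s (p v)) = p v &
    forall c v v', s (c *: p v + p v') = c *: s (p v) + s (p v').
Proof.
move=> lp.
have p0 : p 0 = 0 by have := lp (-1) 0 0; rewrite scaler0 addr0 scaleN1r addNr.
have pD x y : p (x + y) = p x + p y by rewrite -{1}[x]scale1r lp scale1r.
have pZ c x : p (c *: x) = c *: p x by rewrite -[c *: x]addr0 lp p0 addr0.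
pose good (S : set V) := (forall c x y, S x -> S y -> S (c *: x + y)) /\
  (forall x, S x -> p x = 0 -> x = 0).
have [F Fg Ftot|S [[Scl Sker] Smax]] := @Zorn_bigcup V good.
  split=> [c x y [X FX Xx] [Y FY Yy]|x [X FX Xx]]; last by apply: (Fg _ FX).2.
  have [XY|YX] := Ftot _ _ FX FY.
  - by exists Y => //; apply: (Fg _ FY).1 => //; apply: XY.
  - by exists X => //; apply: (Fg _ FX).1 => //; apply: YX.
have maxE (T : set V) : good T -> (forall x, S x -> T x) -> forall x, T x -> S x.
  move=> gT ST x Tx; apply: contrapT => nSx; apply: (Smax T) gT.
  by split=> // TS; apply/nSx/TS.
(* [good] does not ask for 0, so that the union of the empty chain is good; maximality now puts 0
   into S. *)
have S0 : S 0.
  apply: (maxE (fun x => S x \/ x = 0)) => //; [split|by left|by right].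
  - move=> c x y [Sx|->] [Sy|->]; rewrite ?scaler0 ?add0r ?addr0.
    + by left; apply: Scl.
    + left; have := Scl c x x Sx Sx; have := Scl (-1) x _ Sx.
      by move=> h /h; rewrite scaleN1r addrCA addNr addr0.
    + by left.
    + by right.
  - by move=> x [/Sker//|->].
have SZ c x : S x -> S (c *: x) by move=> Sx; rewrite -[_ *: _]addr0; apply: Scl.
have onto v : exists2 x, S x & p x = p v.
  apply: contrapT => nv.
  have np x : S x -> p x <> p v by move=> Sx pxv; apply: nv; exists x.
  (* If p v were not in p(S), then k v + S would still meet the kernel trivially, and maximality
     would put v into S. *)
  apply: (np v) => //.
  apply: (maxE (fun y => exists c x, S x /\ y = c *: v + x)); last 1 first.
  - by exists 1, 0; rewrite scale1r addr0.
  - split=> [c x y [c1 [x1 [Sx1 ->]]] [c2 [x2 [Sx2 ->]]]|x [c [x1 [Sx1 ->]]]].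
      exists (c * c1 + c2), (c *: x1 + x2); split; first exact: Scl.
      by rewrite scalerDr addrACA scalerA -scalerDl.
    rewrite lp; have [->|c0] := eqVneq c 0.
      by rewrite !scale0r !add0r => /Sker->.
    move=> e; case: (np (- c^-1 *: x1)); first exact: SZ.
    rewrite pZ; apply: (scalerI c0).
    by rewrite scalerA mulrN divff // scaleN1r; apply/eqP; rewrite eq_sym -addr_eq0 e.
  - by move=> x Sx; exists 0, x; rewrite scale0r add0r.
have inj x y : S x -> S y -> p x = p y -> x = y.
  move=> Sx Sy e; apply/eqP; rewrite -subr_eq0 -addrC -scaleN1r; apply/eqP/Sker.
    exact: Scl.
  by rewrite lp e scaleN1r addNr.
have /choice [s sP] : forall w, exists x, S x /\ ((exists v, p v = w) -> p x = w).
  move=> w; have [[v <-]|nv] := pselect (exists v, p v = w).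
    by have [x Sx px] := onto v; exists x.
  by exists 0.
have ps v : p (s (p v)) = p v by apply: (sP _).2; exists v.
exists s => // c v v'; apply: inj; first exact: (sP _).1.
  by apply: Scl; apply: (sP _).1.
by rewrite lp !ps -lp ps.
Qed.

(** * Cochains on sequences *)

Section BimoduleActions.
Variables (k : fieldType) (A : algType k) (N : lmodType (env A)).
Implicit Types (x y : N) (a b : A).

Lemma lactDr a x y : lact a (x + y) = lact a x + lact a y.
Proof. exact: scalerDr. Qed.
Lemma lactN a x : lact a (- x) = - lact a x.
Proof. exact: scalerN. Qed.
Lemma lact0r a : lact a (0 : N) = 0.
Proof. exact: scaler0. Qed.
Lemma ractD x y a : ract (x + y) a = ract x a + ract y a.
Proof. exact: scalerDr. Qed.
Lemma ractN x a : ract (- x) a = - ract x a.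
Proof. exact: scalerN. Qed.
Lemma ract0 a : ract (0 : N) a = 0.
Proof. exact: scaler0. Qed.
Lemma lactM a b x : lact (a * b) x = lact a (lact b x).
Proof.
rewrite /lact scalerA; congr (_ *: _); symmetry.
by rewrite [LHS]talg_mulE; congr (_ ⊗ _); rewrite mul1r.
Qed.
Lemma ractM a b x : ract x (a * b) = ract (ract x a) b.
Proof.
rewrite /ract scalerA; congr (_ *: _); symmetry.
by rewrite [LHS]talg_mulE; congr (_ ⊗ _); rewrite mul1r.
Qed.
Lemma lact_ract a b x : lact a (ract x b) = ract (lact a x) b.
Proof.
rewrite /lact /ract !scalerA; congr (_ *: _).
rewrite [LHS]talg_mulE [RHS]talg_mulE; congr (_ ⊗ _); by rewrite ?mul1r ?mulr1.
Qed.
Lemma lact1 x : lact 1 x = x.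
Proof. exact: scale1r. Qed.
Lemma ract1 x : ract x 1 = x.
Proof. exact: scale1r. Qed.
Lemma lactDl a b x : lact (a + b) x = lact a x + lact b x.
Proof. by rewrite /lact -scalerDl; congr (_ *: _); rewrite -tprodDl. Qed.
Lemma ractDr a b x : ract x (a + b) = ract x a + ract x b.
Proof. by rewrite /ract -scalerDl; congr (_ *: _); rewrite -tprodDr. Qed.
Lemma lact0 x : lact 0 x = 0.
Proof. by apply: (addrI (lact 0 x)); rewrite -lactDl !addr0. Qed.
Lemma ractr0 x : ract x 0 = 0.
Proof. by apply: (addrI (ract x 0)); rewrite -ractDr !addr0. Qed.
Lemma lact_alg c a x : lact (c *: a) x = lact c%:A (lact a x).
Proof. by rewrite -lactM mulr_algl. Qed.
(* In [env A] the scalars of the two factors agree.                           *)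
Lemma ract_alg c a x : ract x (c *: a) = lact c%:A (ract x a).
Proof.
rewrite /ract /lact scalerA; congr (_ *: _).
rewrite [RHS]talg_mulE mulr1 mul1r.
by rewrite [RHS]tprodZl [LHS]tprodZr.
Qed.
Lemma lact_algC c a x : lact c%:A (lact a x) = lact a (lact c%:A x).
Proof. by rewrite -!lactM mulr_algl mulr_algr. Qed.
Lemma sg_lact e a x : lact a (sg e x) = sg e (lact a x).
Proof. by case: e; rewrite //= lactN. Qed.
Lemma sg_ract e a x : ract (sg e x) a = sg e (ract x a).
Proof. by case: e; rewrite //= ractN. Qed.
End BimoduleActions.

Section ListCochains.
Variables (k : fieldType) (A : algType k) (N : lmodType (env A)).
Implicit Types (phi : seq A -> N) (a b : A) (s t : seq A) (F : seq A -> bimod A).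

(** Demanded at all lengths at once, so that one function holds a cochain of every degree and no
    degree has to be carried along. *)
Definition multilinear phi : Prop := forall s t c a b,
  phi (s ++ (c *: a + b) :: t) =
  lact c%:A (phi (s ++ a :: t)) + phi (s ++ b :: t).

(** Bimodules carry no separate k-structure here: the scalar c acts as [lact c%:A]. *)
Definition klinear (U V : lmodType (env A)) (h : U -> V) : Prop :=
  forall c x y, h (lact c%:A x + y) = lact c%:A (h x) + h y.

(** These operations recurse by fixing the first argument of phi. Inductions over the sequence
    therefore generalise phi, and the alternating signs build up one letter at a time. *)
Fixpoint inner phi s : N :=
  match s with
  | a :: ((b :: r) as s') => phi (a * b :: r) - inner (fun t => phi (a :: t)) s'
  | _ => 0
  end.

Definition lead phi s : N := if s is a :: s' then lact a (phi s') else 0.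

Fixpoint trail phi s : N :=
  if s is a :: s' then
    if s' is [::] then - ract (phi [::]) a else - trail (fun t => phi (a :: t)) s'
  else 0.

(* The circle product phi o F for a cochain F of degree m.                    *)
Fixpoint insert m F phi s : N :=
  (if (m <= size s)%N then phi ((F (take m s) : A) :: drop m s) else 0) +
  (if s is a :: s' then sg (~~ odd m) (insert m F (fun t => phi (a :: t)) s')
   else 0).

Definition cupl m F phi s : N :=
  if (m <= size s)%N then lact (F (take m s)) (phi (drop m s)) else 0.

(* With the Koszul sign of moving F past the arguments of phi.                *)
Fixpoint cupr m F phi s : N :=
  if size s == m then ract (phi [::]) (F s) else
  if s is a :: s' then sg (odd m) (cupr m F (fun t => phi (a :: t)) s') else 0.

Lemma innerE phi a b r :
  inner phi (a :: b :: r) = phi (a * b :: r) - inner (fun t => phi (a :: t)) (b :: r).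
Proof. by []. Qed.

Lemma trailE phi a b r :
  trail phi (a :: b :: r) = - trail (fun t => phi (a :: t)) (b :: r).
Proof. by []. Qed.

Lemma insertE m F phi a s :
  insert m F phi (a :: s) =
  (if (m <= (size s).+1)%N
   then phi ((F (take m (a :: s)) : A) :: drop m (a :: s)) else 0) +
  sg (~~ odd m) (insert m F (fun t => phi (a :: t)) s).
Proof. by []. Qed.

Lemma cuprE m F phi a s :
  cupr m F phi (a :: s) =
  if (size s).+1 == m then ract (phi [::]) (F (a :: s)) else
  sg (odd m) (cupr m F (fun t => phi (a :: t)) s).
Proof. by []. Qed.

(** The restriction to nonempty t allows phi to be compared with functions defined by cases that are
    0 at [[::]]. *)
Lemma eq_inner phi psi s :
  (forall t, (size t).+1 = size s -> (0 < size t)%N -> phi t = psi t) ->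
  inner phi s = inner psi s.
Proof.
elim: s phi psi => [//|a [//|b r] IH] phi psi e.
rewrite !innerE e //; congr (_ - _); apply: IH => t st t0.
by apply: e => //=; rewrite st.
Qed.

Lemma inner_lin c phi psi s :
  inner (fun t => lact c (phi t) + psi t) s = lact c (inner phi s) + inner psi s.
Proof.
elim: s phi psi => [|a [|b r] IH] phi psi; try by rewrite /= lact0r addr0.
by rewrite !innerE (IH (fun t => phi (a :: t)) (fun t => psi (a :: t))) lactDr lactN opprD addrACA.
Qed.

Lemma trail_lin c phi psi s :
  trail (fun t => lact c (phi t) + psi t) s = lact c (trail phi s) + trail psi s.
Proof.
elim: s phi psi => [|a [|b r] IH] phi psi; first by rewrite lact0r addr0.
  by rewrite /= ractD -lact_ract lactN opprD.
by rewrite !trailE (IH (fun t => phi (a :: t)) (fun t => psi (a :: t))) lactN opprD.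
Qed.

Lemma hoch_dE phi s : hoch_d phi s = lead phi s - inner phi s + trail phi s.
Proof.
have sgE' n (x : N) : sgn (env A) (Posz n) *: x = sg (odd n) x by rewrite /sgn sgE.
rewrite /hoch_d sgE'; case: s => [|a s].
  (* At [[::]] the default letter 0 kills both outer terms. *)
  by rewrite /= lact0 big_ord0 subr0 !add0r ractr0 oppr0.
rewrite [lact _ _]/= [(size _).-1]/=; congr (_ + _ + _).
- elim: s a phi => [|b s IH] a phi; first by rewrite big_ord0 oppr0.
  rewrite [size _]/= big_ord_recl sgE' innerE opprB addrC.
  congr (_ + _); last by rewrite /= drop0.
  rewrite -[inner _ _]opprK -IH -sumrN; apply: eq_bigr => i _.
  by rewrite !sgE' /= negbK; case: odd; rewrite //= ?opprK.
- elim: s a phi => [|b s IH] a phi; first by [].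
  by rewrite trailE -IH /= negbK; case: odd; rewrite //= opprK.
Qed.

Lemma lactN1 x : lact (- 1)%:A x = - x :> N.
Proof. by rewrite scaleN1r -[LHS]addr0 -(subrr x) addrA -{2}[x]lact1 -lactDl addNr lact0 add0r. Qed.

Lemma innerB phi psi s :
  inner (fun t => phi t - psi t) s = inner phi s - inner psi s.
Proof.
rewrite addrC -lactN1 -inner_lin; congr (inner _ s).
by apply/funext => t; rewrite lactN1 addrC.
Qed.

(* Both merges of a triple a_i a_(i+1) a_(i+2) cancel, as do the two orders   *)
(* of disjoint merges.                                                        *)
Lemma inner_inner phi s : inner (inner phi) s = 0.
Proof.
elim: s phi => [|a [|b [|c r]] IH] phi //; first by rewrite /= subr0.
pose psi t := if t is x :: t' then phi (a * x :: t') else 0.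
have e : inner (fun t => inner phi (a :: t)) (b :: c :: r) =
    inner psi (b :: c :: r).
  rewrite -[RHS]subr0 -(IH (fun t => phi (a :: t))) -innerB.
  by apply: eq_inner => -[].
by rewrite innerE e !innerE /psi mulrA subrr.
Qed.

Lemma eq_trail phi psi s :
  (forall t, (size t).+1 = size s -> phi t = psi t) -> trail phi s = trail psi s.
Proof.
elim: s phi psi => [//|a [|b r] IH] phi psi e; first by rewrite /= e.
rewrite !trailE; congr (- _); apply: IH => t st.
by apply: e; rewrite /= st.
Qed.

Lemma eq_lead phi psi s :
  (forall t, (size t).+1 = size s -> phi t = psi t) -> lead phi s = lead psi s.
Proof. by case: s => //= a s e; rewrite e. Qed.

Lemma eq_hoch_d phi psi s :
  (forall t, (size t).+1 = size s -> phi t = psi t) ->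
  hoch_d phi s = hoch_d psi s.
Proof.
move=> e; rewrite !hoch_dE (eq_lead e) (eq_trail e); congr (_ - _ + _).
by apply: eq_inner => t st _; apply: e.
Qed.

Lemma trailB phi psi s :
  trail (fun t => phi t - psi t) s = trail phi s - trail psi s.
Proof.
rewrite addrC -lactN1 -trail_lin; congr (trail _ s).
by apply/funext => t; rewrite lactN1 addrC.
Qed.

Lemma leadB phi psi s :
  lead (fun t => phi t - psi t) s = lead phi s - lead psi s.
Proof. by case: s => [|a s] /=; rewrite ?subr0 // lactDr lactN. Qed.

Lemma innerN phi s : inner (fun t => - phi t) s = - inner phi s.
Proof.
elim: s phi => [|a [|b r] IH] phi; try by rewrite /= oppr0.
by rewrite !innerE (IH (fun t => phi (a :: t))) opprD.
Qed.

Lemma trailN phi s : trail (fun t => - phi t) s = - trail phi s.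
Proof.
elim: s phi => [|a [|b r] IH] phi; first by rewrite /= oppr0.
  by rewrite /= ractN.
by rewrite !trailE (IH (fun t => phi (a :: t))).
Qed.

Lemma inner_lact a phi s : inner (fun t => lact a (phi t)) s = lact a (inner phi s).
Proof.
elim: s phi => [|b [|c r] IH] phi; try by rewrite /= lact0r.
by rewrite !innerE (IH (fun t => phi (b :: t))) lactDr lactN.
Qed.

Lemma trail_lact a phi s : trail (fun t => lact a (phi t)) s = lact a (trail phi s).
Proof.
elim: s phi => [|b [|c r] IH] phi; first by rewrite /= lact0r.
  by rewrite /= lactN lact_ract.
by rewrite !trailE (IH (fun t => phi (b :: t))) lactN.
Qed.

Lemma inner_lead phi s :
  inner (lead phi) s = lead (lead phi) s - lead (inner phi) s.
Proof.
case: s => [|a [|b r]]; try by rewrite /= ?lact0r subr0.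
by rewrite innerE (inner_lact a phi) /lead lactM.
Qed.

Lemma trail_lead phi s : trail (lead phi) s = - lead (trail phi) s.
Proof.
case: s => [|a [|b r]]; rewrite ?oppr0 //; first by rewrite /= ract0 lact0r.
by rewrite trailE (trail_lact a phi).
Qed.

(** Letting the last two letters act on the right in turn is the same as merging them first; merges
    further left cancel between the two sums on the right. *)
Lemma trail_trail phi s :
  trail (trail phi) s = inner (trail phi) s + trail (inner phi) s.
Proof.
elim: s phi => [|a [|b [|c r]] IH] phi.
- by rewrite addr0.
- by rewrite /= ract0 oppr0 addr0.
- by rewrite /= !opprK ract0 ractN ractM subr0 addr0.
(* The contribution of merging a with the letter after it. *)
pose psi t := if t is x :: t' then phi (a * x :: t') else 0.
have eT : trail (fun t => trail phi (a :: t)) (b :: c :: r) =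
    - trail (trail (fun t => phi (a :: t))) (b :: c :: r).
  by rewrite -trailN; apply: eq_trail => -[].
have eI : trail (fun t => inner phi (a :: t)) (b :: c :: r) =
    trail psi (b :: c :: r) - trail (inner (fun t => phi (a :: t))) (b :: c :: r).
  by rewrite -trailB; apply: eq_trail => -[].
have eJ : inner (fun t => trail phi (a :: t)) (b :: c :: r) =
    - inner (trail (fun t => phi (a :: t))) (b :: c :: r).
  by rewrite -innerN; apply: eq_inner => -[].
rewrite innerE [LHS]trailE [X in _ + X]trailE eT eI eJ IH trailE [trail psi _]trailE.
by rewrite /psi !opprK opprD opprK addrACA addrA addNr add0r.
Qed.

Lemma sumB3 (X : (seq A -> N) -> seq A -> N) phi1 phi2 phi3 s :
  (forall f g t, X (fun u => f u - g u) t = X f t - X g t) ->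
  X (fun t => phi1 t - phi2 t + phi3 t) s = X phi1 s - X phi2 s + X phi3 s.
Proof.
move=> XB; have XN f t : X (fun u => - f u) t = - X f t.
  have X0 : X (fun=> 0) t = 0.
    rewrite -[RHS](subrr (X (fun=> 0) t)) -XB; congr (X _ t).
    by apply/funext => u; rewrite subrr.
  by rewrite -[RHS]add0r -X0 -XB; congr (X _ _); apply/funext => u; rewrite add0r.
rewrite -[X phi3 s]opprK -(XN phi3) -!XB; congr X.
by apply/funext => u; rewrite opprK.
Qed.

Lemma hoch_dd phi s : hoch_d (hoch_d phi) s = 0.
Proof.
rewrite hoch_dE (funext (hoch_dE phi)).
rewrite !(sumB3 _ _ _ _ leadB, sumB3 _ _ _ _ innerB, sumB3 _ _ _ _ trailB).
rewrite inner_inner inner_lead trail_lead trail_trail.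
zmod.
Qed.

End ListCochains.

(** * The circle product and the Hochschild differential *)

Section Insertion.
Variables (k : fieldType) (A : algType k) (N : lmodType (env A)).
Implicit Types (phi : seq A -> N) (a b : A) (s t : seq A) (F : seq A -> bimod A).

Lemma innerD phi psi s :
  inner (fun t => phi t + psi t) s = inner phi s + inner psi s.
Proof.
rewrite -[inner psi s]opprK -innerN -innerB.
by congr (inner _ s); apply/funext => t; rewrite opprK.
Qed.

Lemma trailD phi psi s :
  trail (fun t => phi t + psi t) s = trail phi s + trail psi s.
Proof.
rewrite -[trail psi s]opprK -trailN -trailB.
by congr (trail _ s); apply/funext => t; rewrite opprK.
Qed.

Lemma inner_sg (e : bool) phi s : inner (fun t => sg e (phi t)) s = sg e (inner phi s).
Proof. by case: e => //=; rewrite innerN. Qed.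

Lemma trail_sg (e : bool) phi s : trail (fun t => sg e (phi t)) s = sg e (trail phi s).
Proof. by case: e => //=; rewrite trailN. Qed.

Definition upto p (K : seq A -> seq A -> N) s : N :=
  if (p <= size s)%N then K (take p s) (drop p s) else 0.

(** A merge either happens within the first p + 1 letters, and then shortens the left part, or after
    the first p letters; passing those gives the sign. *)
Lemma inner_upto p K s : inner (upto p K) s =
  if (p < size s)%N then
    inner (fun u => K u (drop p.+1 s)) (take p.+1 s) +
    sg (odd p) (inner (K (take p s)) (drop p s))
  else 0.
Proof.
elim: p K s => [|p IH] K [|a [|b r]] //.
- by rewrite /= addr0.
- rewrite -[RHS]/(0 + inner (K [::]) (a :: b :: r)) add0r.
  by apply: eq_inner => t _ _; rewrite /upto take0 drop0.
have := IH (fun u v => K (a :: u) v) (b :: r); rewrite innerE.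
have -> : inner (fun t => upto p.+1 K (a :: t)) (b :: r) =
  inner (upto p (fun u v => K (a :: u) v)) (b :: r) by [].
move=> ->; rewrite /upto [size _]/= !ltnS.
case: (leqP p (size r)) => pr; last by rewrite subr0.
rewrite -[take p.+2 _]/(a :: b :: take p r) innerE -[odd p.+1]/(~~ odd p) sgNb.
by rewrite opprD addrA.
Qed.

Lemma trail_upto p K s : trail (upto p K) s =
  if (p < size s)%N then sg (odd p) (trail (K (take p s)) (drop p s)) else 0.
Proof.
elim: p K s => [|p IH] K [|a [|b r]] //; try by rewrite /= ract0 oppr0.
have := IH (fun u v => K (a :: u) v) (b :: r); rewrite trailE.
have -> : trail (fun t => upto p.+1 K (a :: t)) (b :: r) =
  trail (upto p (fun u v => K (a :: u) v)) (b :: r) by [].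
move=> ->; rewrite [size _]/= !ltnS.
case: (leqP p (size r)) => pr; last by rewrite oppr0.
by rewrite -[odd p.+1]/(~~ odd p) sgNb.
Qed.

Definition first m F phi := upto m (fun u v => phi ((F u : A) :: v)).

Definition rest m F phi s : N :=
  if s is a :: s' then insert m F (fun t => phi (a :: t)) s' else 0.

Lemma insertD m F phi s :
  insert m F phi s = first m F phi s + sg (~~ odd m) (rest m F phi s).
Proof. by case: s => //=; rewrite sg0. Qed.

Lemma eq_insert m F phi psi s :
  (forall t, (0 < size t)%N -> (size t + m = (size s).+1)%N -> phi t = psi t) ->
  insert m F phi s = insert m F psi s.
Proof.
elim: s phi psi => [|a s IH] phi psi e; rewrite !insertD.
  rewrite /rest !sg0 !addr0 /first /upto.
  by case: m e => // e; rewrite /= e.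
congr (_ + sg _ _).
  rewrite /first /upto; case: leqP => // ms; rewrite e //.
  by rewrite /= size_drop /= addSn subnK.
by apply: IH => t t0 st; apply: e => //=; rewrite addSn st.
Qed.

Lemma insert_lin m F c phi psi s :
  insert m F (fun t => lact c (phi t) + psi t) s =
  lact c (insert m F phi s) + insert m F psi s.
Proof.
elim: s phi psi => [|a s IH] phi psi; rewrite !insertD.
  rewrite /rest !sg0 !addr0 /first /upto; case: ifP => // _.
  by rewrite lact0r addr0.
rewrite /rest (IH (fun t => phi (a :: t)) (fun t => psi (a :: t))) sgD -sg_lact.
rewrite lactDr addrACA; congr (_ + _); rewrite /first /upto; case: ifP => // _.
by rewrite lact0r addr0.
Qed.

Lemma insertB m F phi psi s :
  insert m F (fun t => phi t - psi t) s = insert m F phi s - insert m F psi s.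
Proof.
rewrite addrC -lactN1 -insert_lin; congr (insert _ _ _ s).
by apply/funext => t; rewrite lactN1 addrC.
Qed.

Lemma insert0 m F s : insert m F (fun=> 0 : N) s = 0.
Proof.
rewrite -[RHS](subrr (insert m F (fun=> 0 : N) s)) -insertB.
by congr (insert _ _ _ s); apply/funext => t; rewrite subrr.
Qed.

Lemma insertN m F phi s : insert m F (fun t => - phi t) s = - insert m F phi s.
Proof.
rewrite -[RHS]add0r -(insert0 m F s) -insertB.
by congr (insert _ _ _ s); apply/funext => t; rewrite sub0r.
Qed.

Lemma insert_lact m F c phi s :
  insert m F (fun t => lact c (phi t)) s = lact c (insert m F phi s).
Proof.
rewrite -[RHS]addr0 -(insert0 m F s) -insert_lin.
by congr (insert _ _ _ s); apply/funext => t; rewrite addr0.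
Qed.

(** When F takes the first letters its value is the letter that acts, which produces the cup
    product; otherwise the first letter acts from outside the insertion. *)
Lemma insert_lead m F phi s : insert m F (lead phi) s =
  cupl m F phi s + sg (~~ odd m) (lead (insert m F phi) s).
Proof.
by rewrite insertD; congr (_ + sg _ _); case: s => //= a s; rewrite insert_lact.
Qed.

Lemma cupr_small m F phi s : (size s < m)%N -> cupr m F phi s = 0.
Proof.
elim: s phi => [|a s IH] phi sm; first by case: m sm.
by rewrite cuprE ltn_eqF // IH ?sg0 //; apply: ltn_trans sm.
Qed.

Lemma trail_rest m F phi a s :
  trail (rest m F phi) (a :: s) = - trail (insert m F (fun t => phi (a :: t))) s.
Proof. by case: s => [|b s]; rewrite ?trailE //= ract0. Qed.

(** The mirror image of [insert_lead]: the cup product [cupr] comes from F taking the last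
    letters. *)
Lemma insert_trail m F phi s : insert m F (trail phi) s =
  - cupr m F phi s + sg (~~ odd m) (trail (insert m F phi) s).
Proof.
elim: s phi => [|a s IH] phi.
  by rewrite insertD /first /upto /= !sg0 !addr0; case: m => //=; rewrite oppr0.
have eR : rest m F (trail phi) (a :: s) =
    - insert m F (trail (fun t => phi (a :: t))) s.
  by rewrite /rest -insertN; apply: eq_insert => -[].
rewrite insertD eR IH (funext (insertD m F phi)) trailD trail_sg trail_rest trail_upto.
rewrite cuprE /first /upto !sgN !sgD !sgN !sgM addbb /=.
case: ltngtP => ms.
- case E: (drop m (a :: s)) => [|c D].
    by move: (size_drop m (a :: s)); rewrite E subSn //= => -[].
  by rewrite sgM sgNb; case: odd; rewrite /sg /=; zmod.
- by rewrite sgNb sg0; zmod.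
- rewrite ms -[in take _ _]/(size (a :: s)) -[in drop _ _]/(size (a :: s)).
  by rewrite drop_size take_size cupr_small // !sg0; zmod.
Qed.

Lemma trail_rcons phi s a :
  trail phi (rcons s a) = sg (~~ odd (size s)) (ract (phi s) a).
Proof.
elim: s phi => [|b s IH] phi //.
have -> : trail phi (rcons (b :: s) a) = - trail (fun t => phi (b :: t)) (rcons s a).
  by case: s {IH}.
by rewrite IH -sgNb.
Qed.

End Insertion.

Section CircleProduct.
Variables (k : fieldType) (A : algType k) (N : lmodType (env A)).
Implicit Types (phi : seq A -> N) (a b : A) (s t : seq A) (F : seq A -> bimod A).

Lemma multilinear_cons phi a : multilinear phi -> multilinear (fun t => phi (a :: t)).
Proof. by move=> hphi s t; apply: (hphi (a :: s)). Qed.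

Lemma multilinearD phi a b s : multilinear phi ->
  phi (a + b :: s) = phi (a :: s) + phi (b :: s).
Proof.
move=> h; have := h [::] s 1 a b.
by rewrite /= !scale1r lact1.
Qed.

Lemma multilinearB phi a b s : multilinear phi ->
  phi (a - b :: s) = phi (a :: s) - phi (b :: s).
Proof.
by move=> h; rewrite -[in RHS](subrK b a) [in RHS]multilinearD // addrK.
Qed.

Lemma multilinearN phi a s : multilinear phi -> phi (- a :: s) = - phi (a :: s).
Proof.
move=> h; have e0 : phi (0 :: s) = 0.
  by apply: (addrI (phi (0 :: s))); rewrite -multilinearD // !addr0.
by rewrite -[- a]add0r multilinearB // e0 add0r.
Qed.

Lemma multilinear_sg (e : bool) phi a s : multilinear phi ->
  phi (sg e a :: s) = sg e (phi (a :: s)).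
Proof. by case: e => // h; rewrite /= multilinearN. Qed.

Lemma inner_map (U : lmodType (env A)) (h : U -> N) (psi : seq A -> U) s :
  (forall x y, h (x - y) = h x - h y) -> h (inner psi s) = inner (h \o psi) s.
Proof.
move=> hB; elim: s psi => [|a [|b r] IH] psi.
- by rewrite /= -(subrr 0) hB subrr.
- by rewrite /= -(subrr 0) hB subrr.
- by rewrite !innerE hB IH.
Qed.

(** Merges away from the inserted value commute with the insertion. Merging the value of F with a
    neighbouring letter gives the two outer terms of the differential of F, whose inner terms cancel
    the merges among the arguments of F. *)
Lemma insert_inner m F phi s : multilinear phi ->
  insert m F (inner phi) s = sg (~~ odd m) (inner (insert m F phi) s) +
    sg (~~ odd m) (insert m.+1 (hoch_d F) phi s).
Proof.
elim: s phi => [|a s IH] phi hphi.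
  by case: m => [|m]; rewrite /= !(sg0, addr0, oppr0).
pose phia t := phi (a :: t).
pose psi t := if t is x :: t' then phi (a * x :: t') else 0.
have eR : rest m F (inner phi) (a :: s) = insert m F psi s - insert m F (inner phia) s.
  by rewrite /rest -insertB; apply: eq_insert => -[].
rewrite insertD eR (IH phia); last exact: multilinear_cons.
rewrite {1}(funext (insertD m F phi)) innerD inner_sg.
rewrite [insert m F psi s]insertD [insert m.+1 _ phi _]insertD.
have eI : inner (rest m F phi) (a :: s) = rest m F psi s - inner (insert m F phia) s.
  by case: s {IH eR} => [|b r]; rewrite /= ?subr0.
rewrite eI [rest m.+1 _ _ _]/= -/phia -[~~ odd m.+1]/(~~ ~~ odd m) negbK.
(* The terms in which F starts later are settled by induction; what is left concerns the insertions
   at the front. *)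
have : first m F (inner phi) (a :: s) + sg (~~ odd m) (first m F psi s) =
    sg (~~ odd m) (inner (first m F phi) (a :: s)) +
    sg (~~ odd m) (first m.+1 (hoch_d F) phi (a :: s)); last first.
  move=> e; apply: (addIr (- (sg (~~ odd m) (first m F psi s)))).
  move: e => /(congr1 (fun x => x - sg (~~ odd m) (first m F psi s))).
  by rewrite addrK => ->; case: odd; rewrite /sg /=; zmod.
rewrite /first inner_upto /upto [size _]/= !ltnS.
case: ltngtP => ms.
- rewrite -ltnS ms (drop_nth 0) // (take_nth 0) // [nth _ _ _ in LHS]/=.
  set c := nth 0 (a :: s) m; set D := drop m.+1 (a :: s); set T := take m (a :: s).
  have eI' : inner (fun u => phi ((F u : A) :: D)) (rcons T c) =
      phi ((inner F (rcons T c) : A) :: D).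
    by rewrite (@inner_map _ (fun x : bimod A => phi ((x : A) :: D))) // => x y;
      apply: multilinearB.
  rewrite eI' innerE (hoch_dE F) trail_rcons.
  have -> : size T = m by rewrite size_take /= ms.
  rewrite multilinearD // multilinearB // multilinear_sg //.
  have -> : lead F (rcons T c) = (a * (F (take m s) : A)) :> A.
    rewrite -take_nth // /= [LHS]bimod_scale_pure; exact: mulr1.
  rewrite [ract _ _]bimod_scale_pure mul1r /=.
  by rewrite -[drop m s]/D; case: odd; rewrite /sg /=; zmod.
- by rewrite leqNgt -ltnS (leqW ms) /= !(sg0, addr0).
- have eD : drop m (a :: s) = [::] by apply: drop_oversize; rewrite ms.
  by rewrite eD /= ms ltnn !(sg0, addr0).
Qed.

End CircleProduct.

Section RegularActions.
Variables (k : fieldType) (A : algType k).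

Lemma bimod_lactE (a : A) (x : bimod A) : lact a x = (a * (x : A)).
Proof. rewrite [LHS]bimod_scale_pure; exact: mulr1. Qed.
Lemma bimod_ractE (a : A) (x : bimod A) : ract x a = ((x : A) * a).
Proof. by rewrite [LHS]bimod_scale_pure mul1r. Qed.
End RegularActions.

Section Klinear.
Variables (k : fieldType) (A : algType k).
Implicit Types (U V W : lmodType (env A)).

Lemma klinearB U V (h : U -> V) x y : klinear h -> h (x - y) = h x - h y.
Proof. by move=> hl; rewrite addrC -lactN1 hl lactN1 addrC. Qed.
Lemma klinear0 U V (h : U -> V) : klinear h -> h 0 = 0.
Proof. by move=> hl; rewrite -[X in h X](subrr 0) klinearB // subrr. Qed.
Lemma klinearN U V (h : U -> V) x : klinear h -> h (- x) = - h x.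
Proof. by move=> hl; rewrite -[- x]sub0r klinearB // klinear0 // sub0r. Qed.
Lemma klinear_sg U V (h : U -> V) (b : bool) x : klinear h -> h (sg b x) = sg b (h x).
Proof. by case: b => // hl; rewrite /= klinearN. Qed.
Lemma klinear_comp U V W (h : U -> V) (g : V -> W) :
  klinear h -> klinear g -> klinear (g \o h).
Proof. by move=> hl gl c x y; rewrite /= hl gl. Qed.
Lemma linear_klinear U V (h : {linear U -> V}) : klinear h.
Proof. by move=> c x y; rewrite /lact linearP. Qed.

Lemma linear_sg U V (h : {linear U -> V}) (b : bool) x : h (sg b x) = sg b (h x).
Proof. exact/klinear_sg/linear_klinear. Qed.

Lemma linear_lact U V (h : {linear U -> V}) a x : h (lact a x) = lact a (h x).
Proof. exact: linearZ. Qed.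
Lemma linear_ract U V (h : {linear U -> V}) x a : h (ract x a) = ract (h x) a.
Proof. exact: linearZ. Qed.

Lemma linear_lead U V (h : {linear U -> V}) (phi : seq A -> U) s :
  h (lead phi s) = lead (h \o phi) s.
Proof. by case: s => [|a s] /=; rewrite ?linear0 // linear_lact. Qed.
Lemma linear_inner U V (h : {linear U -> V}) (phi : seq A -> U) s :
  h (inner phi s) = inner (h \o phi) s.
Proof. by apply: inner_map => x y; rewrite raddfB. Qed.
Lemma linear_trail U V (h : {linear U -> V}) (phi : seq A -> U) s :
  h (trail phi s) = trail (h \o phi) s.
Proof.
elim: s phi => [|a [|b s] IH] phi; rewrite ?linear0 //.
  by rewrite /= raddfN /= linear_ract.
by rewrite !trailE linearN (IH (fun t => phi (a :: t))).
Qed.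
Lemma linear_hoch_d U V (h : {linear U -> V}) (phi : seq A -> U) s :
  h (hoch_d phi s) = hoch_d (h \o phi) s.
Proof.
by rewrite !hoch_dE linearD linearB linear_lead linear_inner linear_trail.
Qed.
Lemma linear_insert U V (h : {linear U -> V}) m F (phi : seq A -> U) s :
  h (insert m F phi s) = insert m F (h \o phi) s.
Proof.
elim: s phi => [|a s IH] phi.
  by rewrite /= !addr0; case: ifP => // _; rewrite linear0.
rewrite !insertE linearD linear_sg IH; congr (_ + _).
by case: ifP => // _; rewrite linear0.
Qed.
End Klinear.

Section Multilinear.
Variables (k : fieldType) (A : algType k) (N : lmodType (env A)).
Implicit Types (phi : seq A -> N) (a b : A) (s t : seq A) (F : seq A -> bimod A).

Lemma multilinear_rec phi : (forall a, multilinear (fun t => phi (a :: t))) ->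
  (forall t c a b, phi (c *: a + b :: t) = lact c%:A (phi (a :: t)) + phi (b :: t)) ->
  multilinear phi.
Proof. by move=> ht hh [|x s] t c a b; [apply: hh|apply: ht]. Qed.

Lemma multilinear_head phi c a b t : multilinear phi ->
  phi (c *: a + b :: t) = lact c%:A (phi (a :: t)) + phi (b :: t).
Proof. by move=> h; apply: (h [::]). Qed.

Lemma multilinear_hoch phi n : multilinear phi -> hoch_cochain n phi.
Proof. by move=> h s t c a b _; apply: h. Qed.

Lemma multilinear_comp (M : lmodType (env A)) (h : M -> N) (phi : seq A -> M) :
  klinear h -> multilinear phi -> multilinear (h \o phi).
Proof. by move=> hl hphi s t c a b; rewrite /= hphi hl. Qed.

Lemma multilinear_sub phi psi : multilinear phi -> multilinear psi ->
  multilinear (fun s => phi s - psi s).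
Proof. by move=> h1 h2 s t c a b; rewrite h1 h2 lactDr lactN; zmod. Qed.
Lemma multilinear_add phi psi : multilinear phi -> multilinear psi ->
  multilinear (fun s => phi s + psi s).
Proof. by move=> h1 h2 s t c a b; rewrite h1 h2 lactDr; zmod. Qed.
Lemma multilinear_sgn (e : bool) phi : multilinear phi ->
  multilinear (fun s => sg e (phi s)).
Proof. by case: e => // h s t c a b; rewrite /= h lactN opprD. Qed.

Lemma multilinear_lead phi : multilinear phi -> multilinear (lead phi).
Proof.
move=> h; apply: multilinear_rec => [a|t c a b] /=.
  by move=> s t c x y; rewrite h lactDr -lact_algC.
by rewrite lactDl lact_alg.
Qed.

Lemma multilinear_inner phi : multilinear phi -> multilinear (inner phi).
Proof.
have base (psi : seq A -> N) t c a b : multilinear psi ->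
    inner psi (c *: a + b :: t) =
    lact c%:A (inner psi (a :: t)) + inner psi (b :: t).
  move=> h; case: t => [|y r]; first by rewrite /= lact0r addr0.
  rewrite !innerE mulrDl -scalerAl (multilinear_head _ _ _ _ h).
  rewrite (_ : (fun t => psi (c *: a + b :: t)) =
    fun t => lact c%:A (psi (a :: t)) + psi (b :: t)); last first.
    by apply/funext => t; apply: multilinear_head.
  by rewrite inner_lin lactDr lactN; zmod.
move=> h s; elim: s phi h => [|x [|y s] IH] phi h t c a b.
- exact: base.
- rewrite !cat_cons !cat0s !innerE mulrDr -scalerAr (multilinear_head _ _ _ _ h).
  rewrite (base (fun t => phi (x :: t))); last exact: multilinear_cons.
  by rewrite lactDr lactN; zmod.
- rewrite !cat_cons !innerE (h (x * y :: s)) -cat_cons.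
  rewrite (IH (fun t => phi (x :: t))); last exact: multilinear_cons.
  by rewrite lactDr lactN; zmod.
Qed.

Lemma trail_cons phi a s : (0 < size s)%N ->
  trail phi (a :: s) = - trail (fun t => phi (a :: t)) s.
Proof. by case: s. Qed.

Lemma multilinear_trail phi : multilinear phi -> multilinear (trail phi).
Proof.
have s0 s t x : (0 < size (s ++ x :: t :> seq A))%N by rewrite size_cat addnS.
move=> h s; elim: s phi h => [|x s IH] phi h t c a b.
  case: t => [|y r].
    by rewrite /= ractDr ract_alg opprD lactN.
  rewrite !trailE (_ : (fun t => phi (c *: a + b :: t)) =
    fun t => lact c%:A (phi (a :: t)) + phi (b :: t)); last first.
    by apply/funext => t; apply: multilinear_head.
  by rewrite trail_lin lactN opprD.
rewrite !cat_cons !trail_cons // (IH (fun t => phi (x :: t))).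
  by rewrite lactN opprD.
exact: multilinear_cons.
Qed.

Lemma multilinear_hoch_d phi : multilinear phi -> multilinear (hoch_d phi).
Proof.
move=> h; rewrite (funext (hoch_dE phi)).
apply/multilinear_add/multilinear_trail => //.
by apply/multilinear_sub/multilinear_inner => //; apply: multilinear_lead.
Qed.

Lemma multilinear_upto p (K : seq A -> seq A -> N) :
  (forall v, multilinear (K^~ v)) -> (forall u, multilinear (K u)) ->
  multilinear (upto p K).
Proof.
elim: p K => [|p IH] K h1 h2.
  rewrite (_ : upto 0 K = K [::]) //.
  by apply/funext => t; rewrite /upto take0 drop0.
apply: multilinear_rec => [a|t c a b].
  apply: (IH (fun u v => K (a :: u) v)) => [v|u]; last exact: h2.
  by move=> s t c x y; apply: (h1 v (a :: s)).
rewrite /upto /=; case: ifP => _; last by rewrite lact0r addr0.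
exact: (h1 (drop p t) [::] (take p t) c a b).
Qed.

Lemma multilinear_insert m F phi : multilinear F -> multilinear phi ->
  multilinear (insert m F phi).
Proof.
move=> hF hphi; rewrite (funext (insertD m F phi)).
have hf (psi : seq A -> N) : multilinear psi -> multilinear (first m F psi).
  move=> h; apply: multilinear_upto => [v|u].
    move=> s t c a b; rewrite hF bimod_lactE mulr_algl; exact: multilinear_head.
  exact: multilinear_cons.
apply/multilinear_add/multilinear_sgn; first exact: hf.
move=> s; elim: s phi hphi => [|x s IH] phi h t c a b.
  rewrite /= -insert_lin; congr (insert _ _ _ t).
  by apply/funext => u; apply: multilinear_head.
rewrite /= !insertD (hf (fun t => phi (x :: t))); last exact: multilinear_cons.
rewrite (IH (fun t => phi (x :: t))); last exact: multilinear_cons.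
by rewrite sgD lactDr sg_lact; zmod.
Qed.

(** Gerstenhaber's formula: up to the insertion of the differential of F, the circle product
    commutes with the differential except for the commutator of cup products. Everything about the
    bracket rests on it. *)
Lemma insert_hoch_d m F phi s : multilinear phi ->
  insert m F (hoch_d phi) s =
  sg (~~ odd m) (hoch_d (insert m F phi) s) + cupl m F phi s - cupr m F phi s
  - sg (~~ odd m) (insert m.+1 (hoch_d F) phi s).
Proof.
move=> h; rewrite (funext (hoch_dE phi)) hoch_dE.
rewrite (sumB3 _ _ _ _ (insertB m F)) insert_lead insert_inner // insert_trail.
by rewrite !(sgD, sgN); zmod.
Qed.

Lemma insertDl m F G phi s : multilinear phi ->
  insert m (fun t => F t + G t) phi s = insert m F phi s + insert m G phi s.
Proof.
elim: s phi => [|a s IH] phi h; rewrite !insertD /rest ?sg0.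
  by rewrite /first /upto; case: ifP => _; rewrite ?multilinearD ?addr0.
rewrite IH; last exact: multilinear_cons.
rewrite /first /upto; case: ifP => _; rewrite ?multilinearD // !sgD; zmod.
Qed.

(** The closed form, for comparison with [hoch_circ]. *)
Lemma insert_sum m F phi s : insert m F phi s =
  \sum_(i < (size s).+1 - m) sg (~~ odd m && odd i)
     (phi (take i s ++ (F (take m (drop i s)) : A) :: drop (i + m) s)).
Proof.
elim: s phi => [|a s IH] phi; rewrite insertD.
  rewrite /rest sg0 addr0 /first /upto; case: m => [|m].
    by rewrite big_ord_recl big_ord0 addr0.
  by rewrite /= subSS sub0n big_ord0.
rewrite /first /upto [size _]/=; case: leqP => ms; last first.
  rewrite /rest IH; have -> : ((size s).+2 - m = 0)%N by apply/eqP; rewrite subn_eq0.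
  have -> : ((size s).+1 - m = 0)%N by apply/eqP; rewrite subn_eq0 ltnW.
  by rewrite !big_ord0 sg0 addr0.
rewrite subSn // big_ord_recl; congr (_ + _).
  by rewrite /= andbF.
rewrite /rest IH; move: (_ - _)%N => n; rewrite /sg; case: odd => /=.
  by apply: eq_bigr => i _.
rewrite -sumrN; apply: eq_bigr => i _; by case: odd; rewrite //= opprK.
Qed.
End Multilinear.

(** * The deconcatenation product of cochains *)

Section Deconcatenation.
Variables (k : fieldType) (A : algType k) (N : lmodType (env A)).
Implicit Types (K : seq A -> seq A -> N) (a b : A) (s t u v : seq A).

(** Dual to the deconcatenation coproduct of the bar construction. *)
Fixpoint decon K s : N :=
  K [::] s + (if s is a :: s' then decon (fun u v => K (a :: u) v) s' else 0).

Lemma deconE K a s :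
  decon K (a :: s) = K [::] (a :: s) + decon (fun u v => K (a :: u) v) s.
Proof. by []. Qed.

Lemma eq_decon K K' s : (forall u v, u ++ v = s -> K u v = K' u v) ->
  decon K s = decon K' s.
Proof.
elim: s K K' => [|a s IH] K K' e; first by rewrite /= e.
by rewrite !deconE e //; congr (_ + _); apply: IH => u v uv; rewrite e //= uv.
Qed.

Lemma decon_lin c K K' s :
  decon (fun u v => lact c (K u v) + K' u v) s = lact c (decon K s) + decon K' s.
Proof.
elim: s K K' => [|a s IH] K K'; first by rewrite /= !addr0.
rewrite !deconE (IH (fun u v => K (a :: u) v) (fun u v => K' (a :: u) v)).
by rewrite lactDr addrACA.
Qed.

Lemma deconD K K' s :
  decon (fun u v => K u v + K' u v) s = decon K s + decon K' s.
Proof.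
rewrite -[decon K s]lact1 -decon_lin; congr (decon _ s).
by apply/funext => u; apply/funext => v; rewrite lact1.
Qed.

Lemma deconB K K' s :
  decon (fun u v => K u v - K' u v) s = decon K s - decon K' s.
Proof.
rewrite addrC -lactN1 -decon_lin; congr (decon _ s).
by apply/funext => u; apply/funext => v; rewrite lactN1 addrC.
Qed.

Lemma decon0 s : decon (fun _ _ => 0) s = 0.
Proof. by elim: s => [|a s IH]; rewrite /= ?addr0 // IH addr0. Qed.

Lemma decon_lact c K s :
  decon (fun u v => lact c (K u v)) s = lact c (decon K s).
Proof.
rewrite -[RHS]addr0 -[in RHS](decon0 s) -decon_lin; congr (decon _ s).
by apply/funext => u; apply/funext => v; rewrite addr0.
Qed.

Lemma decon_nil K s : (forall a u v, K (a :: u) v = 0) -> decon K s = K [::] s.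
Proof.
move=> h; case: s => [|a s]; rewrite /= ?addr0 //.
rewrite (_ : (fun u v => K (a :: u) v) = fun _ _ => 0) ?decon0 ?addr0 //.
by apply/funext => u; apply/funext => v.
Qed.

Lemma lead_decon K s : lead (decon K) s = decon (fun u v => lead (K^~ v) u) s.
Proof.
by case: s => [|a s]; rewrite /= ?addr0 // add0r (decon_lact a K).
Qed.

Lemma inner_decon K s : inner (decon K) s =
  decon (fun u v => inner (K^~ v) u + sg (odd (size u)) (inner (K u) v)) s.
Proof.
elim: s K => [|a [|b r] IH] K; first by rewrite /= !addr0.
  by rewrite /= !(addr0, oppr0).
pose Ka u v := K (a :: u) v.
pose Psi u v := if u is x :: u' then K (a * x :: u') v else 0.
have -> : inner (decon K) [:: a, b & r] =
    inner (K [::]) [:: a, b & r] + decon Psi (b :: r) - inner (decon Ka) (b :: r).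
  rewrite innerE (deconE K (a * b)).
  rewrite (_ : (fun t => decon K (a :: t)) =
    fun t => K [::] (a :: t) + decon Ka t); last by apply/funext.
  by rewrite innerD [decon Psi _]deconE [Psi [::] _]/= add0r innerE; zmod.
rewrite (IH Ka) [RHS]deconE [inner _ [::]]/= add0r [sg _ _]/= -addrA; congr (_ + _).
rewrite -deconB; apply: eq_decon => u v _.
rewrite -[odd (size (a :: u))]/(~~ odd (size u)) sgNb.
by case: u => [|x u]; rewrite ?innerE /= -/Ka ?add0r; zmod.
Qed.

Lemma trail_decon K s : trail (decon K) s =
  decon (fun u v => sg (odd (size u)) (trail (K u) v)) s.
Proof.
elim: s K => [|a [|b r] IH] K; first by rewrite /= addr0.
  by rewrite /= !addr0 oppr0 addr0.
pose Ka u v := K (a :: u) v.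
rewrite trailE (_ : (fun t => decon K (a :: t)) =
    fun t => K [::] (a :: t) + decon Ka t); last by apply/funext.
rewrite trailD (IH Ka) opprD [RHS]deconE
  -[sg _ (trail (K [::]) _)]/(trail (K [::]) [:: a, b & r]) trailE; congr (_ + _).
rewrite -[LHS]add0r -[in LHS](decon0 (b :: r)) -deconB; apply: eq_decon => u v _.
by rewrite add0r -[odd (size (a :: u))]/(~~ odd (size u)) sgNb.
Qed.

Lemma multilinear_decon K : (forall v, multilinear (K^~ v)) ->
  (forall u, multilinear (K u)) -> multilinear (decon K).
Proof.
move=> h1 h2 s; elim: s K h1 h2 => [|x s IH] K h1 h2 t c a b.
  rewrite !deconE (multilinear_head _ _ _ _ (h2 [::])).
  rewrite (_ : (fun u v => K (c *: a + b :: u) v) =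
    fun u v => lact c%:A (K (a :: u) v) + K (b :: u) v); last first.
    by apply/funext => u; apply/funext => v; apply: (h1 v [::]).
  by rewrite decon_lin lactDr addrACA.
rewrite !cat_cons !deconE (h2 [::] (x :: s)).
rewrite (IH (fun u v => K (x :: u) v)); first by rewrite lactDr addrACA.
  by move=> v s'; apply: (h1 v (x :: s')).
by move=> u; apply: h2.
Qed.

End Deconcatenation.

Section ProductOfCochains.
Variables (k : fieldType) (A : algType k) (X Y : lmodType (env A)).
Variable p : X -> X -> Y.
Hypotheses (pDl : forall x x' y, p (x + x') y = p x y + p x' y)
  (pDr : forall x y y', p x (y + y') = p x y + p x y')
  (p_lact : forall a x y, p (lact a x) y = lact a (p x y))
  (p_ract : forall a x y, p x (ract y a) = ract (p x y) a)
  (p_mid : forall a x y, p (ract x a) y = p x (lact a y)).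
Implicit Types (phi psi : seq A -> X).

Let p0l y : p 0 y = 0.
Proof. by apply: (addrI (p 0 y)); rewrite -pDl !addr0. Qed.
Let p0r x : p x 0 = 0.
Proof. by apply: (addrI (p x 0)); rewrite -pDr !addr0. Qed.
Let pBl x x' y : p (x - x') y = p x y - p x' y.
Proof. by rewrite -[in RHS](subrK x' x) [in RHS]pDl addrK. Qed.
Let pBr x y y' : p x (y - y') = p x y - p x y'.
Proof. by rewrite -[in RHS](subrK y' y) [in RHS]pDr addrK. Qed.
Let pNl x y : p (- x) y = - p x y.
Proof. by rewrite -sub0r pBl p0l sub0r. Qed.
Let pNr x y : p x (- y) = - p x y.
Proof. by rewrite -sub0r pBr p0r sub0r. Qed.

(** A telescoping sum: a letter at the end of u acting on the right cancels against the same letter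
    at the start of v acting on the left at the neighbouring cut, since p is balanced over A. *)
Lemma decon_cross phi psi s :
  decon (fun u v => p (trail phi u) (psi v) +
    sg (odd (size u)) (p (phi u) (lead psi v))) s = 0.
Proof.
elim: s phi => [|a s IH] phi; first by rewrite /= p0l p0r !addr0.
pose phia u := phi (a :: u).
rewrite deconE [trail _ _]/= p0l add0r [lead _ _]/= [sg _ _]/=.
rewrite (_ : decon _ s = decon (fun u v => if u is [::]
    then - p (ract (phi [::]) a) (psi v) else 0) s -
  decon (fun u v => p (trail phia u) (psi v) +
    sg (odd (size u)) (p (phia u) (lead psi v))) s).
  by rewrite IH subr0 decon_nil // p_mid subrr.
rewrite -deconB; apply: eq_decon => u v _.
rewrite -[odd (size (a :: u))]/(~~ odd (size u)) sgNb.
case: u => [|b u]; first by rewrite /= pNl p0l add0r.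
by rewrite trailE pNl sub0r opprD.
Qed.

(** The Leibniz rule: the deconcatenation product of two chain maps is again a chain map. *)
Lemma hoch_d_decon phi psi s :
  hoch_d (decon (fun u v => p (phi u) (psi v))) s =
  decon (fun u v => p (hoch_d phi u) (psi v) +
    sg (odd (size u)) (p (phi u) (hoch_d psi v))) s.
Proof.
rewrite hoch_dE lead_decon inner_decon trail_decon.
(* The differentials of the factors contain actions of the letters next to the cut, which the
   differential of the product lacks; their sum is 0 and is added here. *)
rewrite -[LHS]addr0 -(decon_cross phi psi s) -deconB -!deconD.
apply: eq_decon => u v _; rewrite !hoch_dE.
have -> : lead ((fun u v => p (phi u) (psi v))^~ v) u = p (lead phi u) (psi v).
  by case: u => [|a u] /=; rewrite ?p0l // p_lact.
have -> : inner ((fun u v => p (phi u) (psi v))^~ v) u = p (inner phi u) (psi v).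
  by rewrite (inner_map _ _ (h := p^~ (psi v))) // => x y; apply: pBl.
have -> : inner ((fun u v => p (phi u) (psi v)) u) v = p (phi u) (inner psi v).
  by rewrite (inner_map _ _ (h := p (phi u))) // => x y; apply: pBr.
have -> : trail ((fun u v => p (phi u) (psi v)) u) v = p (phi u) (trail psi v).
  elim: v psi => [|a [|b v] IH] psi; rewrite ?p0r //.
    by rewrite /= pNr p_ract.
  by rewrite !trailE pNr (IH (fun t => psi (a :: t))).
rewrite !(pDl, pNl, pDr, pNr, sgD, sgN); zmod.
Qed.

Lemma multilinear_decon_prod phi psi : multilinear phi -> multilinear psi ->
  multilinear (decon (fun u v => p (phi u) (psi v))).
Proof.
move=> h1 h2; apply: multilinear_decon => [v|u] s t c a b.
  by rewrite h1 pDl p_lact.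
rewrite h2 pDr; congr (_ + _).
(* Scalars act equally from both sides, so [p_ract] takes them out of the second factor. *)
have h (M : lmodType (env A)) (z : M) : lact c%:A z = ract z c%:A.
  by rewrite ract_alg ract1.
by rewrite !h p_ract.
Qed.

End ProductOfCochains.

Section Circle.
Variables (k : fieldType) (A : algType k).

Lemma hoch_circE m n (F G : seq A -> bimod A) s :
  (forall t, size t != m -> F t = 0) -> size s = (m + n).-1 ->
  hoch_circ m n F G s = insert n G F s.
Proof.
move=> hF es; rewrite insert_sum /hoch_circ.
have sgE' (i : nat) (x : bimod A) :
    sgn (env A) ((n%:Z - 1) * i%:Z) *: x = sg (~~ odd n && odd i) x.
  rewrite /sgn abszM sgE oddM; congr (sg (_ && _) x).
  by case: n {es} => // n; rewrite -addn1 PoszD addrK addn1 /= negbK.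
(* For m = n = 0 the length (m + n).-1 is truncated: the sum [hoch_circ] is empty, while [insert]
   has one term, the value of F on a sequence of length 1, which is 0 by [hF]. *)
have [e0|mn] := posnP (m + n).
  move/eqP: e0; rewrite addn_eq0 => /andP[/eqP em /eqP en]; subst m n.
  rewrite big_ord0 (size0nil es) /= subn0 big_ord_recl big_ord0 addr0 /=.
  by rewrite hF.
have -> : ((size s).+1 - n = m)%N by rewrite es prednK // addnK.
by apply: eq_bigr => i _; rewrite sgE'.
Qed.

End Circle.

Section HochDifferential.
Variables (k : fieldType) (A : algType k) (N : lmodType (env A)).
Implicit Types (phi psi : seq A -> N).

Lemma hoch_dB phi psi s :
  hoch_d (fun t => phi t - psi t) s = hoch_d phi s - hoch_d psi s.
Proof. by rewrite !hoch_dE leadB innerB trailB; zmod. Qed.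

Lemma hoch_d0 s : hoch_d (fun=> 0 : N) s = 0.
Proof.
rewrite -[RHS](subrr (hoch_d (fun=> 0 : N) s)) -hoch_dB.
by congr hoch_d; apply/funext => t; rewrite subrr.
Qed.

Lemma hoch_dN phi s : hoch_d (fun t => - phi t) s = - hoch_d phi s.
Proof.
rewrite -[RHS]add0r -(hoch_d0 s) -hoch_dB.
by congr hoch_d; apply/funext => t; rewrite sub0r.
Qed.

Lemma hoch_dD phi psi s :
  hoch_d (fun t => phi t + psi t) s = hoch_d phi s + hoch_d psi s.
Proof.
rewrite -[hoch_d psi s]opprK -hoch_dN -hoch_dB.
by congr hoch_d; apply/funext => t; rewrite opprK.
Qed.

Lemma hoch_d_sg (e : bool) phi s : hoch_d (fun t => sg e (phi t)) s = sg e (hoch_d phi s).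
Proof. by case: e; rewrite //= hoch_dN. Qed.
End HochDifferential.

(** * Lifting along contractible complexes *)

(* A bimodule complex X with augmentation to A, the grading being left        *)
(* implicit, together with a contracting homotopy that is only k-linear.      *)
Record contraction (k : fieldType) (A : algType k) (X : lmodType (env A))
    (d : X -> X) (mu : X -> bimod A) (eta : bimod A -> X) (t : X -> X) : Prop :=
  Contraction {
  contr_eta : klinear eta;
  contr_t : klinear t;
  contr_mu_eta : forall a, mu (eta a) = a;
  contr_mu_t : forall x, mu (t x) = 0;
  contr_d_eta : forall a, d (eta a) = 0;
  contr_dt : forall x, d (t x) + t (d x) = x - eta (mu x) }.

Section Lifting.
Variables (k : fieldType) (A : algType k) (X : lmodType (env A)).
Variables (d : {linear X -> X}) (mu : {linear X -> bimod A}).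
Variables (eta : bimod A -> X) (t : X -> X) (hX : contraction d mu eta t).
Variables (e : bool) (phi : seq A -> X) (h : seq A -> bimod A).
Hypotheses (phi_lin : multilinear phi) (h_lin : multilinear h).

(** The differential of w at s reads w on sequences one letter shorter, so w = eta h + t (phi - e
    (hoch_d w)) is a recursion on the length of s. The number n is fuel; (size s).+1 suffices. *)
Fixpoint lifting_upto n s : X :=
  if n is n'.+1 then eta (h s) + t (phi s - sg e (hoch_d (lifting_upto n') s))
  else 0.

Definition lifting s := lifting_upto (size s).+1 s.

Lemma multilinear_lifting_upto n : multilinear (lifting_upto n).
Proof.
elim: n => [|n IH] /=; first by move=> s u c a b; rewrite lact0r addr0.
apply: multilinear_add.
  by apply: (multilinear_comp (contr_eta hX) h_lin).
apply: (multilinear_comp (h := t) (phi := fun s => _) (contr_t hX)).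
by apply/multilinear_sub/multilinear_sgn/multilinear_hoch_d.
Qed.

Lemma multilinear_lifting : multilinear lifting.
Proof.
move=> s u c a b; rewrite /lifting multilinear_lifting_upto.
by rewrite !size_cat /= !addnS.
Qed.

Lemma liftingE s : lifting s = eta (h s) + t (phi s - sg e (hoch_d lifting s)).
Proof.
rewrite {1}/lifting /=; congr (_ + t (_ - sg e _)).
by apply: eq_hoch_d => u <-.
Qed.

Lemma mu_lifting s : mu (lifting s) = h s.
Proof. by rewrite liftingE linearD (contr_mu_eta hX) (contr_mu_t hX) addr0. Qed.

Hypothesis d_phi : forall s, d (phi s) = sg e (hoch_d phi s).
Hypothesis mu_phi : forall s, mu (phi s) = sg e (hoch_d h s).

(** By induction on the length, phi - e (hoch_d w) is a cycle killed by mu, and t exhibits it as a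
    boundary. *)
Lemma d_lifting s : d (lifting s) + sg e (hoch_d lifting s) = phi s.
Proof.
have [n] := ubnP (size s); elim: n s => // n IH s sn.
set z := phi s - sg e (hoch_d lifting s).
have muz : mu z = 0.
  rewrite linearB mu_phi linear_sg linear_hoch_d.
  by rewrite (funext mu_lifting : mu \o lifting = h) subrr.
have dz : d z = 0.
  rewrite linearB d_phi linear_sg linear_hoch_d.
  rewrite (@eq_hoch_d _ _ _ (d \o lifting)
    (fun u => phi u - sg e (hoch_d lifting u))); last first.
    move=> u us; rewrite /= -{1}(IH u) ?addrK //.
    by rewrite -ltnS us.
  by rewrite hoch_dB hoch_d_sg hoch_dd sg0 subr0 subrr.
have := contr_dt hX z; rewrite dz muz.
rewrite (klinear0 (contr_t hX)) (klinear0 (contr_eta hX)) addr0 subr0 => dtz.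
by rewrite liftingE linearD (contr_d_eta hX) -/z dtz add0r subrK.
Qed.

(** The comparison theorem in terms of cochains, and the single source of chain maps and homotopies.
    With phi = 0, e true and h the unit cochain it yields a chain map from the bar resolution; the
    other choices yield homotopies. *)
Lemma lifting_exists : exists w : seq A -> X, [/\ multilinear w,
  forall s, mu (w s) = h s & forall s, d (w s) + sg e (hoch_d w s) = phi s].
Proof.
by exists lifting; split;
  [apply: multilinear_lifting|apply: mu_lifting|apply: d_lifting].
Qed.
End Lifting.

(** The augmentation of the bar resolution, as a cochain. *)
Definition unit_cochain (k : fieldType) (A : algType k) (s : seq A) : bimod A :=
  if s is [::] then (1 : A) else 0.

(** * Insertion into iota compared with a homotopy lifting *)

Section Comparison.
Variables (k : fieldType) (A : algType k) (X Y : lmodType (env A)).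
Variables (dX : {linear X -> X}) (muX : {linear X -> bimod A}).
Variables (etaX : bimod A -> X) (tX : X -> X) (hX : contraction dX muX etaX tX).
Variables (dY : {linear Y -> Y}) (muY : {linear Y -> bimod A}).
Variables (etaY : bimod A -> Y) (tY : Y -> Y) (hY : contraction dY muY etaY tY).
Variables (Delta : {linear X -> Y}).
Hypotheses (Delta_d : forall x, dY (Delta x) = Delta (dX x))
  (Delta_mu : forall x, muY (Delta x) = muX x).

Variables (iota : seq A -> X) (U : seq A -> Y).
Hypotheses (iota_lin : multilinear iota) (U_lin : multilinear U)
  (d_iota : forall s, dX (iota s) = hoch_d iota s)
  (mu_iota : forall s, muX (iota s) = unit_cochain s)
  (d_U : forall s, dY (U s) = hoch_d U s)
  (mu_U : forall s, muY (U s) = unit_cochain s).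

(* L0 and R0 are mu (x) 1 and 1 (x) mu.                                       *)
Variables (L0 R0 : {linear Y -> X}).
Hypotheses (d_L0 : forall y, dX (L0 y) = L0 (dY y))
  (d_R0 : forall y, dX (R0 y) = R0 (dY y))
  (mu_L0 : forall y, muX (L0 y) = muX (R0 y))
  (LR_U : forall s, L0 (U s) = R0 (U s)).

(* L and R are f (x) 1 and 1 (x) f.                                           *)
Record lifting_datum (m : nat) (f : {linear X -> bimod A})
    (L R : {linear Y -> X}) (psi : {linear X -> X}) : Prop := LiftingDatum {
  ld_f : forall x, f (dX x) = 0;
  ld_dL : forall y, dX (L y) = sg (odd m) (L (dY y));
  ld_dR : forall y, dX (R y) = sg (odd m) (R (dY y));
  ld_LU : forall s, L (U s) = cupl m (f \o iota) iota s;
  ld_RU : forall s, R (U s) = cupr m (f \o iota) iota s;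
  ld_fL0 : forall y, f (L0 y) = muX (R y);
  ld_fR0 : forall y, f (R0 y) = muX (L y);
  ld_psi : forall x, dX (psi x) - sg (~~ odd m) (psi (dX x)) =
    L (Delta x) - R (Delta x);
  ld_mu : exists (psi0 : {linear X -> X}) (hf : {linear X -> bimod A}),
    [/\ forall x, dX (psi0 x) + psi0 (dX x) = L0 (Delta x) - R0 (Delta x),
        forall x, muX (psi0 x) = 0
      & forall x, muX (psi x) - sg (~~ odd m) (f (psi0 x)) = hf (dX x)] }.

(** U and Delta iota are chain maps to Y over the identity of A, and Y is contractible. *)
Lemma diagonal_comparison : exists2 u : seq A -> Y, multilinear u &
  forall s, dY (u s) + hoch_d u s = U s - Delta (iota s).
Proof.
have [||s|s|u [ul _ uE]] := @lifting_exists _ _ _ _ _ _ _ hY false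
   (fun s => U s - Delta (iota s)) (fun=> 0); last by exists u.
- apply: multilinear_sub U_lin _.
  exact: multilinear_comp (linear_klinear Delta) iota_lin.
- by move=> s u c a b; rewrite lact0r addr0.
- by rewrite linearB d_U Delta_d d_iota linear_hoch_d hoch_dB.
- by rewrite linearB mu_U Delta_mu mu_iota subrr hoch_d0.
Qed.

Lemma insert0l (N : lmodType (env A)) m (phi : seq A -> N) s : multilinear phi ->
  insert m (fun=> 0) phi s = 0.
Proof.
move=> h; apply: (addrI (insert m (fun=> 0) phi s)).
by rewrite -insertDl // !addr0.
Qed.

Section OneCocycle.
Variables (u : seq A -> Y) (u_lin : multilinear u)
  (u_eq : forall s, dY (u s) + hoch_d u s = U s - Delta (iota s)).
Variables (m : nat) (f : {linear X -> bimod A}) (L R : {linear Y -> X})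
  (psi : {linear X -> X}) (D : lifting_datum m f L R psi).

Let F : seq A -> bimod A := f \o iota.

Let F_lin : multilinear F.
Proof. exact: multilinear_comp (linear_klinear f) iota_lin. Qed.

Lemma hoch_d_cocycle s : hoch_d F s = 0.
Proof. by rewrite -linear_hoch_d -d_iota (ld_f D). Qed.

Let h_comp (M N : lmodType (env A)) (h : {linear M -> N}) phi s :
  hoch_d (fun t => h (phi t)) s = h (hoch_d phi s).
Proof. by rewrite linear_hoch_d. Qed.

(** Since L0 and R0 agree on U, the boundary of psi0 iota is cancelled by that of (L0 - R0) u. The
    sum psi0 iota + (L0 - R0) u is thus a cycle with augmentation 0, hence null-homotopic, and f
    turns the homotopy w into the primitive h0 = f w. *)
Lemma psi0_comparison : exists (psi0 : {linear X -> X}) (hf : {linear X -> bimod A})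
    (h0 : seq A -> bimod A), [/\ multilinear h0,
    forall x, muX (psi x) - sg (~~ odd m) (f (psi0 x)) = hf (dX x)
  & forall s, f (psi0 (iota s)) = hoch_d h0 s - f (L0 (u s)) + f (R0 (u s))].
Proof.
have [psi0 [hf [hpsi0 mu0 hpsi]]] := ld_mu D.
have lin (M : lmodType (env A)) (h : {linear Y -> M}) : multilinear (h \o u).
  exact: multilinear_comp (linear_klinear h) u_lin.
have [||s|s|w [wl _ wE]] := @lifting_exists _ _ _ _ _ _ _ hX true
   (fun s => - psi0 (iota s) - (L0 (u s) - R0 (u s))) (fun=> 0).
- apply: multilinear_sub.
    apply: (@multilinear_sgn _ _ _ true (psi0 \o iota)).
    exact: multilinear_comp (linear_klinear psi0) iota_lin.
  exact: multilinear_sub (lin _ L0) (lin _ R0).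
- by move=> s u' c a b; rewrite lact0r addr0.
- have e : dY (u s) = U s - Delta (iota s) - hoch_d u s by rewrite -u_eq addrK.
  rewrite !(linearB dX, linearN dX) d_L0 d_R0 e !(linearB L0, linearB R0) LR_U.
  have := hpsi0 (iota s); rewrite d_iota => /(canRL (addrK _)) ->.
  by rewrite /sg !(hoch_dB, hoch_dN, h_comp); zmod.
- rewrite !(linearB muX, linearN muX) mu0 mu_L0 hoch_d0 /sg; zmod.
exists psi0, hf, (f \o w); split=> //.
  exact: multilinear_comp (linear_klinear f) wl.
move=> s; have := congr1 f (wE s).
rewrite (linearD f (dX _)) (linear_sg f) linear_hoch_d (ld_f D) add0r.
rewrite !(linearB f, linearN f) => e.
have -> : f (psi0 (iota s)) = - (- f (psi0 (iota s)) - (f (L0 (u s)) - f (R0 (u s))))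
   - f (L0 (u s)) + f (R0 (u s)) by zmod.
by rewrite -e /= opprK.
Qed.

Lemma insert_unit_cochain s : insert m F (@unit_cochain k A) s = 0.
Proof.
rewrite (@eq_insert _ _ _ _ _ _ (fun=> 0)) ?insert0 //.
by case.
Qed.

(** The insertion of F into iota has boundary (L - R) U by [insert_hoch_d], and psi iota has
    boundary (L - R) Delta iota, up to sign and the differential of the cochain. The term in u makes
    up for the difference of U and Delta iota, so the left side is a cycle. *)
Lemma insert_comparison : exists2 h : seq A -> X, multilinear h & forall s,
  insert m F iota s - psi (iota s) + sg (~~ odd m) (L (u s) - R (u s)) =
  dX (h s) + sg (~~ odd m) (hoch_d h s).
Proof.
have [psi0 [hf [h0 [h0_lin hpsi h0E]]]] := psi0_comparison.
have lin (M : lmodType (env A)) (h : {linear Y -> M}) : multilinear (h \o u).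
  exact: multilinear_comp (linear_klinear h) u_lin.
have liX (M : lmodType (env A)) (h : {linear X -> M}) : multilinear (h \o iota).
  exact: multilinear_comp (linear_klinear h) iota_lin.
have iF : multilinear (insert m F iota) by apply: multilinear_insert.
(* The second function is a primitive of the augmentation of the first: mu kills the insertion, mu
   psi is +- f psi0 up to hf, and by [psi0_comparison] with f L0 = mu R and f R0 = mu L the terms in
   u cancel. *)
have [||s|s|w [wl _ wE]] := @lifting_exists _ _ _ _ _ _ _ hX (~~ odd m)
   (fun s => insert m F iota s - psi (iota s) + sg (~~ odd m) (L (u s) - R (u s)))
   (fun s => - h0 s - sg (~~ odd m) (hf (iota s))); last by exists w.
- apply/multilinear_add/multilinear_sgn.
    exact: multilinear_sub iF (liX _ psi).
  exact: multilinear_sub (lin _ L) (lin _ R).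
- apply: multilinear_sub (multilinear_sgn _ (liX _ hf)).
  exact: (@multilinear_sgn _ _ _ true).
- have e : dY (u s) = U s - Delta (iota s) - hoch_d u s by rewrite -u_eq addrK.
  rewrite !(linearB dX, linearD dX, linear_sg dX) (ld_dL D) (ld_dR D) e.
  rewrite !(linearB L, linearB R).
  rewrite (ld_LU D) (ld_RU D) linear_insert (funext d_iota : dX \o iota = _).
  rewrite insert_hoch_d // (funext hoch_d_cocycle) insert0l // sg0 subr0.
  have := ld_psi D (iota s); rewrite d_iota => /(canRL (subrK _)) ->.
  rewrite !(hoch_dD, hoch_dB, hoch_d_sg, h_comp) -/F.
  by case: odd; rewrite /sg /=; zmod.
- rewrite !(linearB muX, linearD muX, linear_sg muX) linear_insert.
  rewrite (funext mu_iota : muX \o iota = _) insert_unit_cochain.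
  have := hpsi (iota s); rewrite d_iota => /(canRL (subrK _)) ->.
  rewrite h0E (ld_fL0 D) (ld_fR0 D) !(hoch_dB, hoch_dN, hoch_d_sg, h_comp).
  by case: odd; rewrite /sg /=; zmod.
Qed.

End OneCocycle.

Variables (m n : nat) (f g : {linear X -> bimod A}) (Lf Rf Lg Rg : {linear Y -> X}).
Variables (psif psig : {linear X -> X}).
Hypotheses (Df : lifting_datum m f Lf Rf psif) (Dg : lifting_datum n g Lg Rg psig).
Hypotheses (fLg : forall y, f (Lg y) = sg (odd m && odd n) (g (Rf y)))
  (fRg : forall y, f (Rg y) = sg (odd m && odd n) (g (Lf y))).

(** Apply f to the comparison for g, and g to the comparison for f. The boundary terms die because f
    and g are cocycles, and [fLg], [fRg] make the terms in u equal up to the sign with which the two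
    comparisons are subtracted. *)
Lemma circle_comparison :
  exists2 h : seq A -> bimod A, multilinear h & forall s,
    f (psig (iota s)) - sg (~~ odd m && ~~ odd n) (g (psif (iota s))) -
    (insert n (g \o iota) (f \o iota) s -
     sg (~~ odd m && ~~ odd n) (insert m (f \o iota) (g \o iota) s)) = hoch_d h s.
Proof.
have [u u_lin u_eq] := diagonal_comparison.
have [wf wfl wfE] := insert_comparison u_lin u_eq Df.
have [wg wgl wgE] := insert_comparison u_lin u_eq Dg.
exists (fun s => - (sg (~~ odd n) (f (wg s)) -
    sg (~~ odd m && ~~ odd n) (sg (~~ odd m) (g (wf s))))).
  apply: (@multilinear_sgn _ _ _ true); apply: multilinear_sub.
    exact: multilinear_sgn _ (multilinear_comp (linear_klinear f) wgl).
  exact/multilinear_sgn/multilinear_sgn/(multilinear_comp (linear_klinear g) wfl).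
move=> s; have := congr1 f (wgE s); have := congr1 g (wfE s).
rewrite !(linearD f _ (sg _ _), linearD g _ (sg _ _), linear_sg f, linear_sg g).
rewrite !(linearB f, linearB g) !linear_hoch_d.
rewrite !(linear_insert, ld_f Df, ld_f Dg).
rewrite !add0r fLg fRg => ef eg.
rewrite hoch_dN hoch_dB !hoch_d_sg -/(f \o wg) -/(g \o wf).
rewrite -eg -ef; case: (odd m) (odd n) => [] []; rewrite /sg /=; zmod.
Qed.

End Comparison.

(** * The bracket on cohomology classes *)

Section Invariance.
Variables (k : fieldType) (A : algType k).
Implicit Types (F G h : seq A -> bimod A) (s : seq A).

Lemma cuprS (N : lmodType (env A)) m F (phi : seq A -> N) s : (m <= size s)%N ->
  cupr m F phi s = sg (odd m && odd (size s - m))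
    (ract (phi (take (size s - m) s)) (F (drop (size s - m) s))).
Proof.
elim: s phi => [|a s IH] phi; first by case: m.
rewrite cuprE leq_eqVlt eq_sym [size _]/= => /predU1P[->|ms].
  by rewrite eqxx subnn andbF drop0 take0.
rewrite gtn_eqF // subSn // IH // [odd _.+1]/= sgM.
by congr (sg _ _); case: odd; case: odd.
Qed.

(** With values in A both actions are multiplication, so in the top degree each side is, up to sign,
    F on the first p letters times G on the others. *)
Lemma cupr_cupl p q F G s : size s = (p + q)%N ->
  cupr q G F s = sg (odd p && odd q) (cupl p F G s).
Proof.
move=> es; rewrite cuprS ?es ?leq_addl // addnK andbC /cupl es leq_addr.
by rewrite bimod_ractE bimod_lactE.
Qed.

(** The bracket on sequences of every length. It is the Gerstenhaber bracket when F and G vanish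
    outside degrees m and n, see [hoch_bracketE]. *)
Definition bracket m n F G s : bimod A :=
  insert n G F s - sg (~~ odd m && ~~ odd n) (insert m F G s).

(** [insert_hoch_d] expresses both circle products of F with the differential of h; the cup products
    that appear cancel by [cupr_cupl], and a coboundary remains. *)
Lemma bracket_hoch_dr m q F h : multilinear F -> multilinear h ->
  (forall s, hoch_d F s = 0) ->
  exists2 h' : seq A -> bimod A, multilinear h' &
    forall s, size s = (m + q)%N -> bracket m q.+1 F (hoch_d h) s = hoch_d h' s.
Proof.
move=> Fl hl dF.
exists (fun s => insert q h F s -
  sg (~~ odd m && odd q) (sg (~~ odd m) (insert m F h s))).
  apply: multilinear_sub; first exact: multilinear_insert.
  exact/multilinear_sgn/multilinear_sgn/multilinear_insert.
move=> s es; rewrite hoch_dB !hoch_d_sg /bracket [odd q.+1]/= negbK.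
have := insert_hoch_d q h s Fl; rewrite (funext dF) insert0.
rewrite (cupr_cupl _ _ es) => e1.
have := insert_hoch_d m F s hl; rewrite (funext dF) insert0l // sg0 subr0.
rewrite [cupr m F h s](@cupr_cupl q m) ?[(q + m)%N]addnC // => ->.
(* By [e1] the added expression is 0; it trades the insertion of the differential of h into F for a
   coboundary and cup products. *)
have -> : insert q.+1 (hoch_d h) F s = insert q.+1 (hoch_d h) F s +
   sg (~~ odd q) (sg (~~ odd q) (hoch_d (insert q h F) s) + cupl q h F s -
   sg (odd m && odd q) (cupl m F h s) - sg (~~ odd q) (insert q.+1 (hoch_d h) F s)).
  by rewrite -e1 sg0 addr0.
by case: (odd m) (odd q) => [] []; rewrite /sg /=; zmod.
Qed.

(* A cochain h of degree m - 1, hence zero if m = 0.                          *)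
Definition primitive_degree m h := (exists q, m = q.+1) \/ h = fun=> 0.

Lemma bracket_hoch_d m n F h : multilinear F -> multilinear h ->
  (forall s, hoch_d F s = 0) -> primitive_degree n h ->
  exists2 h' : seq A -> bimod A, multilinear h' &
    forall s, size s = (m + n).-1 -> bracket m n F (hoch_d h) s = hoch_d h' s.
Proof.
move=> Fl hl dF [[q ->]|->].
  have [h' h'l h'E] := bracket_hoch_dr m q Fl hl dF.
  by exists h' => // s; rewrite addnS; apply: h'E.
exists (fun=> 0) => [s t c a b|s _]; first by rewrite lact0r addr0.
by rewrite (funext (hoch_d0 _)) /bracket insert0l // insert0 sg0 subr0.
Qed.

(** By biadditivity one argument changes at a time: h1 is a primitive of the bracket of F + d hF
    with d hG, and h2 one of the bracket of G with d hF, which antisymmetry turns round. *)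
Lemma bracket_cohomologous m n F G hF hG :
  multilinear F -> multilinear G -> multilinear hF -> multilinear hG ->
  (forall s, hoch_d F s = 0) -> (forall s, hoch_d G s = 0) ->
  primitive_degree m hF -> primitive_degree n hG ->
  exists2 h : seq A -> bimod A, multilinear h &
    forall s, size s = (m + n).-1 ->
      bracket m n (fun t => F t + hoch_d hF t) (fun t => G t + hoch_d hG t) s =
      bracket m n F G s + hoch_d h s.
Proof.
move=> Fl Gl hFl hGl dF dG pF pG.
have dFl := multilinear_hoch_d hFl; have dGl := multilinear_hoch_d hGl.
have dF' s : hoch_d (fun t => F t + hoch_d hF t) s = 0.
  by rewrite hoch_dD dF hoch_dd addr0.
have [h1 h1l e1] := bracket_hoch_d m (multilinear_add Fl dFl) hGl dF' pG.
have [h2 h2l e2] := bracket_hoch_d n Gl hFl dG pF.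
exists (fun s => h1 s - sg (~~ odd m && ~~ odd n) (h2 s)).
  exact: multilinear_sub h1l (multilinear_sgn _ h2l).
move=> s es; rewrite hoch_dB hoch_d_sg -e1 // -e2; last by rewrite addnC.
have insD p (H phi psi : seq A -> bimod A) :
    insert p H (fun t => phi t + psi t) s = insert p H phi s + insert p H psi s.
  by rewrite -[insert p H phi s]lact1 -insert_lin; congr (insert _ _ _ s);
    apply/funext => t; rewrite lact1.
move: (hoch_d hF) (hoch_d hG) dFl dGl => dhF dhG dFl dGl.
rewrite /bracket !insD !(insertDl, insD) //; try exact: multilinear_add.
by case: (odd m) (odd n) => [] []; rewrite /sg /=; zmod.
Qed.
End Invariance.

(** * Products of modules *)

Definition mkLinear (R : pzRingType) (M N : lmodType R) (h : M -> N)
  (hl : linear h) : {linear M -> N} :=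
  HB.pack h (GRing.isLinear.Build _ _ _ _ h hl).

Definition prodmod (R : pzRingType) (I : Type) (M : I -> lmodType R) : Type :=
  forall i, M i.

Section ProductModule.
Variables (R : pzRingType) (I : Type) (M : I -> lmodType R).
Local Notation T := (prodmod M).

HB.instance Definition _ := gen_eqMixin T.
HB.instance Definition _ := gen_choiceMixin T.

Definition prodmod_zero : T := fun _ => 0.
Definition prodmod_add (x y : T) : T := fun i => x i + y i.
Definition prodmod_opp (x : T) : T := fun i => - x i.
Definition prodmod_scale (r : R) (x : T) : T := fun i => r *: x i.

Lemma prodmod_ext (x y : T) : (forall i, x i = y i) -> x = y.
Proof. exact: functional_extensionality_dep. Qed.

Lemma prodmod_addA : associative prodmod_add.
Proof. by move=> x y z; apply/prodmod_ext => i; apply: addrA. Qed.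
Lemma prodmod_addC : commutative prodmod_add.
Proof. by move=> x y; apply/prodmod_ext => i; apply: addrC. Qed.
Lemma prodmod_add0 : left_id prodmod_zero prodmod_add.
Proof. by move=> x; apply/prodmod_ext => i; apply: add0r. Qed.
Lemma prodmod_addN : left_inverse prodmod_zero prodmod_opp prodmod_add.
Proof. by move=> x; apply/prodmod_ext => i; apply: addNr. Qed.
HB.instance Definition _ := GRing.isZmodule.Build T
  prodmod_addA prodmod_addC prodmod_add0 prodmod_addN.

Lemma prodmod_scaleA a b (x : T) :
  prodmod_scale a (prodmod_scale b x) = prodmod_scale (a * b) x.
Proof. by apply/prodmod_ext => i; apply: scalerA. Qed.
Lemma prodmod_scale1 : left_id 1 prodmod_scale.
Proof. by move=> x; apply/prodmod_ext => i; apply: scale1r. Qed.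
Lemma prodmod_scaleDr : right_distributive prodmod_scale +%R.
Proof. by move=> a x y; apply/prodmod_ext => i; apply: scalerDr. Qed.
Lemma prodmod_scaleDl x : {morph prodmod_scale^~ x : a b / a + b}.
Proof. by move=> a b; apply/prodmod_ext => i; apply: scalerDl. Qed.
HB.instance Definition _ := GRing.Zmodule_isLmodule.Build R T
  prodmod_scaleA prodmod_scale1 prodmod_scaleDr prodmod_scaleDl.

Lemma prodmodD (x y : T) i : (x + y) i = x i + y i. Proof. by []. Qed.
Lemma prodmodN (x : T) i : (- x) i = - x i. Proof. by []. Qed.
Lemma prodmodZ a (x : T) i : (a *: x) i = a *: x i. Proof. by []. Qed.
End ProductModule.

(** * The bimodules M (x) A *)

(** [tlift] is a finite sum over a chosen representative, so an additive map passes inside. *)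
Lemma tlift_map (S : Type) (M N : zmodType) (ra : M -> S -> M) (la : S -> N -> N)
    (U U' : zmodType) (h : U -> U') (b : M -> N -> U) (x : btens ra la) :
  {morph h : u v / u + v} -> h (tlift b x) = tlift (fun m n => h (b m n)) x.
Proof.
move=> hD; have h0 : h 0 = 0 by apply: (addrI (h 0)); rewrite -hD !addr0.
exact: (big_morph h hD h0).
Qed.

Lemma additive0 (U V : zmodType) (h : U -> V) :
  (forall x y, h (x + y) = h x + h y) -> h 0 = 0.
Proof. by move=> hD; apply: (addrI (h 0)); rewrite -hD !addr0. Qed.

Lemma tens_ext (S : Type) (M N : zmodType) (ra : M -> S -> M) (la : S -> N -> N)
    (U : zmodType) (f g : btens ra la -> U) :
  (forall x y, f (x + y) = f x + f y) -> (forall x y, g (x + y) = g x + g y) ->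
  (forall m n, f (tpure m n) = g (tpure m n)) -> forall x, f x = g x.
Proof.
move=> fD gD e; elim/tens_ind=> [|x y ex ey|//]; first by rewrite !additive0.
by rewrite fD gD ex ey.
Qed.

Lemma tliftDf (S : Type) (M N : zmodType) (ra : M -> S -> M) (la : S -> N -> N)
    (U : zmodType) (b c : M -> N -> U) (x : btens ra la) :
  tlift (fun m n => b m n + c m n) x = tlift b x + tlift c x.
Proof. exact: big_split. Qed.

Section EnvLinear.
Variables (k : fieldType) (A : algType k).

Lemma env_ind (Q : env A -> Prop) : Q 0 ->
  (forall u v, Q u -> Q v -> Q (u + v)) -> (forall (a : A) (b : A^c), Q (a ⊗ b)) ->
  forall u, Q u.
Proof. exact: tprod_ind. Qed.

Lemma env_scaleE (U : lmodType (env A)) (a : A) (b : A^c) (x : U) :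
  (a ⊗ b : env A) *: x = lact a (ract x (b : A)).
Proof.
rewrite /lact /ract scalerA; congr (_ *: _); symmetry.
by rewrite [LHS]talg_mulE; congr (_ ⊗ _); rewrite ?mulr1 ?mul1r.
Qed.

(** A^e is spanned by the a (x) b, so linearity over it may be checked on the left and the right
    action separately. *)
Lemma env_linear (U V : lmodType (env A)) (h : U -> V) : {morph h : x y / x + y} ->
  (forall a x, h (lact a x) = lact a (h x)) ->
  (forall x a, h (ract x a) = ract (h x) a) -> linear h.
Proof.
move=> hD hl hr u x y; rewrite hD; congr (_ + _).
have h0 : h 0 = 0 by apply: (addrI (h 0)); rewrite -hD !addr0.
elim/env_ind: u => [|u v IHu IHv|a b].
- by rewrite !scale0r.
- by rewrite !scalerDl hD IHu IHv.
- by rewrite !env_scaleE hl hr.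
Qed.
End EnvLinear.

Section TensorMap.
Variables (k : fieldType) (V1 W1 V2 W2 : lmodType k) (f : V1 -> V2) (g : W1 -> W2).
Hypotheses (fl : linear f) (gl : linear g).

Lemma tmap_bilin : bilin (fun v w => f v ⊗ g w).
Proof.
have D (M N : lmodType k) (h : M -> N) : linear h -> forall x y, h (x + y) = h x + h y.
  by move=> hl x y; rewrite -{1}[x]scale1r hl scale1r.
have Z (M N : lmodType k) (h : M -> N) : linear h -> forall c x, h (c *: x) = c *: h x.
  move=> hl c x; have h0 : h 0 = 0 by apply: (addrI (h 0)); rewrite -D // !addr0.
  by rewrite -[c *: x]addr0 hl h0 addr0.
split=> [v v' w|v w w'|c v w|c v w].
- by rewrite D // tprodDl.
- by rewrite D // tprodDr.
- by rewrite Z // tprodZl.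
- by rewrite Z // tprodZr.
Qed.
Lemma tmap_pure v w : tmap f g (v ⊗ w) = f v ⊗ g w.
Proof. exact: (tlift_prod tmap_bilin). Qed.
Lemma tmapD x y : tmap f g (x + y) = tmap f g x + tmap f g y.
Proof. exact: (tliftD (bilin_bal tmap_bilin)). Qed.
Lemma tmapZ c x : tmap f g (c *: x) = c *: tmap f g x.
Proof. exact: (tliftZ tmap_bilin). Qed.
End TensorMap.

Section FreeBimodule.
Variables (k : fieldType) (A : algType k) (H : hopf A).
Implicit Types (M N : lmodType A).

Definition regmod : lmodType A := A^o.

(* M (x) A, which is isomorphic to A^e (x)_A M.                               *)
Definition freebim M : Type := htens H M regmod.

Definition fpure M (m : M) (x : A) : freebim M :=
  (m : restr M) ⊗ (x : restr regmod).

Definition rmul (b : A) (x : restr regmod) : restr regmod := (x : A) * b.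

Lemma rmul_linear b : linear (rmul b).
Proof.
move=> c x y.
change ((c%:A * (x : A) + (y : A)) * b = c%:A * ((x : A) * b) + (y : A) * b).
by rewrite mulrDl mulrA.
Qed.

Definition fract M (b : A) (v : freebim M) : freebim M :=
  tmap (id : restr M -> restr M) (rmul b) v.

Let id_linear (W : lmodType k) : linear (id : W -> W).
Proof. by []. Qed.

HB.instance Definition _ M := GRing.Zmodule.on (freebim M).

Lemma fract_pure M b (m : M) x : fract b (fpure m x) = fpure m (x * b).
Proof. exact: (tmap_pure (@id_linear _) (rmul_linear b)). Qed.

Lemma fractD M b (v w : freebim M) : fract b (v + w) = fract b v + fract b w.
Proof. exact: (tmapD (@id_linear _) (rmul_linear b)). Qed.

Opaque fract tlift.

Lemma freebim_ind M (Q : freebim M -> Prop) : Q 0 ->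
  (forall v w, Q v -> Q w -> Q (v + w)) -> (forall m x, Q (fpure m x)) ->
  forall v, Q v.
Proof. exact: tprod_ind. Qed.

Lemma fract0 M b : fract b (0 : freebim M) = 0.
Proof. by apply: (addrI (fract b 0)); rewrite -fractD !addr0. Qed.

Definition flact M (a : A) (v : freebim M) : freebim M :=
  (a *: (v : htens H M regmod) : htens H M regmod).

Lemma flactD M a (v w : freebim M) : flact a (v + w) = flact a v + flact a w.
Proof. exact: (scalerDr a (v : htens H M regmod)). Qed.
Lemma flactDl M a b (v : freebim M) : flact (a + b) v = flact a v + flact b v.
Proof. exact: (scalerDl (v : htens H M regmod)). Qed.
Lemma flact0 M a : flact a (0 : freebim M) = 0.
Proof. exact: (scaler0 (htens H M regmod)). Qed.
Lemma flactM M a b (v : freebim M) : flact (a * b) v = flact a (flact b v).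
Proof. by rewrite /flact -scalerA. Qed.

Lemma flact_pure M a (m : M) x : flact a (fpure m x) =
  tlift (fun a1 a2 : A => fpure (a1 *: m) (a2 * x)) (comul H a).
Proof.
rewrite [LHS]/(tens_act _ _) /tens_act /tmul; apply: eq_tlift => a1 a2.
rewrite /tmap (tlift_prod (tmul_bilin_in (mod_act_bilin M) (mod_act_bilin regmod) _ _)).
by [].
Qed.

Opaque flact.

Lemma sweedler_bal M (m : M) x : bilin (V := A) (W := A) (U := tens (restr M) (restr regmod))
  (fun a1 a2 : A => fpure (a1 *: m) (a2 * x)).
Proof.
split=> [v v' w|v w w'|c v w|c v w]; rewrite /fpure.
- rewrite -[LHS]/(((v + v') *: m : restr M) ⊗ ((w * x : A) : restr regmod)).
  by rewrite scalerDl tprodDl.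
- by rewrite mulrDl tprodDr.
- by rewrite -tprodZl; congr (_ ⊗ _); rewrite -[RHS]/(c%:A *: (v *: m)) scalerA mulr_algl.
- by rewrite -tprodZr; congr (_ ⊗ _); rewrite -[RHS]/(c%:A * (w * x)) mulrA mulr_algl.
Qed.

Lemma flact_fract M a b (v : freebim M) : flact a (fract b v) = fract b (flact a v).
Proof.
elim/freebim_ind: v => [|v w IHv IHw|m x].
- by rewrite fract0 flact0 fract0.
- by rewrite fractD !flactD fractD IHv IHw.
rewrite fract_pure !flact_pure (tlift_map _ _ (@fractD M b)).
by apply: eq_tlift => a1 a2; rewrite fract_pure mulrA.
Qed.

Lemma fscal_l M (c : k) a (v : freebim M) :
  flact (c *: a) v = c *: (flact a v : tens (restr M) (restr regmod)).
Proof.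
elim/freebim_ind: v => [|v w IHv IHw|m x].
- by rewrite !flact0 scaler0.
- by rewrite !flactD IHv IHw [RHS]scalerDr.
rewrite !flact_pure -(tliftZ (sweedler_bal _ _)); congr (tlift _ _).
exact: (linearZ_LR (mkLinear (comul_linear H : linear (comul H : A -> tens A A)))).
Qed.

Lemma fscal_alg M (c : k) (v : freebim M) :
  flact c%:A v = c *: (v : tens (restr M) (restr regmod)).
Proof.
rewrite fscal_l (_ : flact 1 v = v) //.
exact: (scale1r (v : htens H M regmod)).
Qed.

Lemma fractDr M a b (v : freebim M) : fract (a + b) v = fract a v + fract b v.
Proof.
elim/freebim_ind: v => [|v w IHv IHw|m x].
- by rewrite !fract0 addr0.
- by rewrite !fractD IHv IHw addrACA.
- by rewrite !fract_pure mulrDr; apply: tprodDr.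
Qed.

Lemma fscal_r M (c : k) b (v : freebim M) :
  fract (c *: b) v = c *: (fract b v : tens (restr M) (restr regmod)).
Proof.
elim/freebim_ind: v => [|v w IHv IHw|m x].
- by rewrite !fract0 scaler0.
- by rewrite !fractD IHv IHw [RHS]scalerDr.
rewrite !fract_pure -[RHS]tprodZr; congr (_ ⊗ _).
by rewrite -[RHS]/(c%:A * (x * b)) -scalerAl mul1r scalerAr.
Qed.

Definition fscale M (u : env A) (v : freebim M) : freebim M :=
  tlift (fun (a : A) (b : A^c) => flact a (fract (b : A) v)) u.

Lemma fscale_bilin M (v : freebim M) :
  bilin (V := A) (W := A^c) (U := tens (restr M) (restr regmod))
    (fun (a : A) (b : A^c) => flact a (fract (b : A) v)).
Proof.
split=> [a a' b|a b b'|c a b|c a b].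
- exact: flactDl.
- by rewrite fractDr flactD.
- exact: fscal_l.
- rewrite -[c *: b]/(c *: (b : A)) fscal_r -fscal_alg -flactM mulr_algr.
  exact: fscal_l.
Qed.
Let fbal M (v : freebim M) := bilin_bal (fscale_bilin v).

Lemma fscale_pure M (a : A) (b : A^c) (v : freebim M) :
  fscale (a ⊗ b) v = flact a (fract (b : A) v).
Proof. exact: (tlift_prod (fscale_bilin v)). Qed.
Lemma fscaleDl M u u' (v : freebim M) : fscale (u + u') v = fscale u v + fscale u' v.
Proof. exact: (tliftD (fbal v)). Qed.
Lemma fscale0l M (v : freebim M) : fscale 0 v = 0.
Proof. exact: (tlift0 (fbal v)). Qed.
Opaque fscale.

Lemma fscaleDr M u (v w : freebim M) : fscale u (v + w) = fscale u v + fscale u w.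
Proof.
elim/env_ind: u => [|u u' IHu IHu'|a b].
- by rewrite !fscale0l addr0.
- by rewrite !fscaleDl IHu IHu' addrACA.
- by rewrite !fscale_pure fractD flactD.
Qed.
Lemma fractM M a b (v : freebim M) : fract (a * b) v = fract b (fract a v).
Proof.
elim/freebim_ind: v => [|v w IHv IHw|m x]; first by rewrite !fract0.
  by rewrite !fractD IHv IHw.
by rewrite !fract_pure mulrA.
Qed.
Lemma fscaleA M u u' (v : freebim M) : fscale u (fscale u' v) = fscale (u * u') v.
Proof.
have s0 w : fscale w (0 : freebim M) = 0.
  by apply: (addrI (fscale w 0)); rewrite -fscaleDr !addr0.
elim/env_ind: u => [|x y IHx IHy|a b].
- by rewrite mul0r !fscale0l.
- by rewrite mulrDl !fscaleDl IHx IHy.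
elim/env_ind: u' => [|x y IHx IHy|a' b'].
- by rewrite mulr0 !fscale0l s0.
- by rewrite mulrDr !fscaleDl fscaleDr IHx IHy.
rewrite talg_mulE !fscale_pure flactM -[b * b']/((b' : A) * (b : A)) fractM.
by rewrite -(flact_fract a').
Qed.
Lemma fscale1 M : left_id 1 (@fscale M).
Proof.
move=> v; rewrite [LHS]fscale_pure.
have -> : fract (1 : A) v = v.
  elim/freebim_ind: v => [|v w IHv IHw|m x]; first by rewrite fract0.
    by rewrite fractD IHv IHw.
  by rewrite fract_pure mulr1.
exact: (scale1r (v : htens H M regmod)).
Qed.

HB.instance Definition _ M := GRing.Zmodule_isLmodule.Build (env A) (freebim M)
  (@fscaleA M) (@fscale1 M) (@fscaleDr M) (fun v u u' => @fscaleDl M u u' v).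

Lemma freebim_lact M a (v : freebim M) : lact a v = flact a v.
Proof.
rewrite [LHS]fscale_pure; congr flact.
elim/freebim_ind: v => [|v w IHv IHw|m x]; first by rewrite fract0.
  by rewrite fractD IHv IHw.
by rewrite fract_pure mulr1.
Qed.

Lemma freebim_ract M a (v : freebim M) : ract v a = fract a v.
Proof. rewrite [LHS]fscale_pure; exact: (scale1r (fract a v : htens H M regmod)). Qed.

Lemma freebim_scal M (c : k) (v : freebim M) :
  lact c%:A v = c *: (v : tens (restr M) (restr regmod)).
Proof.
by rewrite freebim_lact fscal_alg.
Qed.

End FreeBimodule.

(** * Coassociativity, and the functor V on maps *)

Section Sweedler.
Variables (k : fieldType) (A : algType k) (H : hopf A) (U : zmodType).
Variable T : A -> A -> A -> U.
Hypotheses (T1 : forall a a' b c, T (a + a') b c = T a b c + T a' b c)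
  (T2 : forall a b b' c, T a (b + b') c = T a b c + T a b' c)
  (T3 : forall a b c c', T a b (c + c') = T a b c + T a b c')
  (T12 : forall (z : k) a b c, T (z *: a) b c = T a (z *: b) c)
  (T23 : forall (z : k) a b c, T a (z *: b) c = T a b (z *: c)).

Let bal a : balanced (fun (x : A) (z : k) => z *: x) (fun (z : k) (x : A) => z *: x) (T a).
Proof. by split=> *; rewrite ?T2 ?T3 ?T23. Qed.

Let Phi (x : tens A (tens A A)) : U :=
  tlift (fun a (u : tens A A) => tlift (T a) u : U) x.

Let scal a z (u : tens A A) : tlift (T (z *: a)) u = tlift (T a) (z *: u).
Proof.
elim/tprod_ind: u => [|x y IHx IHy|v w].
- by rewrite scaler0 !(tlift0 (bal _)).
- by rewrite scalerDr !(tliftD (bal _)) IHx IHy.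
- by rewrite -tprodZl !(tlift_pure (bal _)) T12.
Qed.

Let balPhi : balanced (fun (x : A) (z : k) => z *: x)
  (fun (z : k) (u : tens A A) => z *: u) (fun a u => tlift (T a) u : U).
Proof.
split=> [a a' u|a u u'|a z u].
- by rewrite -tliftDf; apply: eq_tlift => b c.
- exact: (tliftD (bal a)).
- exact: scal.
Qed.

(** The two readings of T(a_1, a_2, a_3) in Sweedler notation: T induces a map [Phi] on A (x) (A (x)
    A), which is applied to the coassociativity law. *)
Lemma sweedler_coassoc a :
  tlift (fun a1 a2 => tlift (fun b1 b2 => T a1 b1 b2) (comul H a2)) (comul H a) =
  tlift (fun c1 c2 => tlift (fun b1 b2 => T b1 b2 c2) (comul H c1)) (comul H a).
Proof.
pose asc (u : tens A A) (z : A) : tens A (tens A A) := tlift (fun x y => x ⊗ (y ⊗ z)) u.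
have bin (z : A) : bilin (fun x y : A => x ⊗ (y ⊗ z)).
  split=> [v v' w|v w w'|c v w|c v w]; rewrite ?tprodDl ?tprodZl //.
    by rewrite tprodDr.
  by rewrite tprodZr.
have bout : bilin asc.
  split=> [u u' z|u z z'|c u z|c u z].
  - exact: (tliftD (bilin_bal (bin z))).
  - by rewrite -[RHS]tliftDf; apply: eq_tlift => x y; rewrite !tprodDr.
  - exact: (tliftZ (bin z)).
  - rewrite /asc -[RHS](tliftZ (bin z)); elim/tprod_ind: u => [|x y IHx IHy|x y].
    + by rewrite scaler0 !(tlift0 (bilin_bal (bin _))).
    + by rewrite scalerDr !(tliftD (bilin_bal (bin _))) IHx IHy.
    + by rewrite -tprodZl !(tlift_prod (bin _)) !tprodZl !tprodZr.
have PhiD x y : Phi (x + y) = Phi x + Phi y by apply: (tliftD balPhi).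
transitivity (Phi (tmap id (comul H) (comul H a))).
  rewrite /tmap (tlift_map _ _ PhiD); apply: eq_tlift => a1 a2.
  by rewrite /Phi (tlift_pure balPhi).
rewrite -(comul_coassoc H a) -/asc.
have ascD (x y : tens (tens A A) A) :
    Phi (tlift asc (x + y)) = Phi (tlift asc x) + Phi (tlift asc y).
  by rewrite (tliftD (bilin_bal bout)) PhiD.
rewrite /tmap (tlift_map (h := fun x => Phi (tlift asc x)) _ _ ascD); apply: eq_tlift => c1 c2.
rewrite (tlift_prod bout) /asc (tlift_map _ _ PhiD); apply: eq_tlift => b1 b2.
by rewrite /Phi (tlift_pure balPhi) (tlift_pure (bal _)).
Qed.
End Sweedler.

Section Functoriality.
Variables (k : fieldType) (A : algType k) (H : hopf A).
Implicit Types (M N Q : lmodType A).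

(** Linearity over k, whose scalars act on an A-module through c%:A. Contracting homotopies respect
    no more of the module structure, and [fmap] is built to accept them. *)
Definition klin M N (h : M -> N) : Prop :=
  forall (c : k) x y, h (c%:A *: x + y) = c%:A *: h x + h y.

Lemma linear_klin M N (h : M -> N) : linear h -> klin h.
Proof. by move=> hl c x y; rewrite hl. Qed.
Lemma klin_comp M N Q (h : M -> N) (g : N -> Q) : klin h -> klin g -> klin (g \o h).
Proof. by move=> hl gl c x y; rewrite /= hl gl. Qed.
Lemma klin_opp M N (h : M -> N) : klin h -> klin (fun x => - h x).
Proof. by move=> hl c x y; rewrite hl opprD scalerN. Qed.
Lemma klin_sg M N (e : bool) (h : M -> N) : klin h -> klin (fun x => sg e (h x)).
Proof. by case: e => // hl; apply: klin_opp. Qed.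
Lemma klin_zero M N : klin (fun _ : M => 0 : N).
Proof. by move=> c x y; rewrite scaler0 addr0. Qed.

Definition fmap M N (h : M -> N) (v : freebim H M) : freebim H N :=
  tmap (h : restr M -> restr N) (id : restr (regmod A) -> restr (regmod A)) v.

Lemma fmap_pure M N (h : M -> N) m x : klin h ->
  fmap h (fpure H m x) = fpure H (h m) x.
Proof. by move=> hl; apply: tmap_pure. Qed.
Lemma fmapD M N (h : M -> N) v w : klin h -> fmap h (v + w) = fmap h v + fmap h w.
Proof. by move=> hl; apply: tmapD. Qed.
Lemma fmap_scal M N (h : M -> N) (c : k) v : klin h ->
  fmap h (lact c%:A v) = lact c%:A (fmap h v).
Proof. by move=> hl; rewrite !freebim_scal; apply: tmapZ. Qed.

Opaque fmap.

Lemma fmap0 M N (h : M -> N) : klin h -> fmap h 0 = 0.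
Proof. by move=> hl; apply: (addrI (fmap h 0)); rewrite -fmapD // !addr0. Qed.

Lemma fmap_klinear M N (h : M -> N) : klin h -> klinear (fmap h).
Proof. by move=> hl c x y; rewrite fmapD // fmap_scal. Qed.

Lemma fmap_fract M N (h : M -> N) b v : klin h ->
  fmap h (fract b v) = fract b (fmap h v).
Proof.
move=> hl; elim/freebim_ind: v => [|v w IHv IHw|m x].
- by rewrite fract0 fmap0 // fract0.
- by rewrite fractD !fmapD // fractD IHv IHw.
- by rewrite fract_pure !fmap_pure // fract_pure.
Qed.

Lemma fmap_flact M N (h : M -> N) a v : linear h ->
  fmap h (flact a v) = flact a (fmap h v).
Proof.
move=> hl; have hk := linear_klin hl.
have hZ b m : h (b *: m) = b *: h m by apply: (linearZ_LR (mkLinear hl)).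
elim/freebim_ind: v => [|v w IHv IHw|m x].
- by rewrite flact0 fmap0 // flact0.
- by rewrite flactD !fmapD // flactD IHv IHw.
rewrite fmap_pure // !flact_pure (tlift_map (h := fmap h)); last first.
  by move=> *; apply: fmapD.
by apply: eq_tlift => a1 a2; rewrite fmap_pure // hZ.
Qed.

Lemma fmap_linear M N (h : M -> N) : linear h -> linear (fmap h).
Proof.
move=> hl; have hk := linear_klin hl; apply: env_linear => [v w|a v|v b].
- exact: fmapD.
- by rewrite !freebim_lact fmap_flact.
- by rewrite !freebim_ract fmap_fract.
Qed.

Definition fmapL M N (h : M -> N) (hl : linear h) := mkLinear (fmap_linear hl).

Lemma freebim_eq (U : zmodType) M (f g : freebim H M -> U) :
  (forall v w, f (v + w) = f v + f w) -> (forall v w, g (v + w) = g v + g w) ->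
  (forall m x, f (fpure H m x) = g (fpure H m x)) -> forall v, f v = g v.
Proof. exact: tens_ext. Qed.

Lemma fmap_comp M N Q (h : M -> N) (g : N -> Q) v : klin h -> klin g ->
  fmap g (fmap h v) = fmap (g \o h) v.
Proof.
move=> hl gl; have ghl := klin_comp hl gl.
apply: (@freebim_eq _ _ (fun v => fmap g (fmap h v))) => [v1 w|v1 w|m x].
- by rewrite !fmapD.
- by rewrite fmapD.
- by rewrite !fmap_pure.
Qed.

Lemma fpureDl M (m m' : M) x : fpure H (m + m') x = fpure H m x + fpure H m' x.
Proof. exact: tprodDl. Qed.
Lemma fpureDr M (m : M) x x' : fpure H m (x + x') = fpure H m x + fpure H m x'.
Proof. exact: tprodDr. Qed.
Lemma fpureN M (m : M) x : fpure H (- m) x = - fpure H m x.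
Proof.
apply: (addIr (fpure H m x)); rewrite -fpureDl !addNr.
by apply: (addIr (fpure H 0 x)); rewrite -fpureDl !add0r.
Qed.
Lemma fpure0 M x : fpure H (0 : M) x = 0.
Proof. by apply: (addIr (fpure H 0 x)); rewrite -fpureDl !add0r. Qed.
Lemma fpureZ M (c : k) (m : M) x : fpure H (c%:A *: m) x = fpure H m (c *: x).
Proof.
rewrite -[c *: x]mulr_algl.
exact: (etrans (@tprodZl _ (restr M) (restr (regmod A)) c m x)
  (esym (@tprodZr _ (restr M) (restr (regmod A)) c m x))).
Qed.

Lemma fmap_addf M N (h g : M -> N) v : klin h -> klin g ->
  fmap (fun x => h x + g x) v = fmap h v + fmap g v.
Proof.
move=> hl gl; have ghl : klin (fun x => h x + g x).
  by move=> c x y; rewrite hl gl scalerDr addrACA.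
apply: (@freebim_eq _ _ _ (fun v => fmap h v + fmap g v)) => [v1 w|v1 w|m x].
- by rewrite fmapD.
- by rewrite !fmapD // addrACA.
- by rewrite !fmap_pure // fpureDl.
Qed.

Lemma fmap_oppf M N (h : M -> N) v : klin h -> fmap (fun x => - h x) v = - fmap h v.
Proof.
move=> hl; have nhl := klin_opp hl.
apply: (@freebim_eq _ _ _ (fun v => - fmap h v)) => [v1 w|v1 w|m x].
- by rewrite fmapD.
- by rewrite !fmapD // opprD.
- by rewrite !fmap_pure // fpureN.
Qed.

Lemma fmap_id M (v : freebim H M) : fmap id v = v.
Proof.
have il : klin (id : M -> M) by [].
apply: (@freebim_eq _ _ (fmap id) id) => [v1 w|//|m x]; first exact: fmapD.
exact: fmap_pure.
Qed.

Lemma fmap_zero M N (v : freebim H M) : fmap (fun _ => 0 : N) v = 0.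
Proof.
have zl := @klin_zero M N.
apply: (@freebim_eq _ _ (fmap (fun _ => 0)) (fun=> 0)) => [v1 w|v1 w|m x].
- exact: fmapD.
- by rewrite addr0.
- by rewrite fmap_pure // fpure0.
Qed.

(* k (x) A = A.                                                               *)
Definition kap (v : freebim H (triv H)) : bimod A :=
  tlift (fun (c : restr (triv H)) (x : restr (regmod A)) => (c : k) *: (x : A) : bimod A) v.

Lemma trivZ (c : k) (x : triv H) : c%:A *: x = c * (x : k) :> k.
Proof.
rewrite -[LHS]/(counit H c%:A * (x : k)).
have := counit_linear H c 1 0; rewrite addr0 => ->.
have e0 : counit H 0 = 0.
  have := counit_linear H 1 0 0; rewrite scaler0 addr0 /= mul1r => e.
  by apply: (addrI (counit H 0)); rewrite -e addr0.
by rewrite e0 addr0 (counit_multiplicative H).1 /= mulr1.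
Qed.

Lemma kap_bal : balanced (fun (v : restr (triv H)) (c : k) => c *: v)
  (fun (c : k) (w : restr (regmod A)) => c *: w)
  (fun (c : restr (triv H)) (x : restr (regmod A)) => (c : k) *: (x : A) : bimod A).
Proof.
split=> [c c' x|c x x'|c z x].
- exact: (scalerDl (x : A)).
- exact: (scalerDr (c : k) (x : A)).
- rewrite -[z *: c]/(z%:A *: (c : triv H)) trivZ -[z *: x]/(z%:A * (x : A)).
  by rewrite mulr_algl scalerA mulrC.
Qed.

Lemma kap_pure (c : triv H) x : kap (fpure H c x) = (c : k) *: x.
Proof. exact: (tlift_pure kap_bal). Qed.
Lemma kapD v w : kap (v + w) = kap v + kap w.
Proof. exact: (tliftD kap_bal). Qed.

Opaque kap.

End Functoriality.

Section Klin.
Variables (k : fieldType) (A : algType k) (M N : lmodType A) (h : M -> N).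
Hypothesis hl : klin h.

Lemma klinD x y : h (x + y) = h x + h y.
Proof. by have := hl 1 x y; rewrite !scale1r. Qed.
Lemma klin0 : h 0 = 0.
Proof. by apply: (addrI (h 0)); rewrite -klinD !addr0. Qed.
Lemma klinZ (c : k) x : h (c%:A *: x) = c%:A *: h x.
Proof. by rewrite -[_ *: x]addr0 hl klin0 addr0. Qed.
Lemma klinN x : h (- x) = - h x.
Proof. by apply: (addrI (h x)); rewrite -klinD !subrr klin0. Qed.
Lemma klinB x y : h (x - y) = h x - h y.
Proof. by rewrite klinD klinN. Qed.
End Klin.

Section Augmentation.
Variables (k : fieldType) (A : algType k) (H : hopf A).
Implicit Types (M N Q : lmodType A).

Lemma kap0 : kap (0 : freebim H (triv H)) = 0.
Proof. by apply: (addrI (kap (0 : freebim H (triv H)))); rewrite -kapD !addr0. Qed.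

Lemma kap_linear : linear (@kap k A H).
Proof.
apply: env_linear => [v w|a v|v b]; first exact: kapD.
  rewrite freebim_lact bimod_lactE.
  elim/freebim_ind: v => [|v w IHv IHw|c x].
  - by rewrite flact0 kap0 [LHS]/(0 : A) mulr0.
  - by rewrite flactD !kapD IHv IHw [RHS]mulrDr.
  rewrite flact_pure (tlift_map _ _ (@kapD k A H)) kap_pure -[in RHS](counitl H a).
  rewrite (tlift_map (h := fun y : A => y * ((c : k) *: x))); last first.
    by move=> y y'; rewrite mulrDl.
  apply: eq_tlift => a1 a2; rewrite kap_pure -scalerAl -!scalerAr scalerA.
  by [].
rewrite freebim_ract bimod_ractE.
elim/freebim_ind: v => [|v w IHv IHw|c x].
- by rewrite fract0 kap0 [LHS]/(0 : A) mul0r.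
- by rewrite fractD !kapD IHv IHw [RHS]mulrDl.
- by rewrite fract_pure !kap_pure -scalerAl.
Qed.

Definition kapL := mkLinear kap_linear.

Definition kinv (a : bimod A) : freebim H (triv H) := fpure H ((1 : k) : triv H) a.

Lemma kap_kinv a : kap (kinv a) = a.
Proof. by rewrite kap_pure scale1r. Qed.

Lemma kinv_kap v : kinv (kap v) = v.
Proof.
apply: (@freebim_eq _ _ _ _ _ (fun v => kinv (kap v)) id) => [v1 w|//|c x].
  by rewrite kapD [LHS]fpureDr.
rewrite kap_pure /kinv -fpureZ; congr (fpure H _ x).
by rewrite trivZ mulr1.
Qed.

Lemma bimod_scal (c : k) (a : bimod A) : lact c%:A a = c *: (a : A).
Proof. by rewrite bimod_lactE mulr_algl. Qed.

Lemma lact_alg_fpure M (c : k) (m : M) x :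
  lact c%:A (fpure H m x) = fpure H (c%:A *: m) x.
Proof.
by rewrite freebim_scal -[LHS](@tprodZl _ (restr M) (restr (regmod A)) c m x).
Qed.

Lemma kinv_klinear : klinear kinv.
Proof.
move=> c x y; rewrite [LHS]fpureDr; congr (_ + _).
by rewrite bimod_scal lact_alg_fpure fpureZ.
Qed.

(** Tensoring with A over k preserves k-linear contractions; [kinv] replaces A by k (x) A. *)
Lemma contraction_freebim M (d t : M -> M) (mu : M -> triv H) (eta : triv H -> M)
    (dl : linear d) (mul : linear mu) : klin t -> klin eta ->
  (forall c, mu (eta c) = c) -> (forall x, mu (t x) = 0) ->
  (forall c, d (eta c) = 0) -> (forall x, d (t x) + t (d x) = x - eta (mu x)) ->
  contraction (fmapL H dl) (kapL \o fmapL H mul) (fmap eta \o kinv) (fmap t).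
Proof.
move=> tl el me mt de dt; have dk := linear_klin dl; have mk := linear_klin mul.
have cl := klin_comp.
split=> [||a|x|a|x].
- exact: klinear_comp kinv_klinear (fmap_klinear el).
- exact: fmap_klinear.
- by rewrite /= fmap_comp // (funext me : mu \o eta = id) fmap_id kap_kinv.
- by rewrite /= fmap_comp // (funext mt : mu \o t = fun=> 0) fmap_zero kap0.
- by rewrite /= fmap_comp // (funext de : d \o eta = fun=> 0) fmap_zero.
- rewrite /= kinv_kap !fmap_comp // -fmap_addf; try exact: cl.
  rewrite (funext dt : (fun x => (d \o t) x + (t \o d) x) = _).
  rewrite -fmap_oppf; last exact: cl.
  transitivity (fmap id x + fmap (fun y => - (eta \o mu) y) x).
    rewrite -fmap_addf // => c y z; by rewrite /= mk el opprD scalerN.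
  by rewrite fmap_id.
Qed.
End Augmentation.

(** * The product V(M) x V(N) -> V(Q) of an equivariant pairing *)

Section Pairing.
Variables (k : fieldType) (A : algType k) (H : hopf A) (M N Q : lmodType A).
Variable beta : M -> N -> Q.
Hypotheses (betaDl : forall m m' n, beta (m + m') n = beta m n + beta m' n)
  (betaZl : forall (c : k) m n, beta (c%:A *: m) n = c%:A *: beta m n)
  (beta_lin : forall m, klin (beta m))
  (beta_act : forall a m n,
    tlift (fun a1 a2 => beta (a1 *: m) (a2 *: n)) (comul H a) = a *: beta m n).

(** On pure tensors (m (x) x, n (x) y) goes to beta(m, x_1 n) (x) x_2 y. For beta the tensor product
    this is the monoidal structure map V(M) (x)_A V(N) -> V(M (x) N). *)
Definition pairing (v : freebim H M) (w : freebim H N) : freebim H Q :=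
  tlift (fun (m : restr M) (x : restr (regmod A)) => fmap (beta m) (lact (x : A) w)) v.

Lemma pairing_bal (w : freebim H N) : balanced (fun (v : restr M) (c : k) => c *: v)
  (fun (c : k) (w : restr (regmod A)) => c *: w)
  (fun (m : restr M) (x : restr (regmod A)) => fmap (beta m) (lact (x : A) w)).
Proof.
split=> [m m' x|m x x'|m c x].
- by rewrite -fmap_addf //; congr fmap; apply/funext => n; apply: betaDl.
- by rewrite -fmapD // -lactDl.
- rewrite -[c *: x]/(c%:A * (x : A)) lactM fmap_scal //.
  rewrite -[c *: m]/(c%:A *: (m : M)) (funext (betaZl c m)).
  have cl : klin (fun n => c%:A *: beta m n).
    by move=> z y y'; rewrite beta_lin scalerDr !scalerA mulr_algl mulr_algr.
  apply: (@freebim_eq _ _ _ _ _ _ (fun v => lact c%:A (fmap (beta m) v))).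
  + by move=> v w'; rewrite fmapD.
  + by move=> v w'; rewrite fmapD // lactDr.
  + by move=> n y; rewrite !fmap_pure // lact_alg_fpure.
Qed.

Lemma pairing_pure (m : M) (x : A) (w : freebim H N) : pairing (fpure H m x) w = fmap (beta m) (lact x w).
Proof. exact: (tlift_pure (pairing_bal w)). Qed.
Lemma pairingDl v v' w : pairing (v + v') w = pairing v w + pairing v' w.
Proof. exact: (tliftD (pairing_bal w)). Qed.
Lemma pairingDr v w w' : pairing v (w + w') = pairing v w + pairing v w'.
Proof.
by rewrite -[RHS]tliftDf; apply: eq_tlift => m x; rewrite lactDr fmapD.
Qed.

Opaque pairing.

Lemma pairing_ract a v w : pairing v (ract w a) = ract (pairing v w) a.
Proof.
apply: (@freebim_eq _ _ _ _ _ (fun v => pairing v _) (fun v => ract (pairing v w) a)).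
- by move=> *; apply: pairingDl.
- by move=> *; rewrite pairingDl ractD.
move=> m x; rewrite !pairing_pure lact_ract.
by rewrite !freebim_ract fmap_fract.
Qed.

Lemma pairing_mid a v w : pairing (ract v a) w = pairing v (lact a w).
Proof.
apply: (@freebim_eq _ _ _ _ _ (fun v => pairing (ract v a) w) (fun v => pairing v _)).
- by move=> *; rewrite ractD pairingDl.
- by move=> *; rewrite pairingDl.
by move=> m x; rewrite freebim_ract fract_pure !pairing_pure lactM.
Qed.

(** The left action splits a between m and w, and the part reaching w = n (x) y splits again.
    Coassociativity regroups the first two of the three parts, and [beta_act] collects them as an
    action on beta(m, n). *)
Lemma pairing_lact a v w : pairing (lact a v) w = lact a (pairing v w).
Proof.
apply: (@freebim_eq _ _ _ _ _ (fun v => pairing (lact a v) w) (fun v => lact a (pairing v w))).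
- by move=> *; rewrite lactDr pairingDl.
- by move=> *; rewrite pairingDl lactDr.
move=> m x; rewrite freebim_lact flact_pure.
rewrite (tlift_map (h := pairing^~ w)); last by move=> *; apply: pairingDl.
rewrite pairing_pure.
transitivity (tlift (fun a1 a2 => fmap (beta (a1 *: m)) (lact a2 (lact x w))) (comul H a)).
  by apply: eq_tlift => a1 a2; rewrite pairing_pure lactM.
move: (lact x w) => {x w} w.
apply: (@freebim_eq _ _ _ _ _
  (fun w => tlift (fun a1 a2 => fmap (beta (a1 *: m)) (lact a2 w)) (comul H a))
  (fun w => lact a (fmap (beta m) w))).
- by move=> v1 w'; rewrite -tliftDf; apply: eq_tlift => a1 a2; rewrite lactDr fmapD.
- by move=> v1 w'; rewrite fmapD // lactDr.
move=> n y; rewrite fmap_pure // freebim_lact flact_pure.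
pose T a1 a2 a3 := fpure H (beta (a1 *: m) (a2 *: n)) (a3 * y).
transitivity (tlift (fun a1 a2 => tlift (fun b1 b2 => T a1 b1 b2) (comul H a2)) (comul H a)).
  apply: eq_tlift => a1 a2; rewrite freebim_lact flact_pure.
  rewrite (tlift_map (h := fmap (beta (a1 *: m)))); last by move=> *; apply: fmapD.
  by apply: eq_tlift => b1 b2; rewrite fmap_pure.
have sZ (c : k) (b : A) (X : lmodType A) (z : X) : (c *: b) *: z = c%:A *: (b *: z).
  by rewrite scalerA mulr_algl.
rewrite sweedler_coassoc /T.
- apply: eq_tlift => c1 c2; rewrite -beta_act (tlift_map (h := fun q => fpure H q (c2 * y))) //.
  by move=> *; apply: fpureDl.
- by move=> *; rewrite scalerDl betaDl fpureDl.
- move=> a1 b b' c; rewrite scalerDl.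
  have := beta_lin (a1 *: m) 1 (b *: n) (b' *: n); rewrite !scale1r => ->.
  by rewrite fpureDl.
- by move=> *; rewrite mulrDl fpureDr.
- by move=> z a1 b c; rewrite (sZ z a1) (sZ z b) betaZl klinZ.
- by move=> z a1 b c; rewrite (sZ z b) klinZ // fpureZ -scalerAl.
Qed.
End Pairing.

(** * Passage between A^e (x)_A M and M (x) A *)

Section Induced.
Variables (k : fieldType) (A : algType k) (H : hopf A).
Implicit Types (M N : lmodType A).

Lemma antipode1 : antipode H 1 = 1.
Proof.
have := antipodel H 1; rewrite (comul_multiplicative H).1.
have ab : bilin (V := A) (W := A) (U := A) (fun x y : A => antipode H x * y).
  have sl := antipode_linear H.
  have SD x y : antipode H (x + y) = antipode H x + antipode H y.
    exact: (linearD (mkLinear sl)).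
  have SZ c x : antipode H (c *: x) = c *: antipode H x.
    exact: (linearZ_LR (mkLinear sl)).
  by split=> *; rewrite ?SD ?SZ ?mulrDl ?mulrDr // -?scalerAl -?scalerAr.
by rewrite (tlift_prod ab) mulr1 (counit_multiplicative H).1 /= scale1r.
Qed.

Lemma antipodeD x y : antipode H (x + y) = antipode H x + antipode H y.
Proof. exact: (linearD (mkLinear (antipode_linear H))). Qed.
Lemma antipodeZ (c : k) x : antipode H (c *: x) = c *: antipode H x.
Proof. exact: (linearZ_LR (mkLinear (antipode_linear H))). Qed.

Lemma deltaE a : delta H a =
  tlift (fun a1 a2 : A => (a1 ⊗ (antipode H a2 : A^c)) : env A) (comul H a).
Proof. by []. Qed.

(** delta(a) sends m (x) 1 to a_1 m (x) a_2 S(a_3), and a_2 S(a_3) collapses to the counit. This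
    makes u (x) m |-> u (m (x) 1) balanced. *)
Lemma fpure_delta M a (m : M) : delta H a *: fpure H m 1 = fpure H (a *: m) 1.
Proof.
rewrite deltaE (tlift_map (h := fun u : env A => u *: fpure H m 1)); last first.
  by move=> u v; apply: scalerDl.
pose T (a b c : A) := fpure H (a *: m) (b * antipode H c).
transitivity (tlift (fun c1 c2 => tlift (fun b1 b2 => T b1 b2 c2) (comul H c1)) (comul H a)).
  apply: eq_tlift => a1 a2; rewrite env_scaleE freebim_ract fract_pure mul1r.
  by rewrite freebim_lact flact_pure.
rewrite -sweedler_coassoc /T.
- transitivity (tlift (fun a1 a2 : A => fpure H ((counit H a2 *: a1) *: m) 1) (comul H a)).
    apply: eq_tlift => a1 a2.
    have -> : (counit H a2 *: a1) *: m = (counit H a2)%:A *: (a1 *: m).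
      by rewrite scalerA mulr_algl.
    rewrite fpureZ -(antipoder H a2) (tlift_map (h := fpure H (a1 *: m))) //.
    by move=> *; apply: fpureDr.
  rewrite -[in RHS](counitr H a) (tlift_map (h := fun b : A => fpure H (b *: m) 1)) //.
  by move=> *; rewrite scalerDl fpureDl.
- by move=> *; rewrite scalerDl fpureDl.
- by move=> *; rewrite mulrDl fpureDr.
- by move=> *; rewrite antipodeD mulrDr fpureDr.
- move=> z b c d; rewrite -scalerAl -fpureZ; congr (fpure H _ _).
  by rewrite scalerA mulr_algl.
- by move=> z b c d; rewrite antipodeZ -scalerAl -scalerAr.
Qed.

Definition ind_to_free M (t : ind H M) : freebim H M :=
  tlift (fun (u : env A) (m : M) => u *: fpure H m 1) t.

Lemma ind_to_free_bal M : balanced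
  (fun (u : env A) (a : A) => u * delta H a) (fun (a : A) (m : M) => a *: m)
  (fun (u : env A) (m : M) => u *: fpure H m 1).
Proof.
split=> [u u' m|u m m'|u a m].
- exact: scalerDl.
- by rewrite fpureDl scalerDr.
- by rewrite -scalerA fpure_delta.
Qed.

Lemma ind_to_free_pure M (u : env A) (m : M) :
  ind_to_free (tpure u m : ind H M) = u *: fpure H m 1.
Proof. exact: (tlift_pure (ind_to_free_bal M)). Qed.
Lemma ind_to_freeD M (t t' : ind H M) :
  ind_to_free (t + t') = ind_to_free t + ind_to_free t'.
Proof. exact: (tliftD (ind_to_free_bal M)). Qed.

Opaque ind_to_free.

Lemma ind_ind M (Q : ind H M -> Prop) : Q 0 ->
  (forall t t', Q t -> Q t' -> Q (t + t')) ->
  (forall (u : env A) (m : M), Q (tpure u m)) -> forall t, Q t.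
Proof. exact: tens_ind. Qed.

Lemma ind_to_free_linear M : linear (@ind_to_free M).
Proof.
have z : ind_to_free (0 : ind H M) = 0.
  by apply: (addrI (ind_to_free (0 : ind H M))); rewrite -ind_to_freeD !addr0.
move=> u t t'; rewrite ind_to_freeD; congr (_ + _).
elim/ind_ind: t => [|t1 t2 IH1 IH2|v m].
- by rewrite scaler0 z scaler0.
- by rewrite scalerDr !ind_to_freeD IH1 IH2 scalerDr.
- by rewrite -[u *: _]/(ind_scale u _) ind_scale_pure !ind_to_free_pure scalerA.
Qed.

Lemma ind_map_bal M N (h : M -> N) : linear h -> balanced
  (fun (u : env A) (a : A) => u * delta H a) (fun (a : A) (m : M) => a *: m)
  (fun u m => tpure u (h m) : ind H N).
Proof.
move=> hl; have hD x y : h (x + y) = h x + h y := linearD (mkLinear hl) x y.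
have hZ a x : h (a *: x) = a *: h x := linearZ_LR (mkLinear hl) a x.
split=> [u u' m|u m m'|u a m].
- exact: tpureDl.
- by rewrite hD; apply: tpureDr.
- by rewrite hZ; apply: tpure_bal.
Qed.

Lemma ind_map_pure M N (h : M -> N) (u : env A) (m : M) : linear h ->
  ind_map h (tpure u m : ind H M) = tpure u (h m).
Proof. by move=> hl; apply: (tlift_pure (ind_map_bal hl)). Qed.
Lemma ind_mapD M N (h : M -> N) (t t' : ind H M) : linear h ->
  ind_map h (t + t') = ind_map h t + ind_map h t'.
Proof. by move=> hl; apply: (tliftD (ind_map_bal hl)). Qed.

Lemma ind_eq (U : zmodType) M (f g : ind H M -> U) :
  (forall v w, f (v + w) = f v + f w) -> (forall v w, g (v + w) = g v + g w) ->
  (forall u m, f (tpure u m) = g (tpure u m)) -> forall v, f v = g v.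
Proof. exact: tens_ext. Qed.

Lemma ind_to_free_map M N (h : M -> N) (t : ind H M) : linear h ->
  ind_to_free (ind_map h t) = fmap h (ind_to_free t).
Proof.
move=> hl; have hk := linear_klin hl.
apply: (@ind_eq _ _ (fun t => ind_to_free (ind_map h t)) (fun t => fmap h (ind_to_free t))).
- by move=> *; rewrite ind_mapD // ind_to_freeD.
- by move=> *; rewrite ind_to_freeD fmapD.
move=> u m; rewrite ind_map_pure // !ind_to_free_pure.
by rewrite [RHS](linearZ_LR (fmapL H hl)) /= fmap_pure.
Qed.

Definition free_to_ind M (v : freebim H M) : ind H M :=
  tlift (fun (m : restr M) (x : restr (regmod A)) =>
    tpure (((1 : A) ⊗ ((x : A) : A^c)) : env A) (m : M) : ind H M) v.

Lemma delta_alg (c : k) : delta H c%:A = ((c%:A : A) ⊗ (1 : A^c)) :> env A.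
Proof.
rewrite deltaE.
have -> : comul H c%:A = c *: ((1 : A) ⊗ (1 : A)) :> tens A A.
  have e1 : comul H 1 = (1 : A) ⊗ (1 : A) :> tens A A := (comul_multiplicative H).1.
  rewrite -e1.
  exact: (linearZ_LR (mkLinear (comul_linear H : linear (comul H : A -> tens A A)))).
have b : bilin (V := A) (W := A) (U := tens A A^c)
   (fun a1 a2 : A => a1 ⊗ (antipode H a2 : A^c)).
  by split=> *; rewrite ?antipodeD ?antipodeZ ?tprodDl ?tprodDr ?tprodZl ?tprodZr.
by rewrite -tprodZl [LHS](tlift_prod b) antipode1.
Qed.

Lemma free_to_ind_bal M : balanced (fun (v : restr M) (c : k) => c *: v)
  (fun (c : k) (w : restr (regmod A)) => c *: w)
  (fun (m : restr M) (x : restr (regmod A)) =>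
    tpure (((1 : A) ⊗ ((x : A) : A^c)) : env A) (m : M) : ind H M).
Proof.
split=> [m m' x|m x x'|m c x].
- exact: tpureDr.
- by rewrite -tpureDl; congr tpure; apply: tprodDr.
- rewrite -[c *: m]/(c%:A *: (m : M)) -tpure_bal delta_alg; congr tpure.
  rewrite [LHS]talg_mulE mul1r mulr1 -[c *: x]/(c%:A * (x : A)) tprodZl mulr_algl.
  by rewrite -tprodZr.
Qed.

Lemma free_to_ind_pure M (m : M) (x : A) :
  free_to_ind (fpure H m x) = tpure (((1 : A) ⊗ (x : A^c)) : env A) m.
Proof. exact: (tlift_pure (free_to_ind_bal M)). Qed.
Lemma free_to_indD M (v w : freebim H M) :
  free_to_ind (v + w) = free_to_ind v + free_to_ind w.
Proof. exact: (tliftD (free_to_ind_bal M)). Qed.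

Opaque free_to_ind.
Lemma ind_lact_pure M a (u : env A) (m : M) :
  lact a (tpure u m : ind H M) = tpure (((a ⊗ (1 : A^c)) : env A) * u) m.
Proof. exact: ind_scale_pure. Qed.
Lemma ind_ract_pure M a (u : env A) (m : M) :
  ract (tpure u m : ind H M) a = tpure ((((1 : A) ⊗ (a : A^c)) : env A) * u) m.
Proof. exact: ind_scale_pure. Qed.

(** For the left action, a_1 m (x) a_2 x goes to (1 (x) a_2 x) delta(a_1) (x) m, which is (a_1 (x)
    S(a_2) a_3 x) (x) m, and S(a_2) a_3 collapses to the counit. *)
Lemma free_to_ind_linear M : linear (@free_to_ind M).
Proof.
apply: env_linear => [v w|a v|v b]; first exact: free_to_indD.
  apply: (@freebim_eq _ _ _ _ _ (fun v => free_to_ind (lact a v))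
    (fun v => lact a (free_to_ind v))).
  - by move=> *; rewrite lactDr free_to_indD.
  - by move=> *; rewrite free_to_indD lactDr.
  move=> m x; rewrite free_to_ind_pure ind_lact_pure freebim_lact flact_pure.
  rewrite (tlift_map _ _ (@free_to_indD M)).
  pose T (b1 b2 c : A) : ind H M :=
    tpure ((b1 ⊗ ((antipode H b2 * (c * x) : A) : A^c)) : env A) m.
  transitivity (tlift (fun c1 c2 => tlift (fun b1 b2 => T b1 b2 c2) (comul H c1)) (comul H a)).
    apply: eq_tlift => a1 a2; rewrite free_to_ind_pure -tpure_bal deltaE.
    set u : env A := _ ⊗ _.
    rewrite (tlift_map (h := fun v : env A => tpure (u * v) m)); last first.
      by move=> v1 w; rewrite mulrDr tpureDl.
    apply: eq_tlift => b1 b2; rewrite /T /u; congr tpure.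
    by rewrite [LHS]talg_mulE mul1r.
  rewrite -sweedler_coassoc /T.
  - have e (a1 a2 : A) : tlift (fun b1 b2 : A => tpure
        ((a1 ⊗ ((antipode H b1 * (b2 * x) : A) : A^c)) : env A) m : ind H M) (comul H a2) =
      tpure (((counit H a2 *: a1) ⊗ (x : A^c)) : env A) m.
      have -> : (counit H a2 *: a1) ⊗ (x : A^c) =
          a1 ⊗ ((tlift (fun b1 b2 : A => antipode H b1 * b2) (comul H a2) * x : A) : A^c).
        by rewrite antipodel mulr_algl tprodZl -tprodZr.
      rewrite (tlift_map (h := fun b : A =>
        tpure ((a1 ⊗ ((b * x : A) : A^c)) : env A) m : ind H M)); last first.
        by move=> b b'; rewrite mulrDl -tpureDl; congr tpure; apply: tprodDr.
      by apply: eq_tlift => b1 b2; rewrite mulrA.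
    transitivity (tlift (fun a1 a2 : A =>
      tpure (((counit H a2 *: a1) ⊗ (x : A^c)) : env A) m : ind H M) (comul H a)).
      by apply: eq_tlift => a1 a2; apply: e.
    rewrite [X in tpure X m]talg_mulE mulr1 mul1r -[in RHS](counitr H a).
    rewrite (tlift_map (h := fun b : A => tpure ((b ⊗ (x : A^c)) : env A) m : ind H M)) //.
    by move=> b b'; rewrite -tpureDl; congr tpure; apply: tprodDl.
  - by move=> *; rewrite -tpureDl; congr tpure; apply: tprodDl.
  - by move=> *; rewrite antipodeD mulrDl -tpureDl; congr tpure; apply: tprodDr.
  - by move=> *; rewrite mulrDl mulrDr -tpureDl; congr tpure; apply: tprodDr.
  - by move=> z b c d; rewrite antipodeZ -scalerAl tprodZl -tprodZr.
  - by move=> z b c d; rewrite antipodeZ -!scalerAl -scalerAr.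
apply: (@freebim_eq _ _ _ _ _ (fun v => free_to_ind (ract v b))
  (fun v => ract (free_to_ind v) b)).
- by move=> *; rewrite ractD free_to_indD.
- by move=> *; rewrite free_to_indD ractD.
move=> m x; rewrite freebim_ract fract_pure !free_to_ind_pure ind_ract_pure.
by rewrite talg_mulE mul1r.
Qed.

Lemma free_to_ind_map M N (h : M -> N) (v : freebim H M) : linear h ->
  ind_map h (free_to_ind v) = free_to_ind (fmap h v).
Proof.
move=> hl; have hk := linear_klin hl.
apply: (@freebim_eq _ _ _ _ _ (fun v => ind_map h (free_to_ind v))
  (fun v => free_to_ind (fmap h v))).
- by move=> *; rewrite free_to_indD ind_mapD.
- by move=> *; rewrite fmapD // free_to_indD.
by move=> m x; rewrite fmap_pure // !free_to_ind_pure ind_map_pure.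
Qed.

Lemma ind_triv_bal : balanced
  (fun (u : env A) (a : A) => u * delta H a) (fun (a : A) (m : triv H) => a *: m)
  (fun (u : env A) (c : triv H) => u *: ((c : k)%:A : bimod A)).
Proof.
split=> [u u' c|u c c'|u a c].
- exact: scalerDl.
- by rewrite -scalerDr -[_ + _ in RHS]/((c : k)%:A + (c' : k)%:A : A) -scalerDl.
rewrite -scalerA; congr (_ *: _).
rewrite deltaE (tlift_map (h := fun u : env A => u *: ((c : k)%:A : bimod A))); last first.
  by move=> v w; apply: scalerDl.
transitivity (tlift (fun a1 a2 : A => ((c : k) *: (a1 * antipode H a2)) : A) (comul H a)).
  apply: eq_tlift => a1 a2; rewrite [LHS]bimod_scale_pure.
  by rewrite -scalerAr mulr1 -scalerAl.
rewrite -(tlift_map (h := fun b : A => (c : k) *: b)); last by move=> *; apply: scalerDr.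
by rewrite antipoder scalerA mulrC.
Qed.

Lemma ind_triv_pure (u : env A) (c : triv H) :
  ind_triv (tpure u c : ind H (triv H)) = u *: ((c : k)%:A : bimod A).
Proof. exact: (tlift_pure ind_triv_bal). Qed.
Lemma ind_trivD (t t' : ind H (triv H)) : ind_triv (t + t') = ind_triv t + ind_triv t'.
Proof. exact: (tliftD ind_triv_bal). Qed.

Lemma kap_ind_to_free (t : ind H (triv H)) : kap (ind_to_free t) = ind_triv t.
Proof.
apply: (@ind_eq _ _ (fun t => kap (ind_to_free t)) (@ind_triv k A H)).
- by move=> *; rewrite ind_to_freeD kapD.
- exact: ind_trivD.
move=> u c; rewrite ind_triv_pure ind_to_free_pure [LHS](linearZ_LR (kapL H)) /=.
by rewrite kap_pure.
Qed.

Lemma ind_triv_free_to_ind (v : freebim H (triv H)) : ind_triv (free_to_ind v) = kap v.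
Proof.
apply: (@freebim_eq _ _ _ _ _ (fun v => ind_triv (free_to_ind v)) (@kap k A H)).
- by move=> *; rewrite free_to_indD ind_trivD.
- exact: kapD.
move=> c x; rewrite free_to_ind_pure ind_triv_pure kap_pure [LHS]bimod_scale_pure.
by rewrite mul1r -scalerAl mul1r.
Qed.

Lemma hoch_cochain_comp (U V : lmodType (env A)) n (h : {linear U -> V}) (phi : seq A -> U) :
  hoch_cochain n phi -> hoch_cochain n (h \o phi).
Proof. by move=> hp s t c a b st; rewrite /= hp // linearD linear_lact. Qed.

(** Both translations are bimodule maps, natural in M and compatible with the identifications with A
    at M = k, so the data of a comparison map can be carried over in either direction. *)
Lemma hoch_representsP n F (E : extension n (triv H) (triv H)) :
  hoch_represents F E <-> exists phi : forall i, seq A -> freebim H (E i),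
    [/\ forall i, hoch_cochain i (phi i),
        kap (fmap (raug E) (phi 0%N [::])) = 1 :> A,
        forall i s, size s = i.+1 ->
          fmap (rd E i) (phi i.+1 s) = hoch_d (phi i) s
      & forall s, size s = n -> F s = kap (fmap (ext_end E) (phi n s))].
Proof.
split=> -[phi [h1 h2 h3 h4]].
  exists (fun i => mkLinear (@ind_to_free_linear (E i)) \o phi i); split.
  - by move=> i; apply: hoch_cochain_comp.
  - by rewrite /= -ind_to_free_map ?kap_ind_to_free //; apply: linearP.
  - move=> i s es; rewrite -linear_hoch_d -h3 //= ind_to_free_map //; exact: linearP.
  - by move=> s es; rewrite h4 //= -ind_to_free_map ?kap_ind_to_free //; apply: linearP.
exists (fun i => mkLinear (@free_to_ind_linear (E i)) \o phi i); split.
- by move=> i; apply: hoch_cochain_comp.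
- by rewrite /= free_to_ind_map ?ind_triv_free_to_ind //; apply: linearP.
- move=> i s es; rewrite -linear_hoch_d -h3 //= free_to_ind_map //; exact: linearP.
- by move=> s es; rewrite h4 //= free_to_ind_map ?ind_triv_free_to_ind //; apply: linearP.
Qed.
End Induced.

Lemma linZ (R : pzRingType) (M N : lmodType R) (h : M -> N) : linear h ->
  forall a x, h (a *: x) = a *: h x.
Proof. by move=> hl; apply: (linearZ_LR (mkLinear hl)). Qed.

(** * Maps between tensor products of A-modules *)

Section HtensMaps.
Variables (k : fieldType) (A : algType k) (H : hopf A).
Implicit Types (M N Q : lmodType A).

Definition hpure M N (m : M) (n : N) : htens H M N := (m : restr M) ⊗ (n : restr N).

Definition hmap M N M' N' (f : M -> M') (g : N -> N') (x : htens H M N) : htens H M' N' :=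
  tmap (f : restr M -> restr M') (g : restr N -> restr N') x.

Lemma hpureDl M N (m m' : M) (n : N) : hpure (m + m') n = hpure m n + hpure m' n.
Proof. exact: tprodDl. Qed.
Lemma hpureDr M N (m : M) (n n' : N) : hpure m (n + n') = hpure m n + hpure m n'.
Proof. exact: tprodDr. Qed.
Lemma hpureZ M N (c : k) (m : M) (n : N) : hpure (c%:A *: m) n = hpure m (c%:A *: n).
Proof. exact: (@tpure_bal k (restr M) (restr N) (fun v c => c *: v) (fun c w => c *: w)). Qed.

Lemma htens_eq (U : zmodType) M N (f g : htens H M N -> U) :
  (forall v w, f (v + w) = f v + f w) -> (forall v w, g (v + w) = g v + g w) ->
  (forall m n, f (hpure m n) = g (hpure m n)) -> forall v, f v = g v.
Proof. exact: tens_ext. Qed.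

Lemma hmap_pure M N M' N' (f : M -> M') (g : N -> N') m n : klin f -> klin g ->
  hmap f g (hpure m n) = hpure (f m) (g n).
Proof. by move=> fl gl; apply: tmap_pure. Qed.
Lemma hmapD M N M' N' (f : M -> M') (g : N -> N') x y : klin f -> klin g ->
  hmap f g (x + y) = hmap f g x + hmap f g y.
Proof. by move=> fl gl; apply: tmapD. Qed.

Lemma hact_pure M N a (m : M) (n : N) : a *: hpure m n =
  tlift (fun a1 a2 : A => hpure (a1 *: m) (a2 *: n)) (comul H a).
Proof.
rewrite [LHS]/(tens_act _ _) /tens_act /tmul; apply: eq_tlift => a1 a2.
rewrite /tmap (tlift_prod (tmul_bilin_in (mod_act_bilin M) (mod_act_bilin N) _ _)).
by [].
Qed.

Lemma hscal M N (c : k) (x : htens H M N) :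
  c%:A *: x = c *: (x : tens (restr M) (restr N)) :> tens (restr M) (restr N).
Proof.
rewrite -[LHS]/(tens_act (comul H c%:A) x).
have -> : comul H c%:A = c *: (1 : talg A A) :> tens A A.
  rewrite -(comul_multiplicative H).1.
  exact: (linearZ_LR (mkLinear (comul_linear H : linear (comul H : A -> tens A A)))).
rewrite [LHS](tmulZl (mod_act_bilin M) (mod_act_bilin N)); congr (_ *: _).
exact: tens_act1.
Qed.

Lemma hpure_scal M N (c : k) (m : M) (n : N) : c%:A *: hpure m n = hpure (c%:A *: m) n.
Proof. by rewrite [LHS]hscal -[LHS]tprodZl. Qed.

Lemma hmap_klin M N M' N' (f : M -> M') (g : N -> N') : klin f -> klin g ->
  klin (hmap f g).
Proof.
by move=> fl gl c x y; rewrite hmapD // [_ *: x]hscal [RHS]/(_ + _) hscal;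
  congr (_ + _); apply: tmapZ.
Qed.

Lemma hmap_linear M N M' N' (f : M -> M') (g : N -> N') : linear f -> linear g ->
  linear (hmap f g).
Proof.
move=> fl gl; have fk := linear_klin fl; have gk := linear_klin gl.
move=> a x y; rewrite hmapD //; congr (_ + _).
apply: (@htens_eq _ _ _ (fun x => hmap f g (a *: x)) (fun x => a *: hmap f g x)) => [v w|v w|m n].
- by rewrite scalerDr hmapD.
- by rewrite hmapD // scalerDr.
rewrite hmap_pure // !hact_pure (tlift_map (h := hmap f g)); last first.
  by move=> *; apply: hmapD.
apply: eq_tlift => a1 a2; rewrite hmap_pure //.
by rewrite (linZ fl) (linZ gl).
Qed.

Lemma hmapE M N M' N' (f : M -> M') (g : N -> N') (x : htens H M N) :
  tmap (f : restr M -> restr M') (g : restr N -> restr N') x = hmap f g x.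
Proof. by []. Qed.

Opaque hmap.

Lemma hmap_comp M N M' N' M'' N'' (f : M -> M') (g : N -> N') (f' : M' -> M'')
    (g' : N' -> N'') x : klin f -> klin g -> klin f' -> klin g' ->
  hmap f' g' (hmap f g x) = hmap (f' \o f) (g' \o g) x.
Proof.
move=> fl gl f'l g'l.
have cl := klin_comp.
apply: (@htens_eq _ _ _ (fun x => hmap f' g' (hmap f g x))) => [v w|v w|m n].
- by rewrite !hmapD.
- by rewrite hmapD //; apply: cl.
- by rewrite !hmap_pure //; apply: cl.
Qed.

Lemma hmap_id M N (x : htens H M N) : hmap id id x = x.
Proof.
apply: (@htens_eq _ _ _ (hmap id id) id) => [v w|//|m n]; first exact: hmapD.
exact: hmap_pure.
Qed.

Lemma hmap_addl M N M' N' (f f' : M -> M') (g : N -> N') x :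
  klin f -> klin f' -> klin g ->
  hmap (fun y => f y + f' y) g x = hmap f g x + hmap f' g x.
Proof.
move=> fl f'l gl; have sl : klin (fun y => f y + f' y).
  by move=> c u v; rewrite fl f'l scalerDr addrACA.
apply: (@htens_eq _ _ _ _ (fun x => hmap f g x + hmap f' g x)) => [v w|v w|m n].
- exact: hmapD.
- by rewrite !hmapD // addrACA.
- by rewrite !hmap_pure // hpureDl.
Qed.

Lemma hmap_addr M N M' N' (f : M -> M') (g g' : N -> N') x :
  klin f -> klin g -> klin g' ->
  hmap f (fun y => g y + g' y) x = hmap f g x + hmap f g' x.
Proof.
move=> fl gl g'l; have sl : klin (fun y => g y + g' y).
  by move=> c u v; rewrite gl g'l scalerDr addrACA.
apply: (@htens_eq _ _ _ _ (fun x => hmap f g x + hmap f g' x)) => [v w|v w|m n].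
- exact: hmapD.
- by rewrite !hmapD // addrACA.
- by rewrite !hmap_pure // hpureDr.
Qed.

Lemma hmap0l M N M' N' (g : N -> N') (x : htens H M N) : klin g ->
  hmap (fun _ : M => 0 : M') g x = 0.
Proof.
move=> gl; have zl := @klin_zero _ _ M M'.
apply: (addrI (hmap (fun _ : M => 0 : M') g x)); rewrite -hmap_addl // !addr0.
by congr (hmap _ _ _); apply/funext => u; rewrite addr0.
Qed.

Lemma hmap0r M N M' N' (f : M -> M') (x : htens H M N) : klin f ->
  hmap f (fun _ : N => 0 : N') x = 0.
Proof.
move=> fl; have zl := @klin_zero _ _ N N'.
apply: (addrI (hmap f (fun _ : N => 0 : N') x)); rewrite -hmap_addr // !addr0.
by congr (hmap _ _ _); apply/funext => u; rewrite addr0.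
Qed.

(* f (x) 1 and 1 (x) f, for f with values in k.                               *)
Definition slide_l M N (f : M -> triv H) (x : htens H M N) : N :=
  tlift (fun (y : M) (z : N) => (f y : k)%:A *: z : N) x.
Definition slide_r M N (f : M -> triv H) (x : htens H N M) : N :=
  tlift (fun (y : N) (z : M) => (f z : k)%:A *: y : N) x.

Lemma slide_l_bal M N (f : M -> triv H) : klin f ->
  balanced (fun (v : restr M) (c : k) => c *: v) (fun (c : k) (w : restr N) => c *: w)
    (fun (y : M) (z : N) => (f y : k)%:A *: z : N).
Proof.
move=> fl; split=> [m m' n|m n n'|m c n].
- by rewrite (klinD fl) -[(f m + f m' : triv H) : k]/((f m : k) + (f m' : k)) !scalerDl.
- exact: scalerDr.
- rewrite -[c *: m]/(c%:A *: (m : M)) (klinZ fl) trivZ -[c *: n]/(c%:A *: (n : N)).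
  by rewrite scalerA mulr_algl scalerA mulrC.
Qed.

Lemma slide_r_bal M N (f : M -> triv H) : klin f ->
  balanced (fun (v : restr N) (c : k) => c *: v) (fun (c : k) (w : restr M) => c *: w)
    (fun (y : N) (z : M) => (f z : k)%:A *: y : N).
Proof.
move=> fl; split=> [m m' n|m n n'|m c n].
- exact: scalerDr.
- by rewrite (klinD fl) -[(f n + f n' : triv H) : k]/((f n : k) + (f n' : k)) !scalerDl.
- rewrite -[c *: n]/(c%:A *: (n : M)) (klinZ fl) trivZ -[c *: m]/(c%:A *: (m : N)).
  by rewrite scalerA mulr_algl scalerA [(_ * c)%R]mulrC.
Qed.

Lemma slide_l_pure M N (f : M -> triv H) m (n : N) : klin f ->
  slide_l f (hpure m n) = (f m : k)%:A *: n.
Proof. by move=> fl; apply: (tlift_pure (slide_l_bal N fl)). Qed.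
Lemma slide_r_pure M N (f : M -> triv H) (n : N) m : klin f ->
  slide_r f (hpure n m) = (f m : k)%:A *: n.
Proof. by move=> fl; apply: (tlift_pure (slide_r_bal N fl)). Qed.
Lemma slide_lD M N (f : M -> triv H) (x y : htens H M N) : klin f ->
  slide_l f (x + y) = slide_l f x + slide_l f y.
Proof. by move=> fl; apply: (tliftD (slide_l_bal N fl)). Qed.
Lemma slide_rD M N (f : M -> triv H) (x y : htens H N M) : klin f ->
  slide_r f (x + y) = slide_r f x + slide_r f y.
Proof. by move=> fl; apply: (tliftD (slide_r_bal N fl)). Qed.

Lemma slide_l_linear M N (f : M -> triv H) : linear f -> linear (@slide_l M N f).
Proof.
move=> fl; have fk := linear_klin fl; move=> a x y; rewrite slide_lD //; congr (_ + _).
apply: (@htens_eq _ _ _ (fun x => slide_l f (a *: x)) (fun x => a *: slide_l f x)) => [v w|v w|m n].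
- by rewrite scalerDr slide_lD.
- by rewrite slide_lD // scalerDr.
rewrite slide_l_pure // hact_pure (tlift_map (h := slide_l f)); last first.
  by move=> *; apply: slide_lD.
rewrite -[in RHS](counitl H a).
rewrite (tlift_map (h := fun b : A => b *: ((f m : k)%:A *: n))); last first.
  by move=> *; apply: scalerDl.
apply: eq_tlift => a1 a2; rewrite slide_l_pure // (linZ fl).
rewrite -[(a1 *: f m : triv H) : k]/(counit H a1 * (f m : k)).
by rewrite !scalerA mulr_algl mulr_algr scalerA [(f m * _)%R]mulrC.
Qed.

Lemma slide_r_linear M N (f : M -> triv H) : linear f -> linear (@slide_r M N f).
Proof.
move=> fl; have fk := linear_klin fl; move=> a x y; rewrite slide_rD //; congr (_ + _).
apply: (@htens_eq _ _ _ (fun x => slide_r f (a *: x)) (fun x => a *: slide_r f x)) => [v w|v w|m n].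
- by rewrite scalerDr slide_rD.
- by rewrite slide_rD // scalerDr.
rewrite slide_r_pure // hact_pure (tlift_map (h := slide_r f)); last first.
  by move=> *; apply: slide_rD.
rewrite -[in RHS](counitr H a).
rewrite (tlift_map (h := fun b : A => b *: ((f n : k)%:A *: m))); last first.
  by move=> *; apply: scalerDl.
apply: eq_tlift => a1 a2; rewrite slide_r_pure // (linZ fl).
rewrite -[(a2 *: f n : triv H) : k]/(counit H a2 * (f n : k)).
by rewrite !scalerA mulr_algl mulr_algr scalerA [(f n * _)%R]mulrC.
Qed.

Lemma slide_lE M N (f : M -> triv H) (x : htens H M N) :
  tlift (fun (y : M) (z : N) => (f y : k)%:A *: z : N) x = slide_l f x.
Proof. by []. Qed.
Lemma slide_rE M N (f : M -> triv H) (x : htens H N M) :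
  tlift (fun (y : N) (z : M) => (f z : k)%:A *: y : N) x = slide_r f x.
Proof. by []. Qed.

Opaque slide_l slide_r.
End HtensMaps.

(** * The products of the terms of P and of P (x) P *)

Section ResolutionContraction.
Variables (k : fieldType) (A : algType k) (M : lmodType A) (P : resolution M).

Lemma klin_section (N Q : lmodType A) (p : N -> Q) : klin p ->
  exists2 s : Q -> N, forall v, p (s (p v)) = p v &
    forall (c : k) v v', s (c%:A *: p v + p v') = c%:A *: s (p v) + s (p v').
Proof.
by move=> pl; have [s s1 s2] := @linear_section k (restr N) (restr Q) p pl; exists s.
Qed.

(** As a complex of vector spaces P splits: with sections s of the differentials, t in degree i + 1
    is s (x - t (d x)), since x - t (d x) is a cycle and hence a boundary. *)
Lemma resolution_contraction : exists (eta : M -> P 0%N) (t : forall i, P i -> P i.+1),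
  [/\ klin eta, forall i, klin (t i), forall c, raug P (eta c) = c,
      forall x, rd P 0%N (t 0%N x) = x - eta (raug P x)
    & forall i x, rd P i.+1 (t i.+1 x) + t i (rd P i x) = x].
Proof.
have rk i : klin (rd P i) by apply/linear_klin/linearP.
have ak : klin (raug P) by apply/linear_klin/linearP.
have [eta eta1 eta2] := klin_section ak.
have eta_klin : klin eta.
  by move=> c x y; have [x' <-] := raug_surj P x; have [y' <-] := raug_surj P y.
have augK c : raug P (eta c) = c by have [x <-] := raug_surj P c.
have sec i : {s : P i -> P i.+1 | (forall v, rd P i (s (rd P i v)) = rd P i v) /\
    (forall (c : k) v v', s (c%:A *: rd P i v + rd P i v') =
      c%:A *: s (rd P i v) + s (rd P i v'))}.
  by apply: cid; have [s s1 s2] := klin_section (rk i); exists s.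
pose s i := projT1 (sec i); have sP i := projT2 (sec i).
pose t := fix t i : P i -> P i.+1 :=
  match i return P i -> P i.+1 with
  | 0 => fun x => s 0%N (x - eta (raug P x))
  | j.+1 => fun x => s j.+1 (x - t j (rd P j x))
  end.
have im0 x : exists y, rd P 0%N y = x - eta (raug P x).
  by apply/rexact0; rewrite linearB augK subrr.
have t0 x : rd P 0%N (t 0%N x) = x - eta (raug P x).
  by have [y e] := im0 x; rewrite /= -e (sP _).1.
have t_klin0 : klin (t 0%N).
  (* The section is known to be linear on the image of the differential, so its arguments are first
     written as boundaries. *)
  move=> c x y; have [x' ex] := im0 x; have [y' ey] := im0 y; rewrite /= -ex -ey.
  rewrite -(sP 0%N).2 ex ey; congr (s _ _).
  by rewrite (linearP (raug P)) eta_klin scalerBr; zmod.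
have im i : klin (t i) /\ forall x, exists y, rd P i.+1 y = x - t i (rd P i x).
  elim: i => [|i [tl IH]].
    split=> // x; apply/rexact; rewrite linearB t0.
    have -> : raug P (rd P 0%N x) = 0 by apply/rexact0; exists x.
    by rewrite (klin0 eta_klin) subr0 subrr.
  have tS : klin (t i.+1).
    move=> c x y; have [x' ex] := IH x; have [y' ey] := IH y; rewrite /= -ex -ey.
    rewrite -(sP i.+1).2 ex ey; congr (s _ _).
    by rewrite (linearP (rd P i)) tl scalerBr; zmod.
  split=> // x; apply/rexact; rewrite linearB.
  have dd : rd P i (rd P i.+1 x) = 0 by apply/rexact; exists x.
  have [y e] := IH (rd P i.+1 x).
  by rewrite /= -e (sP _).1 e dd (klin0 tl) subr0 subrr.
exists eta, t; split=> // [i|i x]; first exact: (im i).1.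
by have [y e] := (im i).2 x; rewrite /= -e (sP _).1 e subrK.
Qed.
End ResolutionContraction.

Lemma sgZ (R : pzRingType) (M : lmodType R) (e : bool) a (x : M) :
  a *: sg e x = sg e (a *: x).
Proof. by case: e; rewrite //= scalerN. Qed.

Section ProductComplex.
Variables (k : fieldType) (A : algType k) (H : hopf A) (P : resolution (triv H)).

(* The product of the P_i, in which the components of a chain need not be     *)
(* homogeneous: maps of any degree become endomorphisms of one module.        *)
Definition hat : lmodType A := prodmod P.

Definition hat_d (x : hat) : hat := fun i => rd P i (x i.+1).
Definition hat_mu (x : hat) : triv H := raug P (x 0%N).
(** The Koszul sign operator, through which the differential of a tensor product is d (x) 1 + eps
    (x) d; see [bihat_d_beta]. *)
Definition hat_eps (x : hat) : hat := fun i => sg (odd i) (x i).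
Definition hat_proj n (x : hat) : hat := fun i => if i == n then x i else 0.

Lemma hat_d_linear : linear hat_d.
Proof. by move=> a x y; apply/prodmod_ext => i; apply: linearP. Qed.
Lemma hat_mu_linear : linear hat_mu.
Proof. by move=> a x y; apply: linearP. Qed.
Lemma hat_eps_linear : linear hat_eps.
Proof.
by move=> a x y; apply/prodmod_ext => i; rewrite /hat_eps !prodmodD !prodmodZ sgD sgZ.
Qed.
Lemma hat_proj_linear n : linear (hat_proj n).
Proof.
move=> a x y; apply/prodmod_ext => i; rewrite /hat_proj !prodmodD !prodmodZ.
by case: eqP => _; rewrite ?scaler0 ?addr0.
Qed.

Lemma hat_d_proj n x : hat_d (hat_proj n.+1 x) = hat_proj n (hat_d x).
Proof.
by apply/prodmod_ext => i; rewrite /hat_d /hat_proj eqSS; case: eqP => // _; rewrite linear0.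
Qed.
Lemma hat_d_proj0 x : hat_d (hat_proj 0 x) = 0.
Proof. by apply/prodmod_ext => i; rewrite /hat_d /hat_proj /= linear0. Qed.
Lemma hat_eps_proj n x : hat_eps (hat_proj n x) = sg (odd n) (hat_proj n x).
Proof.
apply/prodmod_ext => i.
have -> : sg (odd n) (hat_proj n x) i = sg (odd n) (hat_proj n x i) by case: odd.
by rewrite /hat_eps /hat_proj; case: eqP => [->|_]; rewrite ?sg0.
Qed.

Lemma hat_contraction : exists eta t,
  contraction (fmapL H hat_d_linear) (kapL H \o fmapL H hat_mu_linear) eta t.
Proof.
have [eta [t [etal tl aK t0 tS]]] := resolution_contraction P.
pose e (c : triv H) : hat := fun i => if i is 0 then eta c else 0.
pose T (x : hat) : hat := fun i => if i is j.+1 then t j (x j) else 0.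
exists (fmap e \o @kinv k A H), (fmap T); apply: contraction_freebim.
- by move=> c x y; apply/prodmod_ext => -[|i] /=; rewrite ?prodmodD ?prodmodZ /= ?scaler0 ?addr0 ?tl.
- by move=> c x y; apply/prodmod_ext => -[|i] /=; rewrite ?prodmodD ?prodmodZ /= ?scaler0 ?addr0.
- exact: aK.
- by move=> x; rewrite /hat_mu /= linear0.
- by move=> c; apply/prodmod_ext => i; rewrite /hat_d /= linear0.
- move=> x; apply/prodmod_ext => -[|i] /=; rewrite !prodmodD prodmodN /hat_d /=.
    by rewrite addr0 t0.
  by rewrite tS subr0.
Qed.
End ProductComplex.

Section Slides.
Variables (k : fieldType) (A : algType k) (H : hopf A).
Implicit Types (M N Q : lmodType A).

Lemma hpureN M N (m : M) (n : N) : hpure H (- m) n = - hpure H m n.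
Proof.
have h0 : hpure H (0 : M) n = 0.
  by apply: (addrI (hpure H (0 : M) n)); rewrite -hpureDl !addr0.
by apply: (addrI (hpure H m n)); rewrite -hpureDl !subrr.
Qed.

Lemma slide_l_map M N M' N' (f : M' -> triv H) (h : M -> M') (g : N -> N') x :
  klin f -> klin h -> klin g ->
  slide_l f (hmap h g x : htens H M' N') = g (slide_l (f \o h) x).
Proof.
move=> fl hl gl; have fhl : klin (f \o h) by move=> c u v; rewrite /= hl fl.
apply: (@htens_eq _ _ _ _ _ _ (fun x => slide_l f (hmap h g x)) (fun x => g (slide_l (f \o h) x))).
- by move=> u v; rewrite hmapD // slide_lD.
- by move=> u v; rewrite slide_lD // klinD.
by move=> m n; rewrite hmap_pure // !slide_l_pure // klinZ.
Qed.

Lemma slide_r_map M N M' N' (f : M' -> triv H) (h : M -> M') (g : N -> N') x :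
  klin f -> klin h -> klin g ->
  slide_r f (hmap g h x : htens H N' M') = g (slide_r (f \o h) x).
Proof.
move=> fl hl gl; have fhl : klin (f \o h) by move=> c u v; rewrite /= hl fl.
apply: (@htens_eq _ _ _ _ _ _ (fun x => slide_r f (hmap g h x)) (fun x => g (slide_r (f \o h) x))).
- by move=> u v; rewrite hmapD // slide_rD.
- by move=> u v; rewrite slide_rD // klinD.
by move=> m n; rewrite hmap_pure // !slide_r_pure // klinZ.
Qed.

Lemma slide_l0 M N (x : htens H M N) : slide_l (fun _ : M => 0 : triv H) x = 0.
Proof.
have zl := @klin_zero _ _ M (triv H).
apply: (@htens_eq _ _ _ _ _ _ (slide_l (fun _ : M => 0 : triv H)) (fun=> 0)).
- by move=> u v; rewrite slide_lD.
- by rewrite addr0.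
by move=> m n; rewrite slide_l_pure // !scale0r.
Qed.

Lemma slide_r0 M N (x : htens H N M) : slide_r (fun _ : M => 0 : triv H) x = 0.
Proof.
have zl := @klin_zero _ _ M (triv H).
apply: (@htens_eq _ _ _ _ _ _ (slide_r (fun _ : M => 0 : triv H)) (fun=> 0)).
- by move=> u v; rewrite slide_rD.
- by rewrite addr0.
by move=> m n; rewrite slide_r_pure // !scale0r.
Qed.

(** Both sides are g (x) f followed by k (x) k = k. *)
Lemma slide_lr M N (f : M -> triv H) (g : N -> triv H) (x : htens H N M) :
  klin f -> klin g -> f (slide_l g x) = g (slide_r f x).
Proof.
move=> fl gl.
apply: (@htens_eq _ _ _ _ _ _ (fun x => f (slide_l g x)) (fun x => g (slide_r f x))).
- by move=> u v; rewrite slide_lD // klinD.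
- by move=> u v; rewrite slide_rD // klinD.
move=> n m; rewrite slide_l_pure // slide_r_pure // (klinZ fl) (klinZ gl) !trivZ.
exact: mulrC.
Qed.
End Slides.

(** * The double complex of P (x) P and its contraction *)

Section DoubleComplex.
Variables (k : fieldType) (A : algType k) (H : hopf A) (P : resolution (triv H)).

Definition bihat_row (i : nat) : lmodType A :=
  prodmod (fun j => htens H (P i) (P j) : lmodType A).
Definition bihat : lmodType A := prodmod bihat_row.

Let rk i : klin (rd P i). Proof. exact/linear_klin/linearP. Qed.
Let ak : klin (raug P). Proof. exact/linear_klin/linearP. Qed.
Let idk (M : lmodType A) : klin (id : M -> M). Proof. by []. Qed.
Let idl (M : lmodType A) : linear (id : M -> M). Proof. by []. Qed.

Lemma bihat_ext (x y : bihat) : (forall i j, x i j = y i j) -> x = y.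
Proof. by move=> e; apply/prodmod_ext => i; apply/prodmod_ext => j. Qed.

Definition bihat_d (y : bihat) : bihat := fun i j =>
  hmap (rd P i) id (y i.+1 j) + sg (odd i) (hmap id (rd P j) (y i j.+1)).

Lemma bihat_d_linear : linear bihat_d.
Proof.
move=> a x y; apply/bihat_ext => i j.
rewrite /bihat_d !(prodmodD, prodmodZ) (hmap_linear (linearP (rd P i)) (@idl _)).
rewrite (hmap_linear (@idl _) (linearP (rd P j))) sgD -sgZ scalerDr.
by rewrite addrACA.
Qed.

Definition bihat_mu (y : bihat) : triv H := raug P (slide_l (raug P) (y 0%N 0%N)).

Lemma bihat_mu_linear : linear bihat_mu.
Proof.
move=> a x y; rewrite /bihat_mu !(prodmodD, prodmodZ) (slide_l_linear (linearP (raug P))).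
exact: linearP.
Qed.

Definition beta (p q : hat P) : bihat := fun i j => hpure H (p i) (q j).

Lemma betaDl p p' q : beta (p + p') q = beta p q + beta p' q.
Proof. by apply/bihat_ext => i j; apply: hpureDl. Qed.
Lemma betaZl (c : k) p q : beta (c%:A *: p) q = c%:A *: beta p q.
Proof. by apply/bihat_ext => i j; rewrite !prodmodZ [RHS]hpure_scal. Qed.
Lemma beta_klin p : klin (beta p).
Proof.
move=> c q q'; apply/bihat_ext => i j.
change (hpure H (p i) (c%:A *: q j + q' j) =
  c%:A *: hpure H (p i) (q j) + hpure H (p i) (q' j)).
by rewrite hpureDr hpure_scal hpureZ.
Qed.
Lemma beta_act a p q :
  tlift (fun a1 a2 => beta (a1 *: p) (a2 *: q)) (comul H a) = a *: beta p q.
Proof.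
apply/bihat_ext => i j; rewrite !prodmodZ [RHS]hact_pure.
by rewrite (tlift_map (h := fun y : bihat => y i j)).
Qed.

Lemma bihat_d_beta p q :
  bihat_d (beta p q) = beta (hat_d p) q + beta (hat_eps p) (hat_d q).
Proof.
apply/bihat_ext => i j; rewrite !prodmodD /bihat_d /beta !hmap_pure //.
rewrite /hat_eps /hat_d; congr (_ + _).
by case: odd; rewrite //= hpureN.
Qed.

Section Slide.
Variables (m : nat) (f : P m -> triv H) (fl : linear f).
Let fk := linear_klin fl.

Definition hat_f (x : hat P) : triv H := f (x m).
Definition bihat_l (y : bihat) : hat P := fun j => slide_l f (y m j).
(** The sign is the Koszul sign of moving f past an element of degree j. *)
Definition bihat_r (y : bihat) : hat P :=
  fun j => sg (odd m && odd j) (slide_r f (y j m)).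

Lemma hat_f_linear : linear hat_f.
Proof. by move=> a x y; apply: fl. Qed.
Lemma bihat_l_linear : linear bihat_l.
Proof. by move=> a x y; apply/prodmod_ext => j; apply: slide_l_linear. Qed.
Lemma bihat_r_linear : linear bihat_r.
Proof.
move=> a x y; apply/prodmod_ext => j.
by rewrite /bihat_r !(prodmodD, prodmodZ) slide_r_linear // sgD sgZ.
Qed.

Lemma bihat_l_beta p q : bihat_l (beta p q) = (hat_f p : k)%:A *: q.
Proof. by apply/prodmod_ext => j; rewrite /bihat_l slide_l_pure. Qed.
Lemma bihat_r_beta p q :
  bihat_r (beta p q) = (hat_f q : k)%:A *: (if odd m then hat_eps p else p).
Proof.
apply/prodmod_ext => j; rewrite /bihat_r slide_r_pure // prodmodZ.
by case: (odd m) => //=; rewrite /hat_eps sgZ.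
Qed.

Hypothesis f_cocycle : cocycle f.
Let fr0 : f \o rd P m = fun=> 0.
Proof. exact/funext. Qed.

Lemma hat_f_d x : hat_f (hat_d x) = 0.
Proof. exact: f_cocycle. Qed.

Lemma bihat_l_d y : hat_d (bihat_l y) = sg (odd m) (bihat_l (bihat_d y)).
Proof.
apply/prodmod_ext => j.
have -> : sg (odd m) (bihat_l (bihat_d y)) j = sg (odd m) (bihat_l (bihat_d y) j).
  by case: odd.
rewrite /bihat_l /bihat_d slide_lD // slide_l_map // fr0 slide_l0 add0r.
rewrite (_ : slide_l f (sg _ _) = sg (odd m) (slide_l f (hmap id (rd P j) (y m j.+1)))).
  by rewrite sgK slide_l_map.
by case: odd => //=; apply: (klinN (linear_klin (slide_l_linear fl))).
Qed.

Lemma bihat_r_d y : hat_d (bihat_r y) = sg (odd m) (bihat_r (bihat_d y)).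
Proof.
apply/prodmod_ext => j.
have -> : sg (odd m) (bihat_r (bihat_d y)) j = sg (odd m) (bihat_r (bihat_d y) j).
  by case: odd.
rewrite /bihat_r /bihat_d slide_rD // slide_r_map //.
rewrite (_ : slide_r f (sg _ _) = sg (odd j) (slide_r f (hmap id (rd P m) (y j m.+1)))); last first.
  by case: odd => //=; apply: (klinN (linear_klin (slide_r_linear fl))).
rewrite slide_r_map // fr0 slide_r0 sg0 addr0 sgM /hat_d /=.
by case: (odd m) (odd j) => [] []; rewrite /sg //= linearN.
Qed.
End Slide.

(** f (g (x) 1) and g (1 (x) f) are both g (x) f up to the Koszul sign; this symmetry removes the
    homotopy u from the final formula. *)
Lemma slide_exchange m n (f : P m -> triv H) (g : P n -> triv H) y :
  linear f -> linear g ->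
  hat_f f (bihat_l g y) = sg (odd m && odd n) (hat_f g (bihat_r f y)) /\
  hat_f f (bihat_r g y) = sg (odd m && odd n) (hat_f g (bihat_l f y)).
Proof.
move=> fl gl; have fk := linear_klin fl; have gk := linear_klin gl.
have sgk (M : lmodType A) (h : M -> triv H) (e : bool) x : klin h -> h (sg e x) = sg e (h x).
  by case: e => //= hk; apply: klinN.
rewrite /hat_f /bihat_l /bihat_r !sgk // (slide_lr _ fk gk) (slide_lr _ gk fk).
by split; rewrite ?sgM ?addbb // [(odd n && _)%B]andbC ?addbb.
Qed.

End DoubleComplex.

Section HmapOpp.
Variables (k : fieldType) (A : algType k) (H : hopf A).
Implicit Types (M N : lmodType A).

Lemma hmap_oppl M N M' N' (f : M -> M') (g : N -> N') (x : htens H M N) :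
  klin f -> klin g -> hmap (fun y => - f y) g x = - hmap f g x.
Proof.
move=> fl gl; have nl := klin_opp fl.
apply: (addrI (hmap f g x)); rewrite -hmap_addl // subrr.
by rewrite -[RHS](hmap0l _ x gl); congr (hmap _ _ _); apply/funext => u; rewrite subrr.
Qed.

Lemma hmap_oppr M N M' N' (f : M -> M') (g : N -> N') (x : htens H M N) :
  klin f -> klin g -> hmap f (fun y => - g y) x = - hmap f g x.
Proof.
move=> fl gl; have nl := klin_opp gl.
apply: (addrI (hmap f g x)); rewrite -hmap_addr // subrr.
by rewrite -[RHS](hmap0r _ x fl); congr (hmap _ _ _); apply/funext => u; rewrite subrr.
Qed.
End HmapOpp.

Section DoubleContraction.
Variables (k : fieldType) (A : algType k) (H : hopf A) (P : resolution (triv H)).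

Let rk i : klin (rd P i). Proof. exact/linear_klin/linearP. Qed.
Let ak : klin (raug P). Proof. exact/linear_klin/linearP. Qed.
Let idk (M : lmodType A) : klin (id : M -> M). Proof. by []. Qed.

Lemma bihat_contraction : exists eta t,
  contraction (fmapL H (@bihat_d_linear k A H P))
    (kapL H \o fmapL H (@bihat_mu_linear k A H P)) eta t.
Proof.
have [eta [t [etal tl aK t0 tS]]] := resolution_contraction P.
pose em : P 0%N -> P 0%N := eta \o raug P.
have emk : klin em by move=> c x y; rewrite /em /= ak etal.
have emd : em \o rd P 0%N = fun=> 0.
  apply/funext => x; rewrite /em /=.
  by have -> : raug P (rd P 0%N x) = 0; [apply/rexact0; exists x|exact: klin0].
pose e (c : triv H) : bihat P := fun i j =>
  match i, j with 0, 0 => hpure H (eta c) (eta ((1 : k) : triv H)) | _, _ => 0 end.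
(* The standard contraction t (x) 1 + eta mu (x) t of a tensor product. *)
pose T (y : bihat P) : bihat P := fun i j =>
  match i, j with
  | i'.+1, _ => hmap (t i') id (y i' j)
  | 0, j'.+1 => hmap em (t j') (y 0%N j')
  | 0, 0 => 0
  end.
have d0 (M N M' N' : lmodType A) (f : M -> M') (g : N -> N') : klin f -> klin g ->
    hmap f g (0 : htens H M N) = 0.
  by move=> fl gl; apply: klin0; apply: hmap_klin.
exists (fmap e \o @kinv k A H), (fmap T); apply: contraction_freebim.
- move=> c x y; apply/bihat_ext => -[|i] [|j]; rewrite !(prodmodD, prodmodZ) /T.
  + by rewrite scaler0 addr0.
  + by apply: hmap_klin.
  + by apply: hmap_klin.
  + by apply: hmap_klin.
- move=> c x y; apply/bihat_ext => -[|i] [|j]; rewrite !(prodmodD, prodmodZ) /e;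
    rewrite ?scaler0 ?addr0 //.
  by rewrite etal hpureDl hpure_scal.
- move=> c; rewrite /bihat_mu /= slide_l_pure // aK (klinZ ak) aK trivZ.
  exact: mulr1.
- move=> y; rewrite /bihat_mu /=.
  by rewrite (klin0 (linear_klin (slide_l_linear (linearP (raug P))))) linear0.
- move=> c; apply/bihat_ext => -[|i] [|j]; rewrite /bihat_d /e !d0 //= ?sg0 addr0 //.
- have sgk (M N M' N' : lmodType A) (f : M -> M') (g : N -> N') (b : bool) (x : htens H M N) :
      klin f -> klin g -> hmap f g (sg b x) = sg b (hmap f g x).
    by case: b => //= fl gl; apply/klinN/hmap_klin.
  have ck := klin_comp.
  have nk := klin_opp.
  have t0E : rd P 0%N \o t 0%N = fun x => id x + - em x by apply/funext.
  have tSE i : (fun x => (rd P i.+1 \o t i.+1) x + (t i \o rd P i) x) = id.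
    exact/funext/(tS i).
  move=> y; apply/bihat_ext => -[|i] j; last first.
    change (hmap (rd P i.+1) id (hmap (t i.+1) id (y i.+1 j))
      + sg (odd i.+1) (hmap id (rd P j) (hmap (t i) id (y i j.+1)))
      + hmap (t i) id (hmap (rd P i) id (y i.+1 j)
        + sg (odd i) (hmap id (rd P j) (y i j.+1))) = y i.+1 j - 0).
    rewrite hmapD // sgk // !hmap_comp // -[odd i.+1]/(~~ odd i) sgNb subr0.
    transitivity (hmap (fun x => (rd P i.+1 \o t i.+1) x + (t i \o rd P i) x) id (y i.+1 j)).
      by rewrite hmap_addl //; try exact: ck; zmod.
    by rewrite tSE hmap_id.
  case: j => [|j].
    change (hmap (rd P 0%N) id (hmap (t 0%N) id (y 0%N 0%N))
      + hmap id (rd P 0%N) (hmap em (t 0%N) (y 0%N 0%N)) + 0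
      = y 0%N 0%N - hpure H (eta (bihat_mu y)) (eta ((1 : k) : triv H))).
    rewrite !hmap_comp // t0E hmap_addl // ?hmap_addr // ?hmap_oppl ?hmap_oppr //; try exact: nk.
    rewrite hmap_id.
    (* [em] (x) [em] factors through k (x) k = k, and so equals the section after the augmentation
       of the double complex. *)
    have -> : hmap em em (y 0%N 0%N) = hpure H (eta (bihat_mu y)) (eta ((1 : k) : triv H)).
      rewrite /bihat_mu.
      have etaE (c : triv H) : eta c = (c : k)%:A *: eta ((1 : k) : triv H).
        by rewrite -(klinZ etal) trivZ mulr1.
      apply: (@htens_eq _ _ _ _ _ _ (hmap em em)
        (fun x => hpure H (eta (raug P (slide_l (raug P) x))) (eta ((1 : k) : triv H)))).
      + by move=> u v; apply: hmapD.
      + by move=> u v; rewrite slide_lD // linearD (klinD etal) hpureDl.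
      move=> p q; rewrite hmap_pure // slide_l_pure // (klinZ ak) (klinZ etal).
      rewrite /em /=; move: (raug P p) (raug P q) => c d.
      rewrite [eta c]etaE [eta d]etaE -hpureZ; congr hpure.
      by rewrite !scalerA !mulr_algl !scalerA [(c * _)%R]mulrC.
    by zmod.
  change (hmap (rd P 0%N) id (hmap (t 0%N) id (y 0%N j.+1))
    + hmap id (rd P j.+1) (hmap em (t j.+1) (y 0%N j.+1))
    + hmap em (t j) (hmap (rd P 0%N) id (y 1%N j) + hmap id (rd P j) (y 0%N j.+1))
    = y 0%N j.+1 - 0).
  rewrite hmapD // !hmap_comp // t0E hmap_addl // ?hmap_oppl //; try exact: nk.
  have -> : hmap (em \o rd P 0%N) (t j \o id) (y 1%N j) = 0.
    by rewrite emd hmap0l //; apply: ck.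
  rewrite -[em \o id]/em -[id \o em]/em -[t j \o rd P j]/(t j \o rd P j).
  have e1 : hmap em id (y 0%N j.+1) = hmap em (rd P j.+1 \o t j.+1) (y 0%N j.+1) +
      hmap em (t j \o rd P j) (y 0%N j.+1).
    by rewrite -hmap_addr //; [rewrite tSE|exact: ck|exact: ck].
  by rewrite hmap_id e1; zmod.
Qed.
End DoubleContraction.

(** * Diagonal maps and homotopy liftings on the products *)

Section HatMorphisms.
Variables (k : fieldType) (A : algType k) (H : hopf A) (P : resolution (triv H)).
Variables (Delta : forall n i j, {linear P n -> htens H (P i) (P j)}).

Definition hat_Delta (x : hat P) : bihat P := fun i j => Delta (i + j) i j (x (i + j)%N).

Lemma hat_Delta_linear : linear hat_Delta.
Proof. by move=> a x y; apply/bihat_ext => i j; apply: linearP. Qed.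

Section Diagonal.
Hypothesis Delta_diag : diagonal_map Delta.

Lemma hat_Delta_d x : bihat_d (hat_Delta x) = hat_Delta (hat_d x).
Proof.
apply/bihat_ext => i j; rewrite /bihat_d /hat_Delta /hat_d.
have := diag_chain Delta_diag i j (x (i + j).+1).
rewrite [LHS]/(_ + _) !hmapE sgE => <-; congr (_ + sg _ (hmap _ _ _)).
by rewrite addnS.
Qed.

Lemma hat_Delta_mu x : bihat_mu (hat_Delta x) = hat_mu x.
Proof.
have ak : klin (raug P) by apply/linear_klin/linearP.
(* [slide_l id] is the identification of k (x) k with k. *)
have := diag_aug Delta_diag (x 0%N); rewrite hmapE => /(congr1 (slide_l id)).
rewrite slide_l_map // => e; rewrite /bihat_mu /hat_Delta e.
rewrite [LHS](slide_l_pure (raug P (x 0%N)) (1 : triv H)) //.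
rewrite trivZ; exact: mulr1.
Qed.
End Diagonal.

(** The component into P_j starts in degree j + m - 1, which makes a morphism of degree m - 1 an
    endomorphism of the product. For j = m = 0 the index is truncated to 0, where the degree
    condition makes psi vanish. *)
Definition hat_psi m (psi : forall i j, {linear P i -> P j}) (x : hat P) : hat P :=
  fun j => psi (j + m).-1 j (x (j + m).-1).

Lemma hat_psi_linear m psi : linear (hat_psi m psi).
Proof. by move=> a x y; apply/prodmod_ext => j; apply: linearP. Qed.

Lemma hat_psi_bdry l m (f : P m -> triv H) (psi : forall i j, {linear P i -> P j}) x :
  l = m%:Z - 1 -> has_degree l psi ->
  (forall i j (x : P i), bdry l psi j x = comm_diag Delta f j x) ->
  hat_d (hat_psi m psi x) - sg (~~ odd m) (hat_psi m psi (hat_d x)) =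
  bihat_l f (hat_Delta x) - bihat_r f (hat_Delta x).
Proof.
move=> el deg bd; apply/prodmod_ext => j; rewrite !prodmodD !prodmodN.
have -> : sg (~~ odd m) (hat_psi m psi (hat_d x)) j =
    sg (~~ odd m) (hat_psi m psi (hat_d x) j) by case: (~~ odd m).
have := bd (j + m)%N j (x (j + m)%N); rewrite /bdry /comm_diag !(slide_lE, slide_rE) sgE.
rewrite /sgn sgE el; have -> : odd `|m%:Z - 1|%N = ~~ odd m.
  by case: m {f bd el x} => // m; rewrite -addn1 PoszD addrK addn1 /= negbK.
rewrite oddM => e.
rewrite /bihat_l /bihat_r /hat_Delta [in LHS]/hat_d {1}/hat_psi [(j.+1 + m)%N]/=.
rewrite -[(j.+1 + m)%N]/((j + m).+1)%N /= [(m + j)%N]addnC -e; congr (_ - sg _ _).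
rewrite /hat_psi /hat_d; case E: (j + m)%N => [|i] //=.
(* At j = m = 0 the truncated predecessor yields psi 0 0, which is 0 because psi has degree -1. *)
move/eqP: E; rewrite addn_eq0 => /andP[/eqP j0 /eqP m0]; rewrite linear0.
by apply: deg; rewrite el j0 m0.
Qed.

Lemma hat_psi_mu m psi x : hat_mu (hat_psi m psi x) = raug P (psi m.-1 0%N (x m.-1)).
Proof. by []. Qed.

Lemma hat_psi_f m (f : P m -> triv H) psi x :
  hat_f f (hat_psi 0 psi x) = f (psi m.-1 m (x m.-1)).
Proof. by rewrite /hat_f /hat_psi addn0. Qed.

(** For m < 2 the index m.-1 is 0, where [dfrom] vanishes; otherwise [dfrom] is a component of the
    total differential. *)
Lemma hat_dfrom m (h : {linear P m.-2 -> triv H}) :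
  exists2 h' : hat P -> triv H, linear h' &
    forall x : hat P, h (dfrom (x m.-1)) = h' (hat_d x).
Proof.
case: m h => [|[|m]] h.
- exists (fun=> 0) => [a x y|x]; first by rewrite scaler0 addr0.
  exact: linear0.
- exists (fun=> 0) => [a x y|x]; first by rewrite scaler0 addr0.
  exact: linear0.
- by exists (fun x => h (x m)) => // a x y; apply: linearP.
Qed.

Lemma hat_lifting (Delta_diag : diagonal_map Delta) m (f : {linear P m -> triv H})
    (psi : forall i j, {linear P i -> P j}) : homotopy_lifting Delta f psi ->
  exists (psi0 : hat P -> hat P) (hf : hat P -> triv H), linear psi0 /\ linear hf /\
    [/\ forall x, hat_d (psi0 x) + psi0 (hat_d x) =
          bihat_l (raug P) (hat_Delta x) - bihat_r (raug P) (hat_Delta x),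
        forall x, hat_mu (psi0 x) = 0
      & forall x, hat_mu (hat_psi m psi x) - sg (~~ odd m) (hat_f f (psi0 x)) = hf (hat_d x)].
Proof.
case=> deg bd [psi0 [deg0 bd0 [h hE]]].
have [hf hfl hfE] := hat_dfrom h.
exists (hat_psi 0 psi0), hf; split; first exact: hat_psi_linear.
split=> //; split=> x.
- have := hat_psi_bdry (m := 0) x _ deg0 bd0; rewrite sub0r => <- //.
  by rewrite /sg /= opprK.
(* psi0 raises degrees by one, so its component into P_0 vanishes. *)
- by rewrite hat_psi_mu deg0 ?linear0.
rewrite hat_psi_mu hat_psi_f -hfE -hE /sgn; congr (_ - _).
by rewrite sgE; have -> : odd `|(m%:Z + 1)%R|%N = ~~ odd m by rewrite -PoszD addn1.
Qed.
End HatMorphisms.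

Lemma multilinear_unit (k : fieldType) (A : algType k) : multilinear (@unit_cochain k A).
Proof. by case=> [|x s] t c a b; rewrite /= lact0r addr0. Qed.

Lemma hoch_d_unit (k : fieldType) (A : algType k) s : hoch_d (@unit_cochain k A) s = 0.
Proof.
case: s => [|a [|b s]].
- by rewrite hoch_dE /= subr0 addr0.
- by rewrite hoch_dE /= bimod_lactE bimod_ractE mul1r mulr1 subr0 subrr.
rewrite -[RHS](@hoch_d0 _ _ _ [:: a, b & s]); apply: eq_hoch_d => -[|x t] //.
Qed.

(** A left factor concentrated in degree p leaves a single cut. *)
Lemma decon_size (k : fieldType) (A : algType k) (N : lmodType (env A)) (p : nat)
    (K : seq A -> seq A -> N) s : (forall u v, size u != p -> K u v = 0) ->
  decon K s = upto p K s.
Proof.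
elim: p K s => [|p IH] K s K0.
  by rewrite /upto take0 drop0 decon_nil // => a u v; rewrite K0.
case: s => [|a s]; first by rewrite /= K0 // addr0.
rewrite deconE K0 // add0r (IH (fun u v => K (a :: u) v)) // => u v up.
by apply: K0; rewrite eqSS.
Qed.

Lemma decon_sizer (k : fieldType) (A : algType k) (N : lmodType (env A)) (p : nat)
    (K : seq A -> seq A -> N) s : (forall u v, size v != p -> K u v = 0) ->
  decon K s = if (p <= size s)%N then K (take (size s - p)%N s) (drop (size s - p)%N s) else 0.
Proof.
move=> K0; case: leqP => ps; last first.
  rewrite -[RHS](decon0 _ s); apply: eq_decon => u v uv; apply: K0.
  by rewrite ltn_eqF // (leq_ltn_trans _ ps) // -uv size_cat leq_addl.
rewrite (@eq_decon _ _ _ _ (fun u v => if size u == (size s - p)%N then K u v else 0)).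
  rewrite (@decon_size _ _ _ (size s - p)%N); last by move=> u v /negbTE->.
  by rewrite /upto leq_subr size_takel ?leq_subr // eqxx.
move=> u v uv; case: eqP => // nu; apply: K0; apply/eqP => vp; apply: nu.
by rewrite -uv size_cat vp addnK.
Qed.

Lemma linear_decon (k : fieldType) (A : algType k) (N N' : lmodType (env A))
    (h : {linear N -> N'}) (K : seq A -> seq A -> N) s :
  h (decon K s) = decon (fun u v => h (K u v)) s.
Proof.
elim: s K => [|a s IH] K; first by rewrite /= !addr0.
by rewrite !deconE linearD (IH (fun u v => K (a :: u) v)).
Qed.

Section FreeMaps.
Variables (k : fieldType) (A : algType k) (H : hopf A).
Implicit Types (M N : lmodType A).

Definition kmap M (f : M -> triv H) (fl : linear f) :
  {linear freebim H M -> bimod A} := kapL H \o fmapL H fl.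

Lemma kmapE M (f : M -> triv H) (fl : linear f) v : kmap fl v = kap (fmap f v).
Proof. by []. Qed.

Lemma fmap_sg M N (h : M -> N) (e : bool) (v : freebim H M) : klin h ->
  fmap (fun x => sg e (h x)) v = sg e (fmap h v).
Proof. by case: e => // hl; apply: fmap_oppf. Qed.

Lemma fmap_scalar M (c : k) (w : freebim H M) :
  fmap (fun q : M => c%:A *: q) w = lact c%:A w.
Proof.
have cl : klin (fun q : M => c%:A *: q).
  by move=> z y y'; rewrite scalerDr !scalerA mulr_algl mulr_algr.
apply: (@freebim_eq _ _ _ _ _ _ (fun w => lact c%:A w)) => [v v'|v v'|n y].
- exact: fmapD.
- exact: lactDr.
by rewrite fmap_pure // lact_alg_fpure.
Qed.

Lemma fmap_rank1 M N (f : N -> triv H) (fl : linear f) (p : M) (w : freebim H N) :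
  fmap (fun q : N => (f q : k)%:A *: p) w = fpure H p (kmap fl w).
Proof.
have fk := linear_klin fl; rewrite kmapE.
have cl : klin (fun q : N => (f q : k)%:A *: p).
  move=> z y y'; rewrite fk -[(_ + _ : triv H) : k]/((z%:A *: f y : k) + (f y' : k)).
  by rewrite trivZ !scalerDl scalerA mulr_algl scalerA.
apply: (@freebim_eq _ _ _ _ _ _ (fun w => fpure H p (kap (fmap f w)))) => [v v'|v v'|n y].
- exact: fmapD.
- by rewrite fmapD // kapD fpureDr.
by rewrite !fmap_pure // kap_pure fpureZ.
Qed.
End FreeMaps.

(** * The chain map iota and the product on V(P) *)

Section BarResolution.
Variables (k : fieldType) (A : algType k) (H : hopf A) (P : resolution (triv H)).

Implicit Types (M N : lmodType A).

Let dk := linear_klin (@hat_d_linear k A H P).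
Let ek := linear_klin (@hat_eps_linear k A H P).
Let muk := linear_klin (@hat_mu_linear k A H P).
Let prk n := linear_klin (@hat_proj_linear k A H P n).

Lemma fmap_lact M N (h : M -> N) (hl : linear h) a (v : freebim H M) :
  fmap h (lact a v) = lact a (fmap h v).
Proof. exact: (linear_lact (fmapL H hl)). Qed.

Lemma fmap_hoch_d M N (h : M -> N) (hl : linear h) (phi : seq A -> freebim H M) s :
  fmap h (hoch_d phi s) = hoch_d (fun t => fmap h (phi t)) s.
Proof. exact: (linear_hoch_d (fmapL H hl)). Qed.

Lemma kmap_hoch_d M (h : M -> triv H) (hl : linear h) (phi : seq A -> freebim H M) s :
  kap (fmap h (hoch_d phi s)) = hoch_d (fun t => kap (fmap h (phi t))) s.
Proof. exact: (linear_hoch_d (kmap hl)). Qed.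

(** A chain map from the bar resolution to V(P) over the identity of A. The last clause places its
    values on sequences of length i in the component V(P_i), which [lifting_exists] alone does not
    ensure. *)
Definition homogeneous_chain (iota : seq A -> freebim H (hat P)) : Prop :=
  [/\ multilinear iota, forall s, fmap (@hat_d k A H P) (iota s) = hoch_d iota s,
      forall s, kap (fmap (@hat_mu k A H P) (iota s)) = unit_cochain s
    & forall s, fmap (hat_proj (size s)) (iota s) = iota s].

Lemma iota_exists : exists iota, homogeneous_chain iota.
Proof.
have [eta [t hc]] := @hat_contraction k A H P.
have [||s|s|w [wl muw dw]] := @lifting_exists _ _ _ _ (kmap (@hat_mu_linear k A H P)) _ _ hc
  true (fun=> 0) (@unit_cochain k A).
- by move=> s u c a b; rewrite lact0r addr0.
- exact: multilinear_unit.
- by rewrite linear0 hoch_d0 sg0.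
- by rewrite linear0 hoch_d_unit sg0.
(* The lift w may have components in several degrees; keeping the one in degree [size s] still gives
   a chain map, because d lowers degrees by one. *)
exists (fun s => fmap (hat_proj (size s)) (w s)); split=> [s u c a b|s|s|s].
- by rewrite wl fmapD // fmap_scal // !size_cat /=.
- have dwE : fmap (@hat_d k A H P) (w s) = hoch_d w s.
    by have := dw s; rewrite /= => /eqP; rewrite addr_eq0 opprK => /eqP.
  rewrite fmap_comp //; case: s dwE => [_|a s dwE].
    rewrite (_ : _ \o _ = fun=> 0); last by apply/funext => x; apply: hat_d_proj0.
    by rewrite fmap_zero hoch_dE /= subr0 addr0.
  rewrite (_ : _ \o _ = hat_proj (size s) \o @hat_d k A H P); last first.
    by apply/funext => x; apply: hat_d_proj.
  rewrite -fmap_comp // dwE fmap_hoch_d; last exact: hat_proj_linear.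
  by apply: eq_hoch_d => u [->].
- rewrite fmap_comp //; case: s => [|a s].
    exact: (muw [::]).
  rewrite (_ : _ \o _ = fun=> 0) ?fmap_zero ?kap0 //.
  by apply/funext => x; rewrite /hat_mu /hat_proj /= linear0.
- rewrite fmap_comp //; congr (fmap _ _); apply/funext => x /=.
  by apply/prodmod_ext => i; rewrite /hat_proj; case: eqP.
Qed.

Definition bpair := pairing (H := H) (@beta k A H P).

Let bD := @betaDl k A H P.
Let bZ := @betaZl k A H P.
Let bl := @beta_klin k A H P.
Let bact := @beta_act k A H P.

Lemma bpairDl v v' w : bpair (v + v') w = bpair v w + bpair v' w.
Proof. exact: pairingDl. Qed.
Lemma bpairDr v w w' : bpair v (w + w') = bpair v w + bpair v w'.
Proof. exact: pairingDr. Qed.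
Lemma bpair_pure p x w : bpair (fpure H p x) w = fmap (beta p) (lact x w).
Proof. exact: pairing_pure. Qed.

Lemma fmap_d_bpair v w : fmap (@bihat_d k A H P) (bpair v w) =
  bpair (fmap (@hat_d k A H P) v) w +
  bpair (fmap (@hat_eps k A H P) v) (fmap (@hat_d k A H P) w).
Proof.
have bdk := linear_klin (@bihat_d_linear k A H P).
apply: (@freebim_eq _ _ _ _ _ (fun v => fmap (@bihat_d k A H P) (bpair v w))
  (fun v => bpair (fmap (@hat_d k A H P) v) w +
    bpair (fmap (@hat_eps k A H P) v) (fmap (@hat_d k A H P) w))) => [v1 v2|v1 v2|p x].
- by rewrite bpairDl fmapD.
- by rewrite !fmapD // !bpairDl addrACA.
rewrite !fmap_pure // !bpair_pure -(fmap_lact (@hat_d_linear k A H P)).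
rewrite fmap_comp // fmap_comp // -fmap_addf //.
  by congr (fmap _ _); apply/funext => q; apply: bihat_d_beta.
by move=> c y z; rewrite /= dk bl.
Qed.

Section Slide.
Variables (m : nat) (f : P m -> triv H) (fl : linear f).
Let hfl := @hat_f_linear k A H P m f fl.

(** f (x) 1 turns the product of V(P) into the left action of values of f; this is why it sends U to
    a cup product. *)
Lemma fmap_l_bpair v w : fmap (@bihat_l k A H P m f) (bpair v w) = lact (kmap hfl v) w.
Proof.
have lk := linear_klin (bihat_l_linear fl).
apply: (@freebim_eq _ _ _ _ _ (fun v => fmap (bihat_l f) (bpair v w))
  (fun v => lact (kmap hfl v) w)) => [v1 v2|v1 v2|p x].
- by rewrite bpairDl fmapD.
- by rewrite linearD lactDl.
rewrite bpair_pure fmap_comp // (_ : _ \o _ = fun q => (hat_f f p : k)%:A *: q).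
  by rewrite fmap_scalar -lactM mulr_algl kmapE fmap_pure ?kap_pure //; apply: linear_klin.
by apply/funext => q; apply: bihat_l_beta.
Qed.

Lemma fmap_r_bpair v w : fmap (@bihat_r k A H P m f) (bpair v w) =
  ract (if odd m then fmap (@hat_eps k A H P) v else v) (kmap hfl w).
Proof.
have rk := linear_klin (bihat_r_linear fl).
apply: (@freebim_eq _ _ _ _ _ (fun v => fmap (bihat_r f) (bpair v w))
  (fun v => ract (if odd m then fmap (@hat_eps k A H P) v else v) (kmap hfl w)))
  => [v1 v2|v1 v2|p x].
- by rewrite bpairDl fmapD.
- by case: odd; rewrite ?fmapD // ractD.
rewrite bpair_pure fmap_comp //.
rewrite (_ : _ \o _ = fun q => (hat_f f q : k)%:A *: (if odd m then hat_eps p else p)).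
  rewrite (fmap_rank1 hfl) linear_lact bimod_lactE freebim_ract.
  by case: odd; rewrite ?fmap_pure // fract_pure.
by apply/funext => q; apply: bihat_r_beta.
Qed.
End Slide.
End BarResolution.

Lemma fmap_relation (k : fieldType) (A : algType k) (H : hopf A) (M N : lmodType A)
    (h1 h2 h3 h4 : M -> N) (e : bool) (v : freebim H M) :
  klin h1 -> klin h2 -> klin h3 -> klin h4 ->
  (forall x, h1 x - sg e (h2 x) = h3 x - h4 x) ->
  fmap h1 v - sg e (fmap h2 v) = fmap h3 v - fmap h4 v.
Proof.
move=> l1 l2 l3 l4 r.
have nk := klin_opp; have sk := klin_sg e l2.
rewrite -fmap_sg // -!fmap_oppf // -!fmap_addf //; try exact: nk.
by congr (fmap _ v); apply/funext => x; apply: r.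
Qed.

(** * The bracket of f iota and g iota *)

Section Comparison.
Variables (k : fieldType) (A : algType k) (H : hopf A) (P : resolution (triv H)).
Variables (Delta : forall n i j, {linear P n -> htens H (P i) (P j)})
  (Delta_diag : diagonal_map Delta).
Variables (iota : seq A -> freebim H (hat P)) (hiota : homogeneous_chain iota).

Let dX := fmapL H (@hat_d_linear k A H P).
Let muX := kmap (@hat_mu_linear k A H P).
Let dY := fmapL H (@bihat_d_linear k A H P).
Let muY := kmap (@bihat_mu_linear k A H P).
Let D := fmapL H (hat_Delta_linear Delta).

Let U := decon (fun u v => bpair (iota u) (iota v)).

Let iota_lin : multilinear iota. Proof. by case: hiota. Qed.
Let d_iota s : dX (iota s) = hoch_d iota s.
Proof. case: hiota => _ h _ _; exact: h. Qed.
Let mu_iota s : muX (iota s) = unit_cochain s.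
Proof. case: hiota => _ _ h _; exact: h. Qed.
Let proj_iota s : fmap (hat_proj (size s)) (iota s) = iota s.
Proof. case: hiota => _ _ _ h; exact: h. Qed.

Let klin_hat_d := linear_klin (@hat_d_linear k A H P).

(** Homogeneity of iota turns the operator [hat_eps] into the sign of the length of u in
    [hoch_d_decon]. *)
Lemma eps_iota s : fmap (@hat_eps k A H P) (iota s) = sg (odd (size s)) (iota s).
Proof.
rewrite -{1}proj_iota fmap_comp; [|exact/linear_klin/hat_proj_linear|exact/linear_klin/hat_eps_linear].
rewrite (_ : _ \o _ = fun x => sg (odd (size s)) (hat_proj (size s) x)); last first.
  by apply/funext => x; apply: hat_eps_proj.
by rewrite fmap_sg ?proj_iota //; apply/linear_klin/hat_proj_linear.
Qed.

Lemma hat_f_iota m (f : P m -> triv H) (fl : linear f) s : size s != m ->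
  kmap (hat_f_linear fl) (iota s) = 0.
Proof.
move=> sm; rewrite kmapE -proj_iota fmap_comp;
  [|exact/linear_klin/hat_proj_linear|exact/linear_klin/hat_f_linear].
rewrite (_ : _ \o _ = fun=> 0) ?fmap_zero ?kap0 //; apply/funext => x.
rewrite /hat_f /hat_proj /= eq_sym (negbTE sm).
exact: (klin0 (linear_klin fl)).
Qed.

Let bp_lact a (x y : freebim H (hat P)) : bpair (lact a x) y = lact a (bpair x y).
Proof.
by apply: pairing_lact; [exact: betaDl|exact: betaZl|exact: beta_klin|exact: beta_act].
Qed.
Let bp_ract a (x y : freebim H (hat P)) : bpair x (ract y a) = ract (bpair x y) a.
Proof. by apply: pairing_ract; [exact: betaDl|exact: betaZl|exact: beta_klin]. Qed.
Let bp_mid a (x y : freebim H (hat P)) : bpair (ract x a) y = bpair x (lact a y).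
Proof. by apply: pairing_mid; [exact: betaDl|exact: betaZl|exact: beta_klin]. Qed.

Lemma U_lin : multilinear U.
Proof.
exact: (multilinear_decon_prod (@bpairDl k A H P) (@bpairDr k A H P) bp_lact bp_ract).
Qed.

Lemma d_U s : dY (U s) = hoch_d U s.
Proof.
rewrite /U (hoch_d_decon (@bpairDl k A H P) (@bpairDr k A H P) bp_lact bp_ract bp_mid).
rewrite linear_decon; apply: eq_decon => u v _.
rewrite [LHS]fmap_d_bpair -[fmap _ (iota u)]/(dX (iota u)) -[fmap _ (iota v)]/(dX (iota v)).
rewrite !d_iota eps_iota; congr (_ + _).
case: odd => //=; apply: (addIr (bpair (iota u) (hoch_d iota v))).
by rewrite -bpairDl !addNr; apply: (addrI (bpair 0 (hoch_d iota v))); rewrite -bpairDl !addr0.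
Qed.

Lemma l_U m (f : P m -> triv H) (fl : linear f) s :
  fmapL H (bihat_l_linear fl) (U s) = cupl m (kmap (hat_f_linear fl) \o iota) iota s.
Proof.
rewrite /U linear_decon (@eq_decon _ _ _ _
  (fun u v => lact (kmap (hat_f_linear fl) (iota u)) (iota v))).
  by rewrite (@decon_size _ _ _ m) // => u v um; rewrite hat_f_iota // lact0.
by move=> u v _; apply: fmap_l_bpair.
Qed.

Lemma r_U m (f : P m -> triv H) (fl : linear f) s :
  fmapL H (bihat_r_linear fl) (U s) = cupr m (kmap (hat_f_linear fl) \o iota) iota s.
Proof.
rewrite /U linear_decon (@eq_decon _ _ _ _ (fun u v =>
   sg (odd m && odd (size u)) (ract (iota u) (kmap (hat_f_linear fl) (iota v))))).
  rewrite (@decon_sizer _ _ _ m); last by move=> u v vm; rewrite hat_f_iota // ractr0 sg0.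
  case: leqP => ms; last by rewrite cupr_small.
  by rewrite cuprS // size_takel // leq_subr.
move=> u v _; rewrite [LHS]fmap_r_bpair; case: odd => //.
by rewrite eps_iota sg_ract.
Qed.

Let raug_lin : linear (raug P). Proof. exact: linearP. Qed.
Let raug_cocycle : cocycle (raug P).
Proof. by move=> x; apply/rexact0; exists x. Qed.
Let L0 := fmapL H (bihat_l_linear raug_lin).
Let R0 := fmapL H (bihat_r_linear raug_lin).

Lemma l0_U s : L0 (U s) = iota s.
Proof.
rewrite /L0 l_U [LHS]/(lact (muX (iota (take 0 s))) (iota (drop 0 s))).
by rewrite take0 drop0 mu_iota; apply: lact1.
Qed.

Lemma r0_U s : R0 (U s) = iota s.
Proof.
rewrite /R0 r_U cuprS // [LHS]/(ract (iota (take (size s - 0) s)) (muX (iota (drop (size s - 0) s)))).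
by rewrite subn0 take_size drop_size mu_iota; apply: ract1.
Qed.

Lemma mu_U s : muY (U s) = unit_cochain s.
Proof.
rewrite -mu_iota -l0_U /muX /muY !kmapE fmap_comp //; last exact/linear_klin/hat_mu_linear.
exact/linear_klin/bihat_l_linear.
Qed.

Let kz := klin_zero.
Let kc := klin_comp.

Section Datum.
Variables (m : nat) (f : {linear P m -> triv H}) (f_cocycle : cocycle f).
Variables (psi : forall i j, {linear P i -> P j}) (psi_lift : homotopy_lifting Delta f psi).
Let fl : linear f := linearP f.
Let fk := linear_klin (hat_f_linear fl).
Let lk := linear_klin (bihat_l_linear fl).
Let rk := linear_klin (bihat_r_linear fl).
Let l0k := linear_klin (bihat_l_linear raug_lin).
Let r0k := linear_klin (bihat_r_linear raug_lin).
Let dYk := linear_klin (@bihat_d_linear k A H P).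
Let Dk := linear_klin (hat_Delta_linear Delta).
Let psik := linear_klin (hat_psi_linear m psi).
Let muk := linear_klin (@hat_mu_linear k A H P).

(** The homotopy lifting on P passes to V(P) by functoriality. The clauses linking f with L0 and R0
    are [slide_exchange] with the augmentation, whose degree 0 makes the sign trivial. *)
Lemma hat_datum : lifting_datum dX muX dY D iota U L0 R0 m (kmap (hat_f_linear fl))
  (fmapL H (bihat_l_linear fl)) (fmapL H (bihat_r_linear fl))
  (fmapL H (hat_psi_linear m psi)).
Proof.
split.
- move=> v; rewrite kmapE fmap_comp // (_ : _ \o _ = fun=> 0) ?fmap_zero ?kap0 //.
  by apply/funext => x; apply: hat_f_d.
- move=> v /=; rewrite !fmap_comp // -fmap_sg; last exact: kc.
  by congr (fmap _ v); apply/funext => y; apply: bihat_l_d.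
- move=> v /=; rewrite !fmap_comp // -fmap_sg; last exact: kc.
  by congr (fmap _ v); apply/funext => y; apply: bihat_r_d.
- exact: l_U.
- exact: r_U.
- move=> v; rewrite !kmapE !fmap_comp //; congr (kap (fmap _ v)).
  by apply/funext => y; have [e _] := slide_exchange y fl raug_lin; rewrite /= e andbF.
- move=> v; rewrite !kmapE !fmap_comp //; congr (kap (fmap _ v)).
  by apply/funext => y; have [_ e] := slide_exchange y fl raug_lin; rewrite /= e andbF.
- move=> v /=; rewrite !fmap_comp //; apply: fmap_relation; try exact: kc.
  by move=> x; apply: hat_psi_bdry => //; case: psi_lift.
have [psi0 [hf [psi0l [hfl [e1 e2 e3]]]]] := hat_lifting Delta_diag psi_lift.
have psi0k := linear_klin psi0l; have hfk := linear_klin hfl.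
exists (fmapL H psi0l), (kmap hfl); split=> v.
- have := @fmap_relation k A H _ _ (hat_d (P:=P) \o psi0) (psi0 \o hat_d (P:=P))
    (bihat_l (raug P) \o hat_Delta Delta) (bihat_r (raug P) \o hat_Delta Delta) true v.
  rewrite /= !fmap_comp // opprK; apply; try exact: kc.
  by move=> x; rewrite /= opprK.
- rewrite kmapE fmap_comp // (_ : _ \o _ = fun=> 0) ?fmap_zero ?kap0 //.
  exact/funext.
rewrite !kmapE !fmap_comp //.
have := @fmap_relation k A H _ _ (hat_mu (P:=P) \o hat_psi m psi) (hat_f f \o psi0)
    (hf \o hat_d (P:=P)) (fun=> 0) (~~ odd m) v.
rewrite fmap_zero subr0 => <-; try exact: kc; try exact: kz.
  rewrite [RHS](linearB (kapL H)); congr (_ - _); symmetry.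
  exact: (linear_sg (kapL H)).
by move=> x; rewrite subr0; apply: e3.
Qed.
End Datum.

Variables (m n : nat) (f : {linear P m -> triv H}) (g : {linear P n -> triv H}).
Hypotheses (f_cocycle : cocycle f) (g_cocycle : cocycle g).
Variables (psif psig : forall i j, {linear P i -> P j}).
Hypotheses (psif_lift : homotopy_lifting Delta f psif)
  (psig_lift : homotopy_lifting Delta g psig).

Definition hat_bracket (x : hat P) : triv H :=
  hat_f f (hat_psi n psig x) - sg (~~ odd m && ~~ odd n) (hat_f g (hat_psi m psif x)).

Lemma hat_bracket_linear : linear hat_bracket.
Proof.
move=> a x y; rewrite /hat_bracket.
have h1 := linearP f; have h2 := linearP g.
rewrite !(hat_psi_linear, hat_f_linear h1, hat_f_linear h2) sgD -sgZ scalerBr.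
by zmod.
Qed.

(** Apply g to the boundary formula of psi_f and f to that of psi_g. As f and g kill boundaries,
    only terms on P (x) P remain, and [slide_exchange] cancels them. *)
Lemma hat_bracket_d x : hat_bracket (hat_d x) = 0.
Proof.
have fl : linear f := linearP f; have gl : linear g := linearP g.
have fk := linear_klin (hat_f_linear fl); have gk := linear_klin (hat_f_linear gl).
have [degf bdf _] := psif_lift; have [degg bdg _] := psig_lift.
have := hat_psi_bdry x erefl degf bdf; move/(congr1 (hat_f g)).
have := hat_psi_bdry x erefl degg bdg; move/(congr1 (hat_f f)).
have [e1 _] := slide_exchange (hat_Delta Delta x) fl gl.
have [_ e2] := slide_exchange (hat_Delta Delta x) fl gl.
have sgk (h : hat P -> triv H) (e : bool) y : klin h -> h (sg e y) = sg e (h y).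
  by case: e => // hk; apply: klinN.
rewrite !(klinB fk, klinB gk) !sgk // !hat_f_d // !sub0r e1 e2 /hat_bracket.
move: (hat_f f (hat_psi _ _ _)) (hat_f g (hat_psi _ _ _)) => b c.
move: (hat_f g (bihat_r _ _)) (hat_f g (bihat_l _ _)) => r l eb ec.
have -> : b = sg (~~ odd n) (sg (odd m && odd n) l - sg (odd m && odd n) r).
  by rewrite -opprB -eb opprK sgK.
have -> : c = sg (~~ odd m) (r - l) by rewrite -opprB -ec opprK sgK.
by case: (odd m) (odd n) => [] []; rewrite /sg /=; zmod.
Qed.

Lemma hat_comparison : exists2 h : seq A -> bimod A, multilinear h & forall s,
  kap (fmap hat_bracket (iota s)) -
  bracket m n (kmap (hat_f_linear (linearP f)) \o iota)
    (kmap (hat_f_linear (linearP g)) \o iota) s = hoch_d h s.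
Proof.
have [etaX [tX hX]] := @hat_contraction k A H P.
have [etaY [tY hY]] := @bihat_contraction k A H P.
pose fl : linear f := linearP f; pose gl : linear g := linearP g.
have fk := linear_klin (hat_f_linear fl); have gk := linear_klin (hat_f_linear gl).
have muk := linear_klin (@hat_mu_linear k A H P).
have Dk := linear_klin (hat_Delta_linear Delta).
have dYk := linear_klin (@bihat_d_linear k A H P).
have muYk := linear_klin (@bihat_mu_linear k A H P).
have l0k := linear_klin (bihat_l_linear raug_lin).
have r0k := linear_klin (bihat_r_linear raug_lin).
have D_d x : dY (D x) = D (dX x).
  rewrite /dY /D /dX /= !fmap_comp //; congr (fmap _ x).
  by apply/funext => y; apply: hat_Delta_d.
have D_mu x : muY (D x) = muX x.
  rewrite /muY /D /muX /= ?kmapE fmap_comp //; congr (kap (fmap _ x)).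
  by apply/funext => y; apply: hat_Delta_mu.
have dL0 y : dX (L0 y) = L0 (dY y).
  rewrite /= !fmap_comp //; congr (fmap _ y).
  by apply/funext => z; have := bihat_l_d raug_lin raug_cocycle z.
have dR0 y : dX (R0 y) = R0 (dY y).
  rewrite /= !fmap_comp //; congr (fmap _ y).
  by apply/funext => z; have := bihat_r_d raug_lin raug_cocycle z.
have muL0 y : muX (L0 y) = muX (R0 y).
  rewrite !kmapE !fmap_comp //; congr (kap (fmap _ y)).
  by apply/funext => z; have [e _] := slide_exchange z raug_lin raug_lin.
have LR s : L0 (U s) = R0 (U s) by rewrite l0_U r0_U.
have Df := hat_datum f_cocycle psif_lift; have Dg := hat_datum g_cocycle psig_lift.
have exch (e : bool) (h1 h2 : bihat P -> triv H) y : klin h1 -> klin h2 ->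
    (forall z, h1 z = sg e (h2 z)) -> kap (fmap h1 y) = sg e (kap (fmap h2 y)).
  move=> k1 k2 e12; rewrite (_ : h1 = fun z => sg e (h2 z)); last exact/funext.
  by rewrite fmap_sg //; apply: (linear_sg (kapL H)).
have fLg y : kmap (hat_f_linear fl) (fmapL H (bihat_l_linear gl) y) =
    sg (odd m && odd n) (kmap (hat_f_linear gl) (fmapL H (bihat_r_linear fl) y)).
  have lk := linear_klin (bihat_l_linear gl); have rk := linear_klin (bihat_r_linear fl).
  rewrite !kmapE !fmap_comp //; apply: exch; try exact: kc.
  by move=> z; have [e _] := slide_exchange z fl gl.
have fRg y : kmap (hat_f_linear fl) (fmapL H (bihat_r_linear gl) y) =
    sg (odd m && odd n) (kmap (hat_f_linear gl) (fmapL H (bihat_l_linear fl) y)).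
  have lk := linear_klin (bihat_l_linear fl); have rk := linear_klin (bihat_r_linear gl).
  rewrite !kmapE !fmap_comp //; apply: exch; try exact: kc.
  by move=> z; have [_ e] := slide_exchange z fl gl.
have hX' : contraction dX muX etaX tX := hX.
have hY' : contraction dY muY etaY tY := hY.
have c1 := @circle_comparison k A _ _ dX muX etaX tX hX' dY muY etaY tY hY' D D_d D_mu
  iota U iota_lin U_lin d_iota mu_iota.
have c2 := c1 d_U mu_U L0 R0 dL0 dR0 muL0 LR.
have c3 := c2 _ _ _ _ _ _ _ _ _ _ Df Dg.
have [h hl hE] := c3 fLg fRg.
exists h => // s; rewrite -hE; congr (_ - _); rewrite !kmapE.
have pf := linear_klin (hat_psi_linear m psif); have pg := linear_klin (hat_psi_linear n psig).
rewrite /= !fmap_comp // /hat_bracket.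
have ck : klin (hat_f g \o hat_psi m psif) by apply: kc.
have bk : klin (hat_f f \o hat_psi n psig) by apply: kc.
have sk := klin_sg (~~ odd m && ~~ odd n) ck; have nk := klin_opp sk.
have := fmap_addf (iota s) bk nk; rewrite (fmap_oppf _ sk) (fmap_sg _ _ ck) /= => ->.
rewrite kapD; congr (_ + _).
by rewrite -(linear_sg (kapL H)); apply: (linearN (kapL H)).
Qed.

End Comparison.

(** * Hochschild cochains attached to an extension *)

Section ComponentInjection.
Variables (R : pzRingType) (I : eqType) (M : I -> lmodType R).

Definition prod_inj n (x : M n) : prodmod M := fun i =>
  if n =P i is ReflectT e then eq_rect n (fun i => M i : Type) x i e else 0.

Lemma prod_injK n (x : M n) : prod_inj x n = x.
Proof. by rewrite /prod_inj; case: eqP => // e; rewrite (eq_axiomK e). Qed.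

Lemma prod_inj_neq n i (x : M n) : n != i -> prod_inj x i = 0.
Proof. by rewrite /prod_inj; case: eqP. Qed.

Lemma prod_inj_linear n : linear (@prod_inj n).
Proof.
move=> a x y; apply/prodmod_ext => i; rewrite prodmodD prodmodZ.
have [<-|ni] := eqVneq n i; first by rewrite !prod_injK.
by rewrite !prod_inj_neq // scaler0 addr0.
Qed.
End ComponentInjection.

Section Components.
Variables (k : fieldType) (A : algType k) (H : hopf A) (P : resolution (triv H)).

Lemma hat_d_inj n (x : P n.+1) : hat_d (prod_inj x : hat P) = prod_inj (rd P n x).
Proof.
apply/prodmod_ext => i; rewrite /hat_d.
have [<-|ni] := eqVneq n i; first by rewrite !prod_injK.
by rewrite !prod_inj_neq // linear0.
Qed.

Lemma hat_d_inj0 (x : P 0%N) : hat_d (prod_inj x : hat P) = 0.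
Proof. by apply/prodmod_ext => i; rewrite /hat_d prod_inj_neq // linear0. Qed.
End Components.

Section Embedding.
Variables (k : fieldType) (A : algType k) (H : hopf A) (P : resolution (triv H)).
Variables (iota : seq A -> freebim H (hat P)) (hiota : homogeneous_chain iota).
Variables (n : nat) (f : P n -> triv H).

(** The comparison map is iota followed by the chain map theta from P to E. *)
Lemma represents_embeds E : represents f E -> exists F, hoch_represents F E.
Proof.
case=> theta [td taug tend]; have [il di mui _] := hiota.
pose c i (x : hat P) : E i := theta i (x i).
have cl i : linear (c i) by move=> a x y; apply: linearP.
have ck i := linear_klin (cl i).
pose phi i s := fmap (c i) (iota s).
exists (fun s => kap (fmap (ext_end E) (phi n s))); apply/hoch_representsP.
exists phi; split=> //.
- move=> i; apply: multilinear_hoch.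
  exact: (multilinear_comp (linear_klinear (fmapL H (cl i))) il).
- have rk : klin (raug E) by apply/linear_klin/linearP.
  rewrite fmap_comp // (_ : _ \o _ = @hat_mu k A H P); first exact: mui.
  by apply/funext => x; apply: taug.
- move=> i s _; have rk : klin (rd E i) by apply/linear_klin/linearP.
  rewrite fmap_comp // (_ : _ \o _ = c i \o @hat_d k A H P); last first.
    by apply/funext => x; rewrite /= /c td.
  by rewrite -fmap_comp ?di ?fmap_hoch_d //; apply/linear_klin/hat_d_linear.
Qed.

(** The comparison map phi of the extension and theta iota are chain maps over the identity of A
    into V(E), which is contractible, so a homotopy w connects them; [ext_end] turns w into the
    primitive h. In particular F depends on the choices of E and phi only up to a coboundary. *)
Lemma embeds_cohomologous F : embeds_to f F ->
  exists h : seq A -> bimod A, [/\ multilinear h, primitive_degree n h,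
    forall s, size s = n -> F s = kap (fmap (hat_f f) (iota s)) + hoch_d h s
  & forall s, size s != n -> hoch_d h s = 0].
Proof.
case=> E [theta [td taug tend]] /hoch_representsP[phi [phil phiaug phid phiend]].
have [il di mui _] := hiota.
have [eta [t hE]] := @hat_contraction k A H E.
pose Theta (x : hat P) : hat E := fun i => theta i (x i).
have Tl : linear Theta by move=> a x y; apply/prodmod_ext => i; apply: linearP.
have Tk := linear_klin Tl.
pose inj i : E i -> hat E := @prod_inj _ _ E i.
have injl i : linear (inj i) by apply: prod_inj_linear.
have injk i := linear_klin (injl i).
have dk := linear_klin (@hat_d_linear k A H E).
have dPk := linear_klin (@hat_d_linear k A H P).
have muk := linear_klin (@hat_mu_linear k A H E).
have rk i : klin (rd E i) by apply/linear_klin/linearP.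
(* phi i is a cochain in length i; used on that length only, the phi i combine into one multilinear
   function. *)
pose Phi s := fmap (inj (size s)) (phi (size s) s).
have Phil : multilinear Phi.
  move=> u v c a b; rewrite /Phi.
  have -> : size (u ++ (c *: a + b) :: v) = (size u + size v).+1 by rewrite size_cat addnS.
  have -> : size (u ++ a :: v) = (size u + size v).+1 by rewrite size_cat addnS.
  have -> : size (u ++ b :: v) = (size u + size v).+1 by rewrite size_cat addnS.
  by rewrite phil // fmapD // fmap_scal.
have Phid s : fmap (@hat_d k A H E) (Phi s) = hoch_d Phi s.
  case: s => [|a s]; rewrite /Phi fmap_comp //.
    rewrite (_ : _ \o _ = fun=> 0); last by apply/funext => x; apply: hat_d_inj0.
    by rewrite fmap_zero hoch_dE /= subr0 addr0.
  rewrite (_ : _ \o _ = inj (size s) \o rd E (size s)); last first.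
    by apply/funext => x; apply: hat_d_inj.
  rewrite -[LHS]fmap_comp; [|exact: rk|exact: injk].
  apply: etrans (congr1 _ (phid (size s) (a :: s) erefl)) _.
  rewrite fmap_hoch_d; last exact: injl.
  by apply: eq_hoch_d => u [->].
have Phimu s : kap (fmap (@hat_mu k A H E) (Phi s)) = unit_cochain s.
  rewrite /Phi fmap_comp //; case: s => [|a s].
    rewrite (_ : _ \o _ = raug E) //.
    by apply/funext => x; rewrite /= /hat_mu /inj prod_injK.
  rewrite (_ : _ \o _ = fun=> 0) ?fmap_zero ?kap0 //.
  by apply/funext => x; rewrite /= /hat_mu /inj prod_inj_neq // linear0.
have [||s|s|w [wl _ wE]] := @lifting_exists _ _ _ (fmapL H (@hat_d_linear k A H E))
    (kmap (@hat_mu_linear k A H E)) _ _ hE false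
    (fun s => Phi s - fmap Theta (iota s)) (fun=> 0).
- apply: (multilinear_sub Phil).
  exact: (multilinear_comp (linear_klinear (fmapL H Tl)) il).
- by move=> s u c a b; rewrite lact0r addr0.
- rewrite (linearB (fmapL H (@hat_d_linear k A H E))) hoch_dB /=; congr (_ - _).
    exact: Phid.
  rewrite -(fmap_hoch_d Tl) -di !fmap_comp //; congr (fmap _ _).
  by apply/funext => x; apply/prodmod_ext => i; apply/esym/td.
- rewrite (linearB (kmap (@hat_mu_linear k A H E))) hoch_d0.
  have e : kap (fmap (@hat_mu k A H E) (fmap Theta (iota s))) = unit_cochain s.
    by rewrite fmap_comp // -mui; congr (kap (fmap _ _)); apply/funext => x; apply: taug.
  by rewrite kmapE Phimu kmapE e subrr.
have el : linear (ext_end E) := linearP (ext_end E).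
have ek := linear_klin (hat_f_linear el).
pose h := kmap (hat_f_linear el) \o w.
have hl : multilinear h by apply: (multilinear_comp (linear_klinear _) wl).
have hE' s : size s = n -> F s = kap (fmap (hat_f f) (iota s)) + hoch_d h s.
  move=> es; have := congr1 (kmap (hat_f_linear el)) (wE s).
  rewrite (linearD (kmap (hat_f_linear el))) (linearB (kmap (hat_f_linear el))).
  have -> : kmap (hat_f_linear el) (fmapL H (@hat_d_linear k A H E) (w s)) = 0.
    rewrite kmapE [fmapL _ _ _]/= fmap_comp // (_ : _ \o _ = fun=> 0) ?fmap_zero ?kap0 //.
    apply/funext => x; apply: (@hat_f_d _ _ _ E) => y.
    (* E vanishes in degree n + 1, so [ext_end] is a cocycle on E. *)
    by rewrite (ext_bound (ltnSn n) y) !linear0.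
  rewrite [sg _ _]/= linear_hoch_d add0r -/h => ->.
  rewrite phiend // !kmapE fmap_comp //.
  have -> : fmap (hat_f (ext_end E)) (Phi s) = fmap (ext_end E) (phi n s).
    rewrite /Phi es fmap_comp //; congr (fmap _ _).
    by apply/funext => x; rewrite /= /hat_f /inj prod_injK.
  have -> : hat_f (ext_end E) \o Theta = hat_f f by apply/funext => x; apply: tend.
  by rewrite addrC subrK.
(* Cutting h down to degree n - 1 keeps its differential in length n and makes it vanish in the
   others; for n = 0 nothing is left. *)
exists (fun s => if (size s).+1 == n then h s else 0); split.
- move=> s u c a b; rewrite !size_cat /= !addnS; case: eqP => _; first exact: hl.
  by rewrite lact0r addr0.
- case: n => [|q]; last by left; exists q.
  by right; apply/funext => s.
- move=> s es; rewrite hE' //; congr (_ + _).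
  by apply: eq_hoch_d => u; rewrite es => ->; rewrite eqxx.
move=> s ns; rewrite -[RHS](hoch_d0 _ s); apply: eq_hoch_d => u us.
by rewrite us (negbTE ns).
Qed.
End Embedding.

(** * Extensions representing a cocycle *)

Local Open Scope quotient_scope.

Record submodule (R : pzRingType) (V : lmodType R) := Submodule {
  submod_pred :> V -> Prop;
  submod0 : submod_pred 0;
  submod_lin : forall a x y, submod_pred x -> submod_pred y ->
    submod_pred (a *: x + y) }.

Section Quotient.
Variables (R : pzRingType) (V : lmodType R) (K : submodule V).

Let KN x : K x -> K (- x).
Proof. by move=> kx; rewrite -scaleN1r -[_ *: _]addr0; apply/submod_lin/submod0. Qed.
Let KD x y : K x -> K y -> K (x + y).
Proof. by move=> kx ky; rewrite -[x]scale1r; apply: submod_lin. Qed.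

Definition quo_rel (x y : V) : bool := `[< K (x - y) >].

Lemma quo_rel_refl : reflexive quo_rel.
Proof. by move=> x; apply/asboolP; rewrite subrr; apply: submod0. Qed.
Lemma quo_rel_sym : symmetric quo_rel.
Proof. by move=> x y; apply/asboolP/asboolP => /KN; rewrite opprB. Qed.
Lemma quo_rel_trans : transitive quo_rel.
Proof.
move=> y x z /asboolP kxy /asboolP kyz; apply/asboolP.
by rewrite -[x](subrK y) -addrA; apply: KD.
Qed.
Canonical quo_equiv := EquivRel quo_rel quo_rel_refl quo_rel_sym quo_rel_trans.

Definition quo := {eq_quot quo_equiv}.
HB.instance Definition _ := Choice.on quo.

Definition quo_pi (x : V) : quo := \pi_{eq_quot quo_equiv} x.
Definition quo_repr (x : quo) : V := repr (x : {eq_quot quo_equiv}).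

Lemma quo_reprK x : quo_pi (quo_repr x) = x.
Proof. exact: reprK. Qed.

Lemma quo_piE x y : quo_pi x = quo_pi y <-> K (x - y).
Proof. by split=> [/eqmodP/asboolP//|kxy]; apply/eqmodP/asboolP. Qed.

Lemma quo_piK x : K (quo_repr (quo_pi x) - x).
Proof. by apply/quo_piE; rewrite quo_reprK. Qed.

Definition quo_add (x y : quo) : quo := quo_pi (quo_repr x + quo_repr y).
Definition quo_opp (x : quo) : quo := quo_pi (- quo_repr x).
Definition quo_scale (a : R) (x : quo) : quo := quo_pi (a *: quo_repr x).

Lemma quo_piD x y : quo_add (quo_pi x) (quo_pi y) = quo_pi (x + y).
Proof. by apply/quo_piE; rewrite opprD addrACA; apply: KD; apply: quo_piK. Qed.
Lemma quo_piN x : quo_opp (quo_pi x) = quo_pi (- x).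
Proof. by apply/quo_piE; rewrite -opprD; apply/KN/quo_piK. Qed.
Lemma quo_piZ a x : quo_scale a (quo_pi x) = quo_pi (a *: x).
Proof.
apply/quo_piE; rewrite -scalerBr -[_ *: _]addr0.
by apply: submod_lin (submod0 _); apply: quo_piK.
Qed.

Lemma quoW (Q : quo -> Prop) : (forall x, Q (quo_pi x)) -> forall x, Q x.
Proof. by move=> Qpi x; rewrite -[x]quo_reprK. Qed.

Lemma quo_addA : associative quo_add.
Proof.
by elim/quoW=> x; elim/quoW=> y; elim/quoW=> z; rewrite !quo_piD addrA.
Qed.
Lemma quo_addC : commutative quo_add.
Proof. by elim/quoW=> x; elim/quoW=> y; rewrite !quo_piD addrC. Qed.
Lemma quo_add0 : left_id (quo_pi 0) quo_add.
Proof. by elim/quoW=> x; rewrite quo_piD add0r. Qed.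
Lemma quo_addN : left_inverse (quo_pi 0) quo_opp quo_add.
Proof. by elim/quoW=> x; rewrite quo_piN quo_piD addNr. Qed.
HB.instance Definition _ :=
  GRing.isZmodule.Build quo quo_addA quo_addC quo_add0 quo_addN.

Lemma quo_scaleA a b x : quo_scale a (quo_scale b x) = quo_scale (a * b) x.
Proof. by elim/quoW: x => x; rewrite !quo_piZ scalerA. Qed.
Lemma quo_scale1 : left_id 1 quo_scale.
Proof. by elim/quoW=> x; rewrite quo_piZ scale1r. Qed.
Lemma quo_scaleDr : right_distributive quo_scale +%R.
Proof.
move=> a; elim/quoW=> x; elim/quoW=> y.
by rewrite [_ + _]quo_piD !quo_piZ [RHS]quo_piD scalerDr.
Qed.
Lemma quo_scaleDl x : {morph quo_scale^~ x : a b / a + b}.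
Proof.
by move=> a b; elim/quoW: x => x; rewrite !quo_piZ [RHS]quo_piD scalerDl.
Qed.
HB.instance Definition _ := GRing.Zmodule_isLmodule.Build R quo
  quo_scaleA quo_scale1 quo_scaleDr quo_scaleDl.

Lemma quo_pi_linear : linear quo_pi.
Proof. by move=> a x y; rewrite [a *: quo_pi x]quo_piZ [RHS]quo_piD. Qed.

Lemma quo_pi0 x : quo_pi x = 0 <-> K x.
Proof. by rewrite -[x in K x]subr0; apply: quo_piE. Qed.

Definition quo_lift (W : Type) (h : V -> W) (x : quo) : W := h (quo_repr x).

Section Lift.
Variables (W : lmodType R) (h : V -> W) (hl : linear h) (h0 : forall x, K x -> h x = 0).

Lemma quo_lift_pi x : quo_lift h (quo_pi x) = h x.
Proof.
apply/eqP; rewrite -subr_eq0 -(linearB (mkLinear hl)) /=; apply/eqP/h0/quo_piK.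
Qed.

Lemma quo_lift_linear : linear (quo_lift h).
Proof.
move=> a; elim/quoW=> x; elim/quoW=> y.
by rewrite -quo_pi_linear !quo_lift_pi hl.
Qed.
End Lift.
End Quotient.

Section QuotientComplex.
Variables (R : pzRingType) (M : lmodType R) (T : nat -> lmodType R).
Variables (D : forall i, {linear T i.+1 -> T i}) (aug : {linear T 0%N -> M}).
Variables (K : forall i, submodule (T i)).
Hypotheses (DK : forall i x, K i.+1 x -> K i (D i x))
  (augK : forall x, K 0%N x -> aug x = 0)
  (DD : forall i x, K i (D i (D i.+1 x))) (augD : forall x, aug (D 0%N x) = 0)
  (aug_surj : forall y, exists x, aug x = y)
  (exact0 : forall x, aug x = 0 -> exists y, K 0%N (D 0%N y - x))
  (exactS : forall i x, K i (D i x) -> exists y, K i.+1 (D i.+1 y - x)).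

Let dl i : linear (@quo_pi R _ (K i) \o D i).
Proof. by move=> a x y; rewrite /= linearP quo_pi_linear. Qed.
Let d0 i x : K i.+1 x -> (@quo_pi R _ (K i) \o D i) x = 0.
Proof. by move=> kx; apply/quo_pi0/DK. Qed.
Let augl : linear aug := linearP aug.

Definition quo_d i : {linear quo (K i.+1) -> quo (K i)} :=
  mkLinear (quo_lift_linear (@dl i) (@d0 i)).
Definition quo_aug : {linear quo (K 0%N) -> M} :=
  mkLinear (quo_lift_linear augl augK).

Lemma quo_d_pi i x : quo_d i (quo_pi _ x) = quo_pi _ (D i x).
Proof. exact: (quo_lift_pi (@dl i) (@d0 i)). Qed.
Lemma quo_aug_pi x : quo_aug (quo_pi _ x) = aug x.
Proof. exact: (quo_lift_pi augl augK). Qed.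

Lemma quo_aug_surj y : exists x, quo_aug x = y.
Proof.
by have [x <-] := aug_surj y; exists (quo_pi _ x); apply: quo_aug_pi.
Qed.

Lemma quo_exact0 x : quo_aug x = 0 <-> exists y, quo_d 0%N y = x.
Proof.
elim/quoW: x => x; rewrite quo_aug_pi; split=> [/exact0[y kxy]|[y]].
  by exists (quo_pi _ y); rewrite quo_d_pi; apply/quo_piE.
elim/quoW: y => y; rewrite quo_d_pi => /quo_piE/augK.
by rewrite linearB augD sub0r => /eqP; rewrite oppr_eq0 => /eqP.
Qed.

Lemma quo_exact i x : quo_d i x = 0 <-> exists y, quo_d i.+1 y = x.
Proof.
split=> [|[y <-]]; last first.
  by elim/quoW: y => y; rewrite !quo_d_pi; apply/quo_pi0/DD.
elim/quoW: x => x; rewrite quo_d_pi => /quo_pi0/exactS[y kxy].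
by exists (quo_pi _ y); rewrite quo_d_pi; apply/quo_piE.
Qed.

(** A resolution by quotients T_i / K_i, with exactness stated for representatives. It serves for
    both kinds of extension below. *)
Definition quo_resolution : resolution M :=
  @Resolution R M (fun i => quo (K i) : lmodType R) quo_d quo_aug
    quo_aug_surj quo_exact0 quo_exact.
End QuotientComplex.

Section Extension.
Variables (R : pzRingType) (M N : lmodType R) (P : resolution M).

Let dd i x : rd P i (rd P i.+1 x) = 0.
Proof. by apply/rexact; exists x. Qed.
Let augd x : raug P (rd P 0%N x) = 0.
Proof. by apply/rexact0; exists x. Qed.

Section Zero.
Variables (f : {linear P 0%N -> N}) (f_cocycle : cocycle f).

(** The quotient has P_0 / d P_1, isomorphic to M, in degree 0 and nothing above: a 0-extension, to
    which f descends because it is a cocycle. *)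
Definition trunc0_pred i : P i -> Prop :=
  match i with 0%N => fun x => exists y, rd P 0%N y = x | _ => fun=> True end.

Lemma trunc0_0 i : @trunc0_pred i 0.
Proof. by case: i => //=; exists 0; rewrite linear0. Qed.
Lemma trunc0_lin i a x y :
  @trunc0_pred i x -> @trunc0_pred i y -> @trunc0_pred i (a *: x + y).
Proof.
by case: i x y => //= x y [x' <-] [y' <-]; exists (a *: x' + y'); rewrite linearP.
Qed.
Definition trunc0 i : submodule (P i) := Submodule (trunc0_0 i) (@trunc0_lin i).

Lemma extension_exists0 : exists E : extension 0 M N, represents f E.
Proof.
have fl : linear f := linearP f.
have f0 x : trunc0 0 x -> f x = 0 by case=> y <-.
have DK i x : trunc0 i.+1 x -> trunc0 i (rd P i x) by case: i x => // x _; exists x.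
have augK x : trunc0 0 x -> raug P x = 0 by case=> y <-.
have DD i x : trunc0 i (rd P i (rd P i.+1 x)) by rewrite dd; apply: submod0.
have exact0 x : raug P x = 0 -> exists y, trunc0 0 (rd P 0%N y - x).
  by move/rexact0 => [y <-]; exists y; rewrite subrr; apply: submod0.
have exactS i x : trunc0 i (rd P i x) -> exists y, trunc0 i.+1 (rd P i.+1 y - x).
  by exists 0.
pose E := quo_resolution DK augK DD augd (@raug_surj _ _ P) exact0 exactS.
have bound j : (0 < j)%N -> forall x : E j, x = 0.
  by case: j => // j _; elim/quoW=> x; apply/quo_pi0.
exists (@Extension R 0 M N E bound (mkLinear (quo_lift_linear fl f0))
  (fun z => False_ind _ (notF z))).
exists (fun i => mkLinear (@quo_pi_linear R (P i) (trunc0 i))); split=> [i x|x|x].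
- by rewrite [RHS]quo_d_pi.
- exact: quo_aug_pi.
- exact: (quo_lift_pi fl f0).
Qed.
End Zero.

Section Positive.
Variables (p : nat) (f : {linear P p.+1 -> N}) (f_cocycle : cocycle f).

(* f in degree p + 1 and 0 in the other degrees.                              *)
Let F i (x : P i) : N := f (@prod_inj _ _ P i x p.+1).

Let F_linear i : linear (@F i).
Proof.
move=> a x y; rewrite /F -linearP; congr (f _).
by rewrite (@prod_inj_linear _ _ P).
Qed.
Let F0 i : F (0 : P i) = 0.
Proof. exact: (linear0 (mkLinear (@F_linear i))). Qed.
Let FN i (x : P i) : F (- x) = - F x.
Proof. exact: (linearN (mkLinear (@F_linear i))). Qed.
Let F_f x : F x = f x. Proof. by rewrite /F prod_injK. Qed.
Let F_neq i (x : P i) : i != p.+1 -> F x = 0.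
Proof. by move=> ip; rewrite /F prod_inj_neq // linear0. Qed.
Let F_d i (x : P i.+1) : F (rd P i x) = 0.
Proof.
have [ip|/F_neq//] := eqVneq i p.+1.
by subst i; rewrite F_f f_cocycle.
Qed.

(* The components of E_p are P_p (+) N modulo the relations (d y, - f y): the *)
(* pushout of d and f.                                                        *)
Definition pushout_pred i (z : P i * N) : Prop :=
  if (i < p)%N then z.1 = 0 else
  if i == p then exists y, z = (rd P i y, - F y) else
  if i == p.+1 then z.2 = 0 else True.

Let pred_lt i (z : P i * N) : (i < p)%N -> pushout_pred z <-> z.1 = 0.
Proof. by rewrite /pushout_pred => ->. Qed.
Let pred_eq i (z : P i * N) : i = p ->
  pushout_pred z <-> exists y, z = (rd P i y, - F y).
Proof. by move=> e; subst i; rewrite /pushout_pred ltnn eqxx. Qed.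
Let pred_S i (z : P i * N) : i = p.+1 -> pushout_pred z <-> z.2 = 0.
Proof. by move=> e; subst i; rewrite /pushout_pred ltnNge leqnSn gtn_eqF ?eqxx. Qed.
Let pred_gt i (z : P i * N) : (p.+1 < i)%N -> pushout_pred z.
Proof.
move=> pi; rewrite /pushout_pred ltnNge (ltnW (ltnW pi)) /= gtn_eqF ?(ltnW pi) //.
by rewrite gtn_eqF.
Qed.

Let cases i : [\/ (i < p)%N, i = p, i = p.+1 | (p.+1 < i)%N].
Proof.
case: (ltngtP i p) => [?|ip|?]; [by constructor 1| |by constructor 2].
by case: (ltngtP i p.+1) ip => // ?; [constructor 4|constructor 3].
Qed.

Lemma pushout_0 i : pushout_pred (0 : P i * N).
Proof.
case: (ltngtP i p) => [ip|ip|ip]; first exact/pred_lt.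
  move: ip; rewrite leq_eqVlt => /predU1P[ip|]; last exact: pred_gt.
  exact/pred_S.
by apply/pred_eq => //; exists 0; rewrite linear0 F0 oppr0.
Qed.
Lemma pushout_lin i a (z w : P i * N) :
  pushout_pred z -> pushout_pred w -> pushout_pred (a *: z + w).
Proof.
case: (ltngtP i p) => [ip|ip|ip].
- move=> /(pred_lt _ ip) z0 /(pred_lt _ ip) w0; apply/pred_lt => //=.
  by rewrite z0 w0 scaler0 addr0.
- move: ip; rewrite leq_eqVlt => /predU1P[ip|ip _ _]; last exact: pred_gt.
  move=> /(pred_S _ (esym ip)) z0 /(pred_S _ (esym ip)) w0; apply/pred_S => //=.
  by rewrite z0 w0 scaler0 addr0.
move=> /(pred_eq _ ip)[y ->] /(pred_eq _ ip)[y' ->]; apply/pred_eq => //.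
exists (a *: y + y'); rewrite linearP F_linear opprD -scalerN.
by [].
Qed.
Definition pushout i : submodule (P i * N)%type :=
  Submodule (pushout_0 i) (@pushout_lin i).

(** Every term is a quotient of P_i (+) N: it is P_i below p, the pushout at p, N at p + 1 and 0
    above. The differential is that of P below p and the inclusion of N into the pushout at p. *)
Definition pushout_d_fun i (z : P i.+1 * N) : P i * N :=
  (if (i < p)%N then rd P i z.1 else 0, if i == p then z.2 else 0).
Lemma pushout_d_linear i : linear (@pushout_d_fun i).
Proof.
move=> a z w; rewrite /pushout_d_fun; congr (_, _) => /=.
  by case: ifP => _; rewrite ?linearP // scaler0 addr0.
by case: ifP => _ //; rewrite scaler0 addr0.
Qed.
Definition pushout_d i := mkLinear (@pushout_d_linear i).

Lemma pushout_aug_linear : linear (fun z : P 0%N * N => raug P z.1).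
Proof. by move=> a z w; apply: linearP. Qed.
Definition pushout_aug := mkLinear pushout_aug_linear.

Lemma pushout_end_linear : linear (fun z : P p.+1 * N => z.2).
Proof. by []. Qed.

Lemma extension_existsS : exists E : extension p.+1 M N, represents f E.
Proof.
have step i (x : P i) c y : (i <= p)%N -> rd P i y = x ->
    exists w, pushout i (pushout_d i w - (x, c)).
  move=> ip <-; case: (ltngtP i p) ip => // [ip|ip] _.
    by exists (y, 0); apply/pred_lt; rewrite //= ip subrr.
  (* Modulo the relation (d y, - f y), the element (d y, c) equals (0, c + f y), which comes from
     N. *)
  subst i; exists (0, c + F y); apply/pred_eq => //; exists (- y).
  rewrite linearN FN opprK [LHS]surjective_pairing /= ltnn eqxx; congr (_, _); first exact: add0r.
  by rewrite addrC addKr.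
have DK i z : pushout i.+1 z -> pushout i (pushout_d i z).
  case: (cases i) => [ip|ip|ip|ip].
  - move=> zK; apply/pred_lt; rewrite //= ip; move: ip.
    rewrite leq_eqVlt => /predU1P[ip|ip]; last by move/(pred_lt _ ip): zK => ->; rewrite linear0.
    by move/(pred_eq _ ip): zK => [y ->]; rewrite dd.
  - subst i => /pred_S z0; apply/pred_eq => //; exists 0.
    by rewrite linear0 F0 oppr0 [LHS]surjective_pairing /= z0 // ltnn if_same.
  - by subst i => _; apply/pred_S => //=; rewrite gtn_eqF.
  - by move=> _; apply: pred_gt.
have DD i z : pushout i (pushout_d i (pushout_d i.+1 z)).
  rewrite (_ : pushout_d i _ = 0); first exact: submod0.
  rewrite [LHS]surjective_pairing /=; congr (_, _).
    by case: ifP => // _; case: ifP => _; rewrite ?dd ?linear0.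
  case: eqP => // ip; case: eqP => // ip'; move: (ltnSn i).
  by rewrite {1}ip -ip' ltnn.
have augK z : pushout 0 z -> pushout_aug z = 0.
  case: (cases 0%N) => [ip|ip|//|//].
    by move/(pred_lt _ ip) => /= ->; rewrite linear0.
  by move/(pred_eq _ ip) => [y ->]; apply: augd.
have augD z : pushout_aug (pushout_d 0 z) = 0.
  by rewrite /=; case: ifP => _; rewrite ?augd ?linear0.
have aug_surj y : exists z, pushout_aug z = y.
  by have [x <-] := raug_surj P y; exists (x, 0).
have exact0 z : pushout_aug z = 0 -> exists w, pushout 0 (pushout_d 0 w - z).
  by case: z => x c /rexact0[y]; apply: step.
have exactS i z : pushout i (pushout_d i z) ->
    exists w, pushout i.+1 (pushout_d i.+1 w - z).
  case: z => x c; case: (cases i) => [ip|ip|ip|ip].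
  - move/(pred_lt _ ip); rewrite /= ip => /rexact[y]; exact: step.
  (* Injectivity of N into the pushout: if (0, c) = (d y, - f y), then y is a boundary by exactness
     of P, and c = 0 since f is a cocycle. *)
  - subst i => /(pred_eq _ erefl) [y]; rewrite /= /pushout_d_fun ltnn eqxx.
    move=> -[/esym/rexact [y' <-] ->]; exists 0; apply/pred_S => //=.
    by rewrite F_d oppr0 subr0 gtn_eqF.
  - by exists 0; apply: pred_gt; rewrite ip.
  - by exists 0; apply: pred_gt; rewrite ltnW.
pose E := quo_resolution DK augK DD augD aug_surj exact0 exactS.
have bound j : (p.+1 < j)%N -> forall x : E j, x = 0.
  by move=> pj; elim/quoW=> x; apply/quo_pi0/pred_gt.
have el := pushout_end_linear.
have e0 z : pushout p.+1 z -> z.2 = 0 by move/pred_S => ->.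
pose e : {linear E p.+1 -> N} := mkLinear (quo_lift_linear el e0).
have eE z : e (quo_pi _ z) = z.2 := quo_lift_pi el e0 z.
have ebij : (0 < p.+1)%N -> bijective e.
  move=> _; exists (fun c => quo_pi _ (0, c)) => [|c]; last exact: eE.
  elim/quoW=> z; rewrite eE; apply/quo_piE/pred_S => //=.
  exact: subrr.
have tl i : linear (fun x : P i => quo_pi (pushout i) (x, F x)).
  by move=> a x y; rewrite -quo_pi_linear F_linear.
(* The chain map from P is x |-> (x, F x); in degree p it commutes with the differentials exactly
   because of the relations (d x, - f x). *)
exists (@Extension R p.+1 M N E bound e ebij).
exists (fun i => mkLinear (tl i)); split=> [i x|x|x].
- rewrite [RHS]quo_d_pi; apply/quo_piE.
  case: (cases i) => [ip|ip|ip|ip].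
  + by apply/pred_lt; rewrite //= ip subrr.
  + apply/pred_eq => //; subst i; exists x; rewrite [LHS]surjective_pairing /= F_d eqxx.
    by rewrite ltnn subr0 sub0r.
  + by subst i; apply/pred_S; rewrite //= F_d gtn_eqF // subr0.
  + exact: pred_gt.
- exact: quo_aug_pi.
- by rewrite [LHS]eE F_f.
Qed.
End Positive.

Lemma extension_exists n (f : {linear P n -> N}) : cocycle f ->
  exists E : extension n M N, represents f E.
Proof. by case: n f => [|p] f; [apply: extension_exists0|apply: extension_existsS]. Qed.
End Extension.

(** * The bracket of the embedded classes *)

Lemma sgn_shifted (R : pzRingType) (M : lmodType R) (m n : nat) (x : M) :
  sgn R ((m%:Z - 1) * (n%:Z - 1)) *: x = sg (~~ odd m && ~~ odd n) x.
Proof.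
have e (p : nat) : odd `|p%:Z - 1|%N = ~~ odd p.
  by case: p => // p; rewrite -addn1 PoszD addrK addn1 /= negbK.
by rewrite /sgn abszM sgE oddM !e.
Qed.

Section HochschildBracket.
Variables (k : fieldType) (A : algType k).
Implicit Types (F G : seq A -> bimod A) (s : seq A).

Lemma eq_hoch_circ m n F F' G G' s : size s = (m + n).-1 ->
  (forall t, size t = m -> F t = F' t) -> (forall t, size t = n -> G t = G' t) ->
  hoch_circ m n F G s = hoch_circ m n F' G' s.
Proof.
move=> es eF eG; apply: eq_bigr => i _; congr (_ *: _).
have im := ltn_ord i.
rewrite eG; last by rewrite size_takel // size_drop es; lia.
by apply: eF; rewrite size_cat /= size_drop size_takel es; lia.
Qed.

(** The vanishing outside the degrees covers m = n = 0, where the Gerstenhaber bracket is an empty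
    sum. *)
Lemma hoch_bracketE m n F G s : size s = (m + n).-1 ->
  (forall t, size t != m -> F t = 0) -> (forall t, size t != n -> G t = 0) ->
  hoch_bracket m n F G s = bracket m n F G s.
Proof.
move=> es F0 G0; rewrite /hoch_bracket /bracket !hoch_circE // ?[(n + m)%N]addnC //.
by rewrite sgn_shifted.
Qed.
End HochschildBracket.

Section LiftBracket.
Variables (k : fieldType) (A : algType k) (H : hopf A) (P : resolution (triv H)).
Variables (Delta : forall n i j, {linear P n -> htens H (P i) (P j)})
  (Delta_diag : diagonal_map Delta).
Variables (m n : nat) (f : {linear P m -> triv H}) (g : {linear P n -> triv H}).
Hypotheses (f_cocycle : cocycle f) (g_cocycle : cocycle g).
Variables (psif psig : forall i j, {linear P i -> P j}).
Hypotheses (psif_lift : homotopy_lifting Delta f psif)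
  (psig_lift : homotopy_lifting Delta g psig).

Lemma lift_bracketE (x : hat P) :
  lift_bracket f g psif psig (x (m + n).-1) = hat_bracket f g psif psig x.
Proof.
by rewrite /lift_bracket sgn_shifted /hat_bracket /hat_f /hat_psi [(n + m)%N]addnC.
Qed.

Lemma lift_bracket_inj x :
  lift_bracket f g psif psig x = hat_bracket f g psif psig (prod_inj x : hat P).
Proof. by rewrite -lift_bracketE prod_injK. Qed.

Lemma lift_bracket_linear : linear (lift_bracket f g psif psig).
Proof.
move=> a x y; rewrite !lift_bracket_inj (@prod_inj_linear _ _ P).
exact: hat_bracket_linear.
Qed.

Lemma lift_bracket_cocycle : cocycle (lift_bracket f g psif psig).
Proof.
move=> x; rewrite lift_bracket_inj -hat_d_inj.
exact: (hat_bracket_d f_cocycle g_cocycle psif_lift psig_lift).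
Qed.

Lemma hat_cochain (iota : seq A -> freebim H (hat P)) p (h : {linear P p -> triv H})
    (F := fun s => kap (fmap (hat_f h) (iota s))) :
  homogeneous_chain iota -> cocycle h ->
  [/\ multilinear F, forall s, hoch_d F s = 0 & forall s, size s != p -> F s = 0].
Proof.
move=> hiota hc; have [il di _ _] := hiota; have hl : linear h := linearP h.
have dk := linear_klin (@hat_d_linear k A H P).
have hk := linear_klin (hat_f_linear hl).
split=> [|s|s sp].
- exact: (multilinear_comp (linear_klinear (kmap (hat_f_linear hl))) il).
- rewrite /F -(kmap_hoch_d (hat_f_linear hl)) -di fmap_comp // (_ : _ \o _ = fun=> 0).
    by rewrite fmap_zero kap0.
  by apply/funext => x; apply: hat_f_d.
- exact: (hat_f_iota hiota hl).
Qed.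

(** F, G and B are replaced by f iota, g iota and the lifted bracket after iota, each up to a
    coboundary, and [hat_comparison] relates these three. *)
Lemma bracket_represented F G B : embeds_to f F -> embeds_to g G ->
  embeds_to (lift_bracket f g psif psig) B ->
  hoch_eq (m + n).-1 B (hoch_bracket m n F G).
Proof.
move=> fF gG bB; have [iota hiota] := @iota_exists k A H P.
have [hF [hFl hFp hFE hF0]] := embeds_cohomologous hiota fF.
have [hG [hGl hGp hGE hG0]] := embeds_cohomologous hiota gG.
have [hB [hBl _ hBE _]] := embeds_cohomologous hiota bB.
have [Fl dF F0] := hat_cochain hiota f_cocycle.
have [Gl dG G0] := hat_cochain hiota g_cocycle.
have [h1 h1l h1E] := bracket_cohomologous Fl Gl hFl hGl dF dG hFp hGp.
have [h2 h2l h2E] := hat_comparison Delta_diag hiota f_cocycle g_cocycle psif_lift psig_lift.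
(* h2 comes from the comparison along iota, hB from the choice of B, and h1 from the choices of F
   and G. *)
pose h s := h2 s + hB s - h1 s.
have hl : multilinear h by apply: multilinear_sub (multilinear_add _ _) _.
have hE s : size s = (m + n).-1 -> B s - hoch_bracket m n F G s = hoch_d h s.
  move=> es; rewrite /hoch_bracket (eq_hoch_circ es hFE hGE).
  rewrite (eq_hoch_circ _ hGE hFE); last by rewrite addnC.
  rewrite -/(hoch_bracket m n _ _ s) hoch_bracketE //; first last.
  - by move=> t tn; rewrite G0 // hG0 // addr0.
  - by move=> t tn; rewrite F0 // hF0 // addr0.
  rewrite h1E // hBE // /h hoch_dB hoch_dD -h2E.
  have -> : hat_f (lift_bracket f g psif psig) = hat_bracket f g psif psig.
    by apply/funext => x; apply: lift_bracketE.
  rewrite -[kmap _ \o _]/(fun s => kap (fmap (hat_f f) (iota s))).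
  rewrite -[kmap _ \o _]/(fun s => kap (fmap (hat_f g) (iota s))).
  by zmod.
rewrite /hoch_eq; case E: (m + n).-1 hE => [|q] hE.
  (* In degree 0 the coboundary is evaluated at [[::]], where it is 0, and equality results. *)
  apply/eqP; rewrite -subr_eq0 hE // hoch_dE /= subr0 addr0 //.
exists h => //; exact: multilinear_hoch.
Qed.
End LiftBracket.

Lemma cocycle_embeds (k : fieldType) (A : algType k) (H : hopf A)
    (P : resolution (triv H)) n (f : {linear P n -> triv H}) :
  cocycle f -> exists F, embeds_to f F.
Proof.
move=> f_cocycle; have [iota hiota] := @iota_exists k A H P.
have [E fE] := extension_exists f_cocycle.
by have [F EF] := represents_embeds hiota fE; exists F; exists E.
Qed.

Theorem theorem4p1
  (k : fieldType) (A : algType k) (H : hopf A)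
  (antipode_bij : bijective (antipode H))
  (P : resolution (triv H)) (P_proj : forall i, projective (P i))
  (Delta : forall n i j, {linear P n -> htens H (P i) (P j)})
  (Delta_diag : diagonal_map Delta)
  (m n : nat) (f : {linear P m -> triv H}) (g : {linear P n -> triv H})
  (f_cocycle : cocycle f) (g_cocycle : cocycle g)
  (psif psig : forall i j, {linear P i -> P j})
  (psif_lift : homotopy_lifting Delta f psif)
  (psig_lift : homotopy_lifting Delta g psig) :
  [/\ cocycle (lift_bracket f g psif psig),
      exists F, embeds_to f F,
      exists G, embeds_to g G,
      exists B, embeds_to (lift_bracket f g psif psig) B
    & forall F G B : seq A -> bimod A,
        embeds_to f F -> embeds_to g G ->
        embeds_to (lift_bracket f g psif psig) B ->
        hoch_eq (m + n).-1 B (hoch_bracket m n F G)].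
Proof.
have bc := lift_bracket_cocycle f_cocycle g_cocycle psif_lift psig_lift.
split=> //; try exact: cocycle_embeds.
  exact: (@cocycle_embeds _ _ _ _ _ (mkLinear (@lift_bracket_linear _ _ _ _ _ _ f g psif psig))).
by move=> F G B; apply: (bracket_represented Delta_diag).
Qed.
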